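(* Let $\gamma>0$, $x_0\in X$, and let the target function $h\in X$ be such that $Ah\in L_2(\Xi)$ (i.e. $h\in D(A)$). Set $f=-Ah$. Then the optimal control problem (P2) of minimizing $$J(u)=\gamma|x(T)-h|^2+\int_0^T|u(t)|^2\,dt$$ over $u\in L_2([0,T],X)$, subject to $x'=Ax+u$, $x(0)=x_0$, admits a unique optimal control $u_*$, given by the feedback law $$u_*(t)=P(T-t)y_*(t)+r(t),$$ where $y_*$ is the unique mild solution of the closed-loop equation $$\begin{cases}y'(t)=(A-P(T-t))y(t)-r(t)+f,\\ y(0)=h-x_0,\end{cases}$$ and $P(\cdot)$, $r(\cdot)$ solve, respectively, the Riccati equation $$\begin{cases}P'(t)=2AP(t)-P^2(t),\\ P(0)=\gamma I,\end{cases}$$ and the backward equation $$\begin{cases}r'(t)+(A-P(T-t))r(t)+P(T-t)f=0,\\ r(T)=0.\end{cases}$$ Moreover, the optimal value is $$J^*=J(u_* )=\langle P(T)y(0),y(0)\rangle+2\langle r(0),y(0)\rangle+\int_0^T\Big[2\langle r(t),f\rangle-|r(t)|^2\Big]dt,$$ where $y(0)=h-x_0$.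
   Context: Let $T>0$, $\rho>0$ be constants, let $\Xi\subset\mathbb{R}^2$ be a bounded open set with regular boundary, and let $X=L_2(\Xi)$ with its usual inner product $\langle\cdot,\cdot\rangle$ and norm $|\cdot|$. Let $A$ be the operator $Ay=(\Delta-\rho)y$ on $X$ with Neumann boundary conditions, i.e. with domain $$D(A)=\Big\{v\in H^1(\Xi):\ \Delta v\in L_2(\Xi),\ \int_\Xi \Delta v\,\psi\,d\xi=-\int_\Xi\langle\nabla v,\nabla\psi\rangle\,d\xi\ \text{ for all }\psi\in H^1(\Xi)\Big\}.$$ It is self-adjoint and generates a strongly continuous semigroup $e^{tA}$ on $X$. The control operator is taken to be the identity, $B=I$. The state $x$ associated with a control $u\in L_2([0,T],X)$ is the mild solution $x(t)=e^{tA}x_0+\int_0^t e^{(t-s)A}u(s)\,ds$. The variable $y(t)=h-x(t)$ is the distance from the target, and is the mild solution of $y'=Ay-u+f$, $y(0)=h-x_0$. All differential equations are understood in the mild sense. In the Riccati equation, $2AP$ stands for $AP+PA$, and $P:[0,T]\to\mathcal{L}(X)$ is the strongly continuous, self-adjoint-valued function satisfying $P(t)x=\gamma e^{2tA}x-\int_0^t e^{(t-s)A}P(s)^2e^{(t-s)A}x\,ds$ for all $x\in X$; $r\in C([0,T],X)$ satisfies $r(t)=\int_t^T e^{(s-t)A}\big[P(T-s)f-P(T-s)r(s)\big]ds$; and a mild solution of the closed-loop equation is $y\in C([0,T],X)$ with $y(t)=e^{tA}(h-x_0)+\int_0^t e^{(t-s)A}\big[-P(T-s)y(s)-r(s)+f\big]ds$.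 *)

(* Defs.v *)
From HB Require Import structures.
From mathcomp Require Import all_boot all_order all_algebra.
From mathcomp Require Import all_classical all_reals all_analysis measurable_realfun.

Set Implicit Arguments.
Unset Strict Implicit.
Unset Printing Implicit Defensive.
Import Order.TTheory GRing.Theory Num.Theory numFieldNormedType.Exports.
Local Open Scope classical_set_scope.
Local Open Scope ring_scope.

(* The library provides the carrier LspaceType2 of the quotient L^2 space but
   neither its vector space structure nor its norm.  Elements coerce to
   functions through a chosen representative, so identities between
   representatives hold almost everywhere. *)
Definition L2 d (T : measurableType d) (R : realType)
  (mu : {measure set T -> \bar R}) := LspaceType2 mu.

Section L2.
Context d (T : measurableType d) (R : realType)
  (mu : {measure set T -> \bar R}).
Implicit Types (f g h : L2 mu) (u v : T -> R).

Local Notation Lfun2 := (LfunType mu (lee1n 2)).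

Definition L2fun f : T -> R := aqEqMfun_to_fun (LebesgueSpace.sort f).

HB.instance Definition _ := gen_eqMixin (L2 mu).
HB.instance Definition _ := gen_choiceMixin (L2 mu).

Lemma L2_Lfun f : L2fun f \in Lfun mu 2%:E.
Proof.
apply/andP; split; rewrite inE /=.
  exact: (@measurable_funPT _ _ _ _ (repr (LebesgueSpace.sort f))).
by case: f => f [[]].
Qed.

Definition L2repr f : Lfun2 := Lfun_Sub (lee1n 2) (L2_Lfun f).

Lemma L2_eqP f g : f = g <-> L2fun f = L2fun g %[ae mu].
Proof.
split=> [->|fg]; first exact: ae_eq_refl.
have e : LebesgueSpace.sort f = LebesgueSpace.sort g.
  have /eqP := introT (ae_eqP (LebesgueSpace.sort f) (LebesgueSpace.sort g)) fg.
  by rewrite !reprK.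
case: f g {fg} e => [f [[cf]]] [g [[cg]]] /= e.
by rewrite -{}e in cg *; rewrite (Prop_irrelevance cf cg).
Qed.

Lemma Lnorm2_ae u v : measurable_fun setT u -> measurable_fun setT v ->
  u = v %[ae mu] ->
  Lnorm mu 2%:E (EFin \o u) = Lnorm mu 2%:E (EFin \o v).
Proof.
move=> mu' mv uv; rewrite unlock /Lnorm; congr (_ `^ _)%E.
have m (w : T -> R) : measurable_fun setT w ->
    measurable_fun setT (fun x : T => poweR (abse (EFin (w x))) 2 : \bar R).
  move=> mw; have mw' : measurable_fun setT (fun x : T => abse (EFin (w x))).
    by apply: measurableT_comp => //; exact/measurable_EFinP.
  exact: (measurableT_comp (measurable_poweR _)).
apply: ae_eq_integral => //; [exact: m|exact: m|].
by apply: filterS uv => x /= /[apply] ->.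
Qed.

Lemma L2_ofP (u : Lfun2) : exists f, L2fun f = u %[ae mu].
Proof.
pose U : {mfun T >-> measurableTypeR R} :=
  HB.pack (u : T -> measurableTypeR R)
    (isMeasurableFun.Build _ _ T (measurableTypeR R) u (measurable_funPT u)).
pose q : {mfun_ mu, T >-> measurableTypeR R} := (\pi_({mfun_ mu, T >-> measurableTypeR R}) U)%qT.
have qu : aqEqMfun_to_fun q = u %[ae mu].
  have : repr q = U %[mod {mfun_ mu, T >-> measurableTypeR R}]%qT by rewrite reprK.
  by move/eqP; rewrite eqmodE => /asboolP.
have fq : finite_norm mu 2%:E q.
  rewrite /finite_norm (@Lnorm2_ae _ u)//; first exact: Lfunction_finite.
  exact: (@measurable_funPT _ _ _ _ (repr q)).
pose F : LspaceType2 mu := HB.pack q (isFinLebesgue.Build _ _ _ _ _ (lee1n 2) q fq).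
by exists (F : L2 mu).
Qed.

Definition L2of (u : Lfun2) : L2 mu := sval (cid (L2_ofP u)).

Lemma L2ofE (u : Lfun2) : L2fun (L2of u) = u %[ae mu].
Proof. by rewrite /L2of; case: cid. Qed.

Definition L2zero : L2 mu := L2of 0.
Definition L2opp f : L2 mu := L2of (- L2repr f).
Definition L2add f g : L2 mu := L2of (L2repr f + L2repr g).
Definition L2scale (a : R) f : L2 mu := L2of (a *: L2repr f).

Fact L2zeroE : L2fun L2zero = (fun=> 0) %[ae mu].
Proof. exact: L2ofE. Qed.
Fact L2oppE f : L2fun (L2opp f) = (fun x => - L2fun f x) %[ae mu].
Proof. exact: L2ofE. Qed.
Fact L2addE f g :
  L2fun (L2add f g) = (fun x => L2fun f x + L2fun g x) %[ae mu].
Proof. exact: L2ofE. Qed.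
Fact L2scaleE a f : L2fun (L2scale a f) = (fun x => a * L2fun f x) %[ae mu].
Proof. exact: L2ofE. Qed.

Fact L2addA : associative L2add.
Proof.
move=> f g h; apply/L2_eqP; near=> x => _.
rewrite (near (L2addE f (L2add g h)) x)// (near (L2addE g h) x)//.
by rewrite (near (L2addE (L2add f g) h) x)// (near (L2addE f g) x)// addrA.
Unshelve. all: by end_near. Qed.

Fact L2addC : commutative L2add.
Proof.
move=> f g; apply/L2_eqP; near=> x => _.
by rewrite (near (L2addE f g) x)// (near (L2addE g f) x)// addrC.
Unshelve. all: by end_near. Qed.

Fact L2add0 : left_id L2zero L2add.
Proof.
move=> f; apply/L2_eqP; near=> x => _.
by rewrite (near (L2addE L2zero f) x)// (near L2zeroE x)// add0r.
Unshelve. all: by end_near. Qed.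

Fact L2addN : left_inverse L2zero L2opp L2add.
Proof.
move=> f; apply/L2_eqP; near=> x => _.
rewrite (near (L2addE (L2opp f) f) x)// (near (L2oppE f) x)//.
by rewrite (near L2zeroE x)// addNr.
Unshelve. all: by end_near. Qed.

HB.instance Definition _ :=
  GRing.isZmodule.Build (L2 mu) L2addA L2addC L2add0 L2addN.

Fact L2scaleA a b f : L2scale a (L2scale b f) = L2scale (a * b) f.
Proof.
apply/L2_eqP; near=> x => _.
rewrite (near (L2scaleE a (L2scale b f)) x)// (near (L2scaleE b f) x)//.
by rewrite (near (L2scaleE (a * b) f) x)// mulrA.
Unshelve. all: by end_near. Qed.

Fact L2scale1 : left_id 1 L2scale.
Proof.
move=> f; apply/L2_eqP; near=> x => _.
by rewrite (near (L2scaleE 1 f) x)// mul1r.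
Unshelve. all: by end_near. Qed.

Fact L2scaleDr : right_distributive L2scale +%R.
Proof.
move=> a f g; apply/L2_eqP; near=> x => _.
rewrite (near (L2scaleE a (f + g)) x)// (near (L2addE f g) x)//.
rewrite (near (L2addE (L2scale a f) (L2scale a g)) x)//.
by rewrite (near (L2scaleE a f) x)// (near (L2scaleE a g) x)// mulrDr.
Unshelve. all: by end_near. Qed.

Fact L2scaleDl f : {morph L2scale^~ f : a b / a + b}.
Proof.
move=> a b; apply/L2_eqP; near=> x => _.
rewrite (near (L2scaleE (a + b) f) x)//.
rewrite (near (L2addE (L2scale a f) (L2scale b f)) x)//.
by rewrite (near (L2scaleE a f) x)// (near (L2scaleE b f) x)// mulrDl.
Unshelve. all: by end_near. Qed.

HB.instance Definition _ := GRing.Zmodule_isLmodule.Build R (L2 mu)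
  L2scaleA L2scale1 L2scaleDr L2scaleDl.

Definition L2norm f : R := fine (Lnorm mu 2%:E (EFin \o L2fun f)).

Fact L2norm_of (u : Lfun2) :
  L2norm (L2of u) = fine (Lnorm mu 2%:E (EFin \o u)).
Proof.
rewrite /L2norm (@Lnorm2_ae _ u)//; last exact: L2ofE.
exact: (@measurable_funPT _ _ _ _ (L2repr _)).
Qed.

Fact L2normD f g : L2norm (f + g) <= L2norm f + L2norm g.
Proof. by rewrite L2norm_of; exact: ler_LnormD. Qed.

Fact L2normZ a f : L2norm (a *: f) = `|a| * L2norm f.
Proof.
rewrite L2norm_of; apply: EFin_inj.
by rewrite EFinM (finite_norm_fine (L2repr f)) -LnormZ finite_norm_fine.
Qed.

Fact L2norm_eq0 f : L2norm f = 0 -> f = 0.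
Proof.
move=> /(@fine_Lnormr_eq0 _ _ _ _ _ _ (L2repr f)) f0.
apply/L2_eqP; near=> x => _.
rewrite (near L2zeroE x)//; exact: (near f0 x).
Unshelve. all: by end_near. Qed.

HB.instance Definition _ := Lmodule_isNormed.Build R (L2 mu)
  L2normD L2normZ L2norm_eq0.

Definition L2dot f g : R := \int[mu]_x (L2fun f x * L2fun g x).

End L2.

Section plane.
Context (R : realType).
Implicit Type Xi : set (R * R).

Lemma open_measurable_plane Xi : open Xi -> measurable Xi.
Proof.
move=> oXi.
pose B (i : rat * rat * nat) : set (R * R) :=
  ball (ratr i.1.1 : R) i.2.+1%:R^-1 `*` ball (ratr i.1.2 : R) i.2.+1%:R^-1.
have -> : Xi = \bigcup_(i in [set i | B i `<=` Xi]) B i.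
  apply/seteqP; split=> [[a b] Xab|x [i /= +]]; last exact.
  move: oXi; rewrite openE => /(_ _ Xab) /nbhs_ballP[e /= e0 eX].
  pose n := Num.truncn (2 / e).
  have ne : n.+1%:R^-1 + n.+1%:R^-1 < e.
    have := truncnS_gt (2 / e); rewrite -/n ltr_pdivrMr// => H.
    by rewrite -mulr2n -[ltLHS]mulr_natl ltr_pdivrMr// mulrC.
  have rb (c : R) : exists q : rat, ball (ratr q : R) n.+1%:R^-1 c.
    have [q] := @rat_in_itvoo R c (c + n.+1%:R^-1) ltac:(by rewrite ltrDl).
    rewrite in_itv /= => /andP[cq qc]; exists q.
    by rewrite /ball /= gtr0_norm ?subr_gt0// ltrBlDl.
  have [q qa] := rb a; have [r rb'] := rb b.
  exists (q, r, n); last by split.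
  move=> [c d] [/= qc rd]; apply: eX; split => /=.
    by apply: (le_ball (ltW ne)); apply: ball_triangle qc; exact: ball_sym.
  by apply: (le_ball (ltW ne)); apply: ball_triangle rd; exact: ball_sym.
rewrite bigcup_mkcond; apply: countable_bigcupT_measurable => // i.
by case: ifPn => // _; apply: measurableX; exact: measurable_ball.
Qed.

Definition plane_measure :
    {measure set (measurableTypeR R * measurableTypeR R) -> \bar R} :=
  (lebesgue_measure \x lebesgue_measure)%E.

Definition domain_measure Xi (oXi : open Xi) :
    {measure set (measurableTypeR R * measurableTypeR R) -> \bar R} :=
  mrestr plane_measure (open_measurable_plane oXi).

(* "Regular" is read as Lipschitz, the weakest of the usual meanings: near
   each boundary point p and in the orthonormal frame (a, b), (- b, a), the set
   Xi is the strict epigraph of a Lipschitz function. *)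
Definition regular_boundary Xi :=
  forall p, (closure Xi `\` interior Xi) p ->
  exists a b r l k : R, exists g : R -> R,
  [/\ a ^+ 2 + b ^+ 2 = 1, 0 < r /\ 0 < l,
      forall s t, `|g s - g t| <= k * `|s - t|,
      forall s, `|s| < r -> `|g s| < l &
      forall s t, `|s| < r -> `|t| < l ->
        Xi (p.1 + s * a - t * b, p.2 + s * b + t * a) <-> g s < t].

Definition iterated_derivative (phi : R * R -> R) (s : seq (R * R)) :
    R * R -> R :=
  foldr (fun e psi x => 'D_e psi x) phi s.

Definition smooth (phi : R * R -> R) :=
  forall s, continuous (iterated_derivative phi s) /\
    forall x e, derivable (iterated_derivative phi s) x e.

Definition test_function Xi (phi : R * R -> R) :=
  smooth phi /\
  exists K, [/\ compact K, K `<=` Xi & forall x, ~ K x -> phi x = 0].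

Definition axis1 : R * R := (1, 0).
Definition axis2 : R * R := (0, 1).

Definition laplacian (phi : R * R -> R) (x : R * R) : R :=
  iterated_derivative phi [:: axis1; axis1] x + iterated_derivative phi [:: axis2; axis2] x.

Section neumann.
Context Xi (oXi : open Xi).
Local Notation mu := (domain_measure oXi).
Implicit Types v w Lv : L2 mu.

Definition weak_partial (e : R * R) v w :=
  forall phi, test_function Xi phi ->
    \int[mu]_x (L2fun v x * 'D_e phi x) = - \int[mu]_x (L2fun w x * phi x).

Definition weak_gradient v (g : L2 mu * L2 mu) :=
  weak_partial axis1 v g.1 /\ weak_partial axis2 v g.2.

Definition weak_laplacian v Lv :=
  forall phi, test_function Xi phi ->
    \int[mu]_x (L2fun v x * laplacian phi x) = \int[mu]_x (L2fun Lv x * phi x).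

(* Graph of A: neumann_op rho v w holds when v belongs to D(A) and A v = w.
   Membership in H^1 is the existence of a weak gradient in L^2. *)
Definition neumann_op (rho : R) v w :=
  exists g Lv,
  [/\ weak_gradient v g, weak_laplacian v Lv,
      forall psi k, weak_gradient psi k ->
        L2dot Lv psi = - (L2dot g.1 k.1 + L2dot g.2 k.2) &
      w = Lv - rho *: v].

End neumann.
End plane.

Section bochner.
Context {R : realType} {V : normedModType R}.
Implicit Types (a b : R) (f : R -> V).
Local Notation leb := (@lebesgue_measure R).

Definition simple_map f :=
  finite_set (range f) /\
  forall v, measurable (f @^-1` [set v] : set (measurableTypeR R)).

Definition simple_integral a b f : V :=
  \sum_(v \in range f) fine (leb (`[a, b] `&` f @^-1` [set v])) *: v.

Definition strongly_measurable a b f :=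
  exists f_ : nat -> R -> V, (forall n, simple_map (f_ n)) /\
    forall t, t \in `[a, b] -> f_ n t @[n --> \oo] --> f t.

Definition is_bochner_integral a b f (z : V) :=
  strongly_measurable a b f /\
  exists f_ : nat -> R -> V,
  [/\ forall n, simple_map (f_ n),
      (\int[leb]_(t in `[a, b]) (`|f t - f_ n t|)%:E)%E @[n --> \oo] --> 0%E &
      simple_integral a b (f_ n) @[n --> \oo] --> z].

(* Junk value 0 when f is not Bochner integrable on [a, b]. *)
Definition bochner_integral a b f : V := xget 0 (is_bochner_integral a b f).

Definition bounded_operator (L : V -> V) := linear L /\ continuous L.

(* Only the values S t with 0 <= t are meaningful. *)
Definition c0_semigroup (S : R -> V -> V) :=
  [/\ forall t, 0 <= t -> bounded_operator (S t),
      forall x, S 0 x = x,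
      forall s t x, 0 <= s -> 0 <= t -> S (s + t) x = S s (S t x) &
      forall x, S t x @[t --> 0^'+] --> x].

(* S is the semigroup e^{tA}, where A is an operator given by its graph. *)
Definition generates (A : V -> V -> Prop) (S : R -> V -> V) :=
  c0_semigroup S /\
  forall v w, A v w <-> (t^-1 *: (S t v - v) @[t --> 0^'+] --> w).

End bochner.

Section control.
Context d (T0 : measurableType d) (R : realType)
  (mu : {measure set T0 -> \bar R}).
Local Notation X := (L2 mu).
Local Notation leb := (@lebesgue_measure R).
Context (S : R -> X -> X) (T : R).
Implicit Types (P : R -> X -> X) (u r y : R -> X) (f h x : X) (gamma : R).

(* The elements of L_2([0, T], X); two controls are identified when they agree
   almost everywhere on [0, T]. *)
Definition control u :=
  strongly_measurable 0 T u /\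
  (\int[leb]_(t in `[0%R, T]) (`|u t| ^+ 2)%:E < +oo)%E.

Definition state (x0 : X) u (t : R) : X :=
  S t x0 + bochner_integral 0 t (fun s => S (t - s) (u s)).

Definition cost gamma h (x0 : X) u : R :=
  gamma * `|state x0 u T - h| ^+ 2 + \int[leb]_(t in `[0, T]) (`|u t| ^+ 2).

Definition optimal_control gamma h (x0 : X) u :=
  control u /\
  forall v, control v -> cost gamma h x0 u <= cost gamma h x0 v.

Definition riccati_solution gamma P :=
  [/\ forall t, t \in `[0, T] -> bounded_operator (P t),
      forall x, {within `[0, T], continuous (fun t => P t x)},
      forall t x z, t \in `[0, T] -> L2dot (P t x) z = L2dot x (P t z) &
      forall t x, t \in `[0, T] ->
        P t x = gamma *: S (2 * t) x
          - bochner_integral 0 t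
              (fun s => S (t - s) (P s (P s (S (t - s) x))))].

Definition backward_solution P f r :=
  {within `[0, T], continuous r} /\
  forall t, t \in `[0, T] ->
    r t = bochner_integral t T
      (fun s => S (s - t) (P (T - s) f - P (T - s) (r s))).

Definition closed_loop_solution P r f (y0 : X) y :=
  {within `[0, T], continuous y} /\
  forall t, t \in `[0, T] ->
    y t = S t y0 + bochner_integral 0 t
      (fun s => S (t - s) (- P (T - s) (y s) - r s + f)).

End control.

Definition is_unique_on {R : realType} {U : Type} (T : R)
    (Q : (R -> U) -> Prop) (z : R -> U) :=
  Q z /\ forall z', Q z' -> forall t, t \in `[0, T] -> z' t = z t.
(* The state space X = L_2(Xi). *)
Notation L2dom oXi := (L2 (domain_measure oXi)).

(* Main.v *)
Require Import Defs.
From HB Require Import structures.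
From mathcomp Require Import all_boot all_order all_algebra.
From mathcomp Require Import all_classical all_reals all_analysis measurable_realfun.
From mathcomp Require Import ring lra.
Set Implicit Arguments.
Unset Strict Implicit.
Unset Printing Implicit Defensive.
Import Order.TTheory GRing.Theory Num.Theory numFieldNormedType.Exports.
Local Open Scope classical_set_scope.
Local Open Scope ring_scope.

(** Since the control operator is the identity, every operator in the problem is
a function of [A], and all the objects have closed forms. Read with a number
[a <= 0] in place of [A], the Riccati equation [p' = 2 a p - p ^ 2],
[p(0) = gamma] is solved by dividing [gamma exp(2 a t)] by
[1 + gamma int_0^t exp(2 a s) ds]. Accordingly, let
[Q(t) = int_0^t S(2 s) ds] ([gramian]) and [N(t) = (1 + gamma Q(t))^-1]
([resolvent]). Each [S(s)] is symmetric, so that [S(2 s) = S(s) S(s)] and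
[Q(t)] are nonnegative and [N(t)] exists by the Lax-Milgram lemma. The
solution is
- [P(t) = gamma S(2 t) N(t)],
- [r(t) = gamma S(T - t) N(T - t) (h - S(T - t) h)],
- [u(t) = S(T - t) p], with [p = gamma N(T) (h - S(T) x0)],
- [y(t) = h - S(t) x0 - S(T - t) Q(t) p].

All these operators commute and [N' = - gamma S(2 t) N ^ 2], whence the three
integral equations follow from the fundamental theorem of calculus
([riccati_equation], [feedforward_rev_equation], [closed_loop_equation]);
[feedback] is the identity [P(T - t) y(t) + r(t) = u(t)]. Uniqueness
is Gronwall's lemma ([riccati_unique], [feedforward_rev_unique],
[closed_loop_unique]); for the Riccati equation the Banach-Steinhaus theorem
first bounds the competing solution uniformly in time.

Optimality does not go through the Riccati equation. The cost is a quadratic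
functional of the control, and [gamma (x(T) - h) = - p] ([optimal_final]) says
that its first variation vanishes at [u]. Therefore
[J(v) = J(u) + gamma |x_v(T) - x_u(T)| ^ 2 + int |v - u| ^ 2]
([objective_split]), which gives both minimality and uniqueness almost
everywhere. The optimal value is [gamma <N(T) z, z>] with
[z = h - S(T) x0]; splitting [z] as [S(T) (h - x0)] plus [h - S(T) h] produces
the three terms of the formula, the integral being
that of the derivative of [gamma <N k, k>] with [k(s) = h - S(s) h]
([quadratic_gap], [optimal_value]).

Three foundations are laid first. The space [L2] is complete (Riesz-Fischer,
[L2_complete]). A strongly measurable function with integrable norm has a
Bochner integral ([bochner_ex]), and this integral commutes with bounded linear
functionals ([bochner_functional]); identities between vector integrals are
therefore tested against vectors and reduce to real integrals. Finally, Green's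
formula makes the Neumann operator symmetric ([neumann_op_sym]), and a
semigroup with a symmetric generator is symmetric ([semigroup_sym]): its
generator has a dense domain, on which [<S(s) v, S(t - s) w>] has derivative
zero in [s]. *)

(** * Inner products and the Lax-Milgram lemma *)

Record inner_product {R : realType} {V : normedModType R} (dot : V -> V -> R) :=
  InnerProduct {
    dotC : forall x y, dot x y = dot y x;
    dot_linearl : forall a x y z, dot (a *: x + y) z = a * dot x z + dot y z;
    dot_self : forall x, dot x x = `|x| ^+ 2 }.

Section inner_product_theory.
Context {R : realType} {V : normedModType R} (dot : V -> V -> R).
Context (ip : inner_product dot).
Implicit Types (x y z : V) (a : R).

Lemma dotDl x y z : dot (x + y) z = dot x z + dot y z.
Proof. by rewrite -[x]scale1r dot_linearl// mul1r scale1r. Qed.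

Lemma dot0l z : dot 0 z = 0.
Proof. by apply: (@addrI _ (dot 0 z)); rewrite -dotDl !addr0. Qed.

Lemma dotZl a x z : dot (a *: x) z = a * dot x z.
Proof. by rewrite -[a *: x]addr0 dot_linearl// dot0l addr0. Qed.

Lemma dotNl x z : dot (- x) z = - dot x z.
Proof. by rewrite -scaleN1r dotZl mulN1r. Qed.

Lemma dotBl x y z : dot (x - y) z = dot x z - dot y z.
Proof. by rewrite dotDl dotNl. Qed.

Lemma dotDr x y z : dot z (x + y) = dot z x + dot z y.
Proof. by rewrite !(dotC ip z) dotDl. Qed.

Lemma dot0r z : dot z 0 = 0. Proof. by rewrite (dotC ip) dot0l. Qed.

Lemma dotZr a x z : dot z (a *: x) = a * dot z x.
Proof. by rewrite !(dotC ip z) dotZl. Qed.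

Lemma dotNr x z : dot z (- x) = - dot z x.
Proof. by rewrite !(dotC ip z) dotNl. Qed.

Lemma dotBr x y z : dot z (x - y) = dot z x - dot z y.
Proof. by rewrite dotDr dotNr. Qed.

Lemma sqr_normD x y : `|x + y| ^+ 2 = `|x| ^+ 2 + 2 * dot x y + `|y| ^+ 2.
Proof. by rewrite -!(dot_self ip) dotDl !dotDr (dotC ip y x); ring. Qed.

Lemma sqr_normB x y : `|x - y| ^+ 2 = `|x| ^+ 2 - 2 * dot x y + `|y| ^+ 2.
Proof. by rewrite sqr_normD dotNr normrN mulrN. Qed.

Lemma cauchy_schwarz x y : `|dot x y| <= `|x| * `|y|.
Proof.
have [->|y0] := eqVneq y 0; first by rewrite dot0r !normr0 mulr0.
have ny : 0 < `|y| by rewrite normr_gt0.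
have ny2 : 0 < `|y| ^+ 2 by rewrite exprn_gt0.
rewrite -(@ler_pXn2r _ 2)// ?nnegrE ?mulr_ge0// real_normK ?num_real// exprMn.
set q := `|y| ^+ 2.
have : 0 <= `|x - (dot x y / q) *: y| ^+ 2 * q by rewrite mulr_ge0// sqr_ge0.
rewrite sqr_normB dotZr normrZ exprMn real_normK ?num_real// -/q.
suff -> : (`|x| ^+ 2 - 2 * (dot x y / q * dot x y) + (dot x y / q) ^+ 2 * q) * q
  = `|x| ^+ 2 * q - dot x y ^+ 2 by rewrite subr_ge0.
by field; rewrite gt_eqF.
Qed.

Lemma dot_ext x y : (forall z, dot x z = dot y z) -> x = y.
Proof.
move=> xy; apply/eqP; rewrite -subr_eq0 -normr_eq0 -sqrf_eq0 -(dot_self ip).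
by rewrite dotBl xy subrr.
Qed.

Lemma cvg_dot {T : Type} (F : set_system T) {FF : Filter F} (f g : T -> V)
    (a b : V) :
  f @ F --> a -> g @ F --> b -> (fun t => dot (f t) (g t)) @ F --> dot a b.
Proof.
move=> fa gb; apply/cvgrPdist_le => /= e e0.
have fa0 : (fun t => `|f t - a| * (`|g t - b| + `|b|) + `|a| * `|g t - b|) @ F
    --> (0 : R).
  rewrite -[X in _ --> X](_ : `|a - a| * (`|b - b| + `|b|) + `|a| * `|b - b| = 0);
    last by rewrite !subrr !normr0 mul0r mulr0 addr0.
  apply: cvgD; apply: cvgM; [| |exact: cvg_cst|].
  - by apply: cvg_norm; apply: cvgB => //; exact: cvg_cst.
  - apply: cvgD; last exact: cvg_cst.
    by apply: cvg_norm; apply: cvgB => //; exact: cvg_cst.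
  - by apply: cvg_norm; apply: cvgB => //; exact: cvg_cst.
move/cvgrPdist_le : fa0 => /(_ _ e0); apply: filterS => t /=.
rewrite sub0r normrN => /ler_normlW; apply: le_trans.
have -> : dot a b - dot (f t) (g t) =
    - (dot (f t - a) (g t) + dot a (g t - b)).
  by rewrite dotBl dotBr; ring.
rewrite normrN (le_trans (ler_normD _ _))// lerD//; last exact: cauchy_schwarz.
rewrite (le_trans (cauchy_schwarz _ _))// ler_wpM2l//.
by rewrite -[X in `|X|](subrK b) ler_normD.
Qed.

End inner_product_theory.

Section linear_pred.
Context {R : realType} {V W : normedModType R} (L : V -> W).
Context (lL : linear L).

Lemma linD x y : L (x + y) = L x + L y.
Proof. by rewrite -[x]scale1r lL !scale1r. Qed.

Lemma lin0 : L 0 = 0.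
Proof. by apply: (@addrI _ (L 0)); rewrite -linD !addr0. Qed.

Lemma linZ a x : L (a *: x) = a *: L x.
Proof. by rewrite -[a *: x]addr0 lL lin0 addr0. Qed.

Lemma linN x : L (- x) = - L x.
Proof. by rewrite -scaleN1r linZ scaleN1r. Qed.

Lemma linB x y : L (x - y) = L x - L y.
Proof. by rewrite linD linN. Qed.

Lemma lin_continuous M : (forall x, `|L x| <= M * `|x|) -> continuous L.
Proof.
pose L' : {linear V -> W} := HB.pack L (GRing.isLinear.Build _ _ _ _ _ lL).
move=> LM; apply: (@bounded_linear_continuous _ _ _ L').
apply/linear_boundedP; near=> r => x; apply: le_trans (LM x) _.
by rewrite ler_wpM2r//; near: r; apply: nbhs_pinfty_ge; rewrite num_real.
Unshelve. all: by end_near. Qed.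

Lemma lin_bounded : continuous L ->
  exists2 M, 0 < M & forall x, `|L x| <= M * `|x|.
Proof.
pose L' : {linear V -> W} := HB.pack L (GRing.isLinear.Build _ _ _ _ _ lL).
move=> cL; have := @continuous_linear_bounded _ _ _ 0 L' (cL 0).
by move=> /linear_boundedP /pinfty_ex_gt0[M M0 H]; exists M.
Qed.

End linear_pred.

Lemma bounded_operator_comp {R : realType} {V : normedModType R} (K L : V -> V) :
  bounded_operator K -> bounded_operator L -> bounded_operator (K \o L).
Proof.
move=> [lK cK] [lL cL]; split=> [a x y|x]; first by rewrite /= lL lK.
by apply: continuous_comp; [exact: cL|exact: cK].
Qed.

Lemma bounded_operatorZ {R : realType} {V : normedModType R} (K : V -> V) c :
  bounded_operator K -> bounded_operator (fun x => c *: K x).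
Proof.
move=> [lK cK]; split=> [a x y|x]; first by rewrite lK scalerDr !scalerA mulrC.
by apply: cvgZl_tmp; exact: cK.
Qed.

Section coercive.
Context {R : realType} {V : completeNormedModType R} (dot : V -> V -> R).
Context (ip : inner_product dot).
Context (B : V -> V).
Context (bB : bounded_operator B) (B1 : forall x, `|x| ^+ 2 <= dot (B x) x).

(** Coercivity bounds [|x| ^ 2] by [<B x, x>], hence by [|B x| |x|]. *)
Lemma coercive_norm x : `|x| <= `|B x|.
Proof.
have [->|x0] := eqVneq x 0; first by rewrite normr0.
have nx : 0 < `|x| by rewrite normr_gt0.
rewrite -(ler_pM2r nx) -expr2 (le_trans (B1 x))//.
by rewrite (le_trans (ler_norm _))// (cauchy_schwarz ip).
Qed.

Lemma coercive_inj : injective B.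
Proof.
move=> x y xy; apply/eqP; rewrite -subr_eq0 -normr_le0.
by rewrite (le_trans (coercive_norm _))// (linB bB.1) xy subrr normr0.
Qed.

(** For a small step [t] the map [x |-> x - t (B x - z)] is a contraction,
because [|w - t B w| ^ 2] is at most [(1 - 2 t + t ^ 2 M ^ 2) |w| ^ 2]; its fixed point
solves [B x = z]. *)
Lemma coercive_surj z : exists x, B x = z.
Proof.
have [M M0 BM] := lin_bounded bB.1 bB.2.
(* the step [t = 1 / (1 + M ^ 2)] makes [t ^ 2 |B w| ^ 2 <= t |w| ^ 2], leaving the factor [1 - t] *)
pose M1 := 1 + M ^+ 2; have M10 : 1 < M1 by rewrite ltrDl exprn_gt0.
pose t := M1^-1; have t0 : 0 < t by rewrite invr_gt0 (lt_trans ltr01).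
have t1 : t < 1 by rewrite invf_lt1 ?(lt_trans ltr01).
pose g x : V := x - t *: (B x - z).
have gE x y : g x - g y = (x - y) - t *: B (x - y).
  by rewrite /g (linB bB.1) opprD addrACA -opprD -scalerBr opprB addrA subrK.
have gL x y : `|g x - g y| ^+ 2 <= (1 - t) * `|x - y| ^+ 2.
  rewrite gE (sqr_normB ip) (dotZr ip) normrZ (gtr0_norm t0) exprMn.
  have h1 : t * `|x - y| ^+ 2 <= t * dot (x - y) (B (x - y)).
    by rewrite ler_pM2l// (dotC ip) B1.
  have h2 : t ^+ 2 * `|B (x - y)| ^+ 2 <= t * `|x - y| ^+ 2.
    rewrite expr2 -mulrA ler_pM2l//.
    apply: (@le_trans _ _ (t * (M ^+ 2 * `|x - y| ^+ 2))).
      by rewrite ler_pM2l// -exprMn lerXn2r ?nnegrE ?mulr_ge0// ltW.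
    by rewrite mulrA ler_piMl ?sqr_ge0// /t mulrC ler_pdivrMr ?mul1r ?lerDr//
      (lt_trans ltr01).
  by move: h1 h2; set a := dot _ _; set b := `|B _| ^+ 2; lra.
pose q := Num.sqrt (1 - t).
have q0 : 0 <= q by exact: sqrtr_ge0.
have gq x y : `|g x - g y| <= q * `|x - y|.
  rewrite -(@ler_pXn2r _ 2)// ?nnegrE ?mulr_ge0// exprMn sqr_sqrtr//.
  by rewrite subr_ge0 ltW.
pose G : {fun [set: V] >-> [set: V]} :=
  HB.pack g (isFun.Build _ _ setT setT g (fun _ _ => I)).
have [x _ xG] : exists2 x, [set: V] x & x = G x.
  apply: banach_fixed_point; [|exact: closedT|by exists 0].
  exists (NngNum q0); split => /=; last by move=> [x y] _ /=; exact: gq.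
  by rewrite -sqrtr1 ltr_sqrt// ltrBlDr ltrDl.
exists x; apply/eqP; rewrite -subr_eq0.
have /eqP : t *: (B x - z) = 0.
  by apply/eqP; rewrite -oppr_eq0; apply/eqP; apply: (@addrI _ x); rewrite addr0 [RHS]xG.
by rewrite scaler_eq0 gt_eqF.
Qed.

End coercive.

(** * The Hilbert space L2 *)

Section L2_hilbert.
Context d (T : measurableType d) (R : realType)
  (mu : {measure set T -> \bar R}).
Implicit Types (f g h : L2 mu).

Lemma L2fun_measurable f : measurable_fun setT (L2fun f).
Proof. exact: (@measurable_funPT _ _ _ _ (L2repr f)). Qed.
Hint Resolve L2fun_measurable : core.

Lemma L2fun_mul_integrable f g :
  mu.-integrable setT (EFin \o (fun x => L2fun f x * L2fun g x)).
Proof.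
by apply/Lfun1_integrable; apply: Lfun2_mul_Lfun1; exact: L2_Lfun.
Qed.

Lemma L2norm_sqr f : (`|f| ^+ 2)%:E = (\int[mu]_x (L2fun f x ^+ 2)%:E)%E.
Proof.
have fE : (`|f|)%:E = Lnorm mu 2%:E (EFin \o L2fun f).
  exact: (finite_norm_fine (L2repr f)).
rewrite -powR_mulrn// -poweR_EFin fE powR_Lnorm//.
by apply: eq_integral => x _ /=; rewrite powR_mulrn// real_normK ?num_real.
Qed.

Lemma L2dot_inner : inner_product (@L2dot _ T R mu).
Proof.
split.
- by move=> f g; apply: eq_Rintegral => x _; rewrite mulrC.
- move=> a f g h; rewrite /L2dot -RintegralZl//; last exact: L2fun_mul_integrable.
  rewrite -RintegralD//; last 2 first.
  + exact: (integrableZl _ _ (L2fun_mul_integrable f h)).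
  + exact: L2fun_mul_integrable.
  congr fine; apply: ae_eq_integral => //.
  + by apply/measurable_EFinP; apply: measurable_funM.
  + apply/measurable_EFinP; apply: measurable_funD; last exact: measurable_funM.
    by apply: measurable_funM => //; exact: measurable_funM.
  near=> x => _; congr EFin.
  rewrite (near (L2addE (a *: f) g) x)// (near (L2scaleE a f) x)//.
  by rewrite mulrDl mulrA.
- by move=> f; apply: EFin_inj; rewrite L2norm_sqr /L2dot /Rintegral fineK //;
    exact: integrable_fin_num (L2fun_mul_integrable f f).
Unshelve. all: by end_near. Qed.

Lemma L2_dist_sqr f g : (`|f - g| ^+ 2)%:E =
  (\int[mu]_x ((L2fun f x - L2fun g x) ^+ 2)%:E)%E.
Proof.
rewrite L2norm_sqr; apply: ae_eq_integral => //.
- by apply/measurable_EFinP; apply: measurable_funX.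
- by apply/measurable_EFinP; apply: measurable_funX; exact: measurable_funB.
near=> x => _; congr EFin; rewrite (near (L2addE f (- g)) x)//.
by rewrite (near (L2oppE g) x).
Unshelve. all: by end_near. Qed.

Lemma L2_ex (u : T -> R) : measurable_fun setT u ->
  (\int[mu]_x (u x ^+ 2)%:E < +oo)%E -> exists f, L2fun f = u %[ae mu].
Proof.
move=> mu' iu.
have uL : u \in Lfun mu 2%:E.
  apply/andP; split; rewrite inE//= /finite_norm unlock poweR_lty//.
  apply: le_lt_trans iu; apply: ge0_le_integral => //=.
  - apply/measurable_EFinP.
    apply: (@measurableT_comp _ _ _ _ _ _ (fun x : R => x `^ 2)%R) => //.
    exact: measurableT_comp.
  - by apply/measurable_EFinP; apply: measurable_funX.
  - by move=> x _; rewrite powR_mulrn// real_normK ?num_real.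
by exists (L2of (Lfun_Sub (lee1n 2) uL)); exact: L2ofE.
Qed.

Section riesz_fischer.
Context (x : nat -> L2 mu).
Context (xS : forall n, `|x n.+1 - x n| <= 4^-1 ^+ n).

Let dx n t := L2fun (x n.+1) t - L2fun (x n) t.

Let mdx n : measurable_fun setT (dx n).
Proof. exact: measurable_funB. Qed.

Lemma rapid_dist n m : `|x (n + m)%N - x n| <= 2 * 4^-1 ^+ n.
Proof.
suff : `|x (n + m)%N - x n| <= (2 - 2 * 4^-1 ^+ m) * 4^-1 ^+ n.
  move/le_trans; apply; rewrite ler_wpM2r ?exprn_ge0//.
  by rewrite gerBl mulr_ge0// exprn_ge0.
elim: m => [|m ih].
  by rewrite addn0 subrr normr0 expr0 mulr_ge0 ?exprn_ge0//; lra.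
rewrite addnS -[_ - x n](subrKA (x (n + m)%N)).
rewrite (le_trans (ler_normD _ _))//.
apply: le_trans (lerD (xS _) ih) _.
rewrite exprD mulrC -mulrDl ler_wpM2r ?exprn_ge0// exprS.
have : 0 <= (4^-1 : R) ^+ m by rewrite exprn_ge0.
set a := _ ^+ m; lra.
Qed.

(** The weighted series of [4 ^ n |x n.+1 - x n| ^ 2] has a finite integral,
so it is finite almost everywhere. Where it is, its terms are bounded, and the
increments are dominated by the geometric series of ratio 1/2. *)
Lemma rapid_ae_cvg : {ae mu, forall t, cvgn (fun n => L2fun (x n) t)}.
Proof.
(* the squares decay like 16 ^ - n in the mean, so the weight 4 ^ n keeps them summable *)
pose F n t : \bar R := (4 ^+ n * dx n t ^+ 2)%:E.
have mF n : measurable_fun setT (F n).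
  apply/measurable_EFinP; apply: measurable_funM => //.
  exact: measurable_funX.
have F0 n t : (0 <= F n t)%E by rewrite lee_fin mulr_ge0 ?sqr_ge0 ?exprn_ge0.
have iF : mu.-integrable setT (fun t => \sum_(0 <= n <oo) F n t)%E.
  apply/integrableP; split; first exact: ge0_emeasurable_sum.
  under eq_integral do rewrite gee0_abs ?nneseries_ge0//.
  rewrite integral_nneseries//.
  apply: (@le_lt_trans _ _ (\sum_(0 <= n <oo) (geometric 1 4^-1 n)%:E)%E).
    apply: lee_nneseries => [n _ _|n _]; first exact: integral_ge0.
    under eq_integral do rewrite /F EFinM.
    rewrite ge0_integralZl//; last 2 first.
    - by apply/measurable_EFinP; apply: measurable_funX.
    - by move=> t _; rewrite lee_fin sqr_ge0.
    rewrite -L2_dist_sqr -EFinM lee_fin /= mul1r.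
    apply: (@le_trans _ _ (4 ^+ n * (4^-1 ^+ n) ^+ 2)).
      by rewrite ler_wpM2l ?exprn_ge0// lerXn2r ?nnegrE ?exprn_ge0.
    by rewrite expr2 mulrA -exprMn mulfV// expr1n mul1r.
  have /cvg_lim gl : (\sum_(0 <= k < n) (geometric 1 4^-1 k)%:E)%E
     @[n --> \oo] --> (limn (series (geometric 1 (4^-1 : R))))%:E.
    under eq_fun do rewrite sumEFin.
    apply: cvg_EFin; first exact: nearW.
    by apply: is_cvg_geometric_series; rewrite ger0_norm//; lra.
  by rewrite gl// ltry.
have := integrable_ae measurableT iF.
apply: filterS => t /(_ I) Ft.
set S := (\sum_(0 <= n <oo) F n t)%E in Ft.
have S0 : (0 <= S)%E by apply: nneseries_ge0.
have dxS n : `|dx n t| <= geometric (Num.sqrt (fine S)) 2^-1 n.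
  rewrite -(@ler_pXn2r _ 2)// ?nnegrE ?mulr_ge0 ?sqrtr_ge0 ?exprn_ge0//.
  rewrite real_normK ?num_real// exprMn sqr_sqrtr ?fine_ge0//.
  have : (F n t <= S)%E.
    have := @nneseries_lim_ge _ (fun k => F k t) xpredT 0 n.+1.
    move=> /(_ (fun k _ _ => F0 k t)).
    apply: le_trans; rewrite big_nat_recr//= leeDr//.
    by apply: sume_ge0 => k _.
  rewrite -(fineK Ft) lee_fin /= => H.
  have -> : dx n t ^+ 2 = (4 ^+ n * dx n t ^+ 2) * (2^-1 ^+ n) ^+ 2.
    rewrite -exprM mulnC exprM mulrAC -exprMn.
    by rewrite (_ : 4 * 2^-1 ^+ 2 = 1 :> R) ?expr1n ?mul1r//; field.
  by rewrite ler_wpM2r// sqr_ge0.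
have -> : (fun n => L2fun (x n) t) =
    (fun n => L2fun (x 0%N) t + series (fun n => dx n t) n).
  apply/funext => n; rewrite /series /=.
  elim: n => [|n ih]; first by rewrite big_geq// addr0.
  by rewrite big_nat_recr//= addrA -ih addrC subrK.
apply: is_cvgD; first exact: is_cvg_cst.
apply: normed_cvg; apply: series_le_cvg dxS _ => //.
- by move=> n; rewrite mulr_ge0 ?sqrtr_ge0 ?exprn_ge0.
- by apply: is_cvg_geometric_series; rewrite ger0_norm//; lra.
Qed.

(** The pointwise limit is within the stated distance of each term of the
sequence by Fatou's lemma; the case [n = 0] also shows that it is square
integrable. *)
Lemma rapid_cvg : exists l, forall n, `|l - x n| <= 2 * 4^-1 ^+ n.
Proof.
pose l0 t := fine (limn_esup (fun n => (L2fun (x n) t)%:E)).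
have ml0 : measurable_fun setT l0.
  apply: (measurableT_comp (fine_measurable measurableT)).
  by apply: measurable_fun_limn_esup => n; exact/measurable_EFinP.
have l0E : {ae mu, forall t, L2fun (x n) t @[n --> \oo] --> l0 t}.
  move: rapid_ae_cvg; apply: filterS => t ct.
  have := ct; rewrite /l0.
  have /cvg_limn_einf_sup [_ ->] // : (L2fun (x n) t)%:E @[n --> \oo] -->
      (limn (fun n => L2fun (x n) t))%:E.
  by apply: cvg_EFin => //; exact: nearW.
have fat n : (\int[mu]_t ((l0 t - L2fun (x n) t) ^+ 2)%:E <=
    ((2 * 4^-1 ^+ n) ^+ 2)%:E)%E.
  pose g m t : \bar R := ((L2fun (x m) t - L2fun (x n) t) ^+ 2)%:E.
  have mg m : measurable_fun setT (g m).
    by apply/measurable_EFinP; apply: measurable_funX; exact: measurable_funB.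
  rewrite (@ae_eq_integral _ _ _ mu setT (fun t => limn_einf (g^~ t)))//.
  - apply: le_trans (fatou mu measurableT mg _) _.
      by move=> m t _; rewrite lee_fin sqr_ge0.
    rewrite limn_einf_lim; apply: lime_le; first exact: is_cvg_einfs.
    exists n => // m /= nm.
    apply: (@le_trans _ _ (\int[mu]_t g m t)%E).
      by apply: ereal_inf_lbound; exists m => /=.
    rewrite -L2_dist_sqr lee_fin lerXn2r ?nnegrE ?mulr_ge0 ?exprn_ge0//.
    by rewrite -(subnKC nm) rapid_dist.
  - by apply/measurable_EFinP; apply: measurable_funX; exact: measurable_funB.
  - rewrite (_ : (fun t => limn_einf (g^~ t)) =
        (fun t => - limn_esup (fun m => - g m t))%E).
      apply: measurableT_comp => //; apply: measurable_fun_limn_esup => m.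
      exact: measurableT_comp.
    by apply/funext => t; rewrite -[LHS]oppeK -limn_esupN.
  near=> t => _; apply/esym.
  have lt : L2fun (x m) t @[m --> \oo] --> l0 t by near: t.
  have /cvg_limn_einf_sup [] // : g m t @[m --> \oo] -->
      ((l0 t - L2fun (x n) t) ^+ 2)%:E.
  apply: cvg_EFin; first exact: nearW.
  have h : L2fun (x m) t - L2fun (x n) t @[m --> \oo] --> l0 t - L2fun (x n) t.
    by apply: cvgB => //; exact: cvg_cst.
  exact: (cvgM h h).
have mk : measurable_fun setT (fun t => l0 t - L2fun (x 0%N) t).
  exact: measurable_funB.
have [k kE] := L2_ex mk (le_lt_trans (fat 0%N) (ltry _)).
exists (k + x 0%N) => n.
rewrite -(@ler_pXn2r _ 2)// ?nnegrE ?mulr_ge0 ?exprn_ge0// -lee_fin.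
apply: le_trans (fat n); rewrite L2_dist_sqr le_eqVlt; apply/orP; left.
apply/eqP; apply: ae_eq_integral => //.
- by apply/measurable_EFinP; apply: measurable_funX; exact: measurable_funB.
- by apply/measurable_EFinP; apply: measurable_funX; exact: measurable_funB.
near=> t => _; rewrite (near (L2addE k (x 0%N)) t)// (near kE t)//.
by rewrite subrK.
Unshelve. all: by end_near. Qed.

End riesz_fischer.

(** A Cauchy filter contains balls of radius [4 ^ - n / 2], whose centres
form a rapidly convergent sequence. *)
Lemma L2_complete (F : set_system (L2 mu)) : ProperFilter F -> cauchy F -> cvg F.
Proof.
move=> FF /cauchyP cF.
have e0 n : 0 < 2^-1 * (4^-1 : R) ^+ n by rewrite mulr_gt0 ?exprn_gt0.
pose x n := sval (cid (cF _ (e0 n))).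
have xF n : F (ball (x n) (2^-1 * 4^-1 ^+ n)) by rewrite /x; case: cid.
have xS n : `|x n.+1 - x n| <= 4^-1 ^+ n.
  have [z [z1 z2]] := filter_ex (filterI (xF n) (xF n.+1)).
  move: z1 z2; rewrite -!ball_normE /= => z1 z2.
  rewrite -(subrKA z) (le_trans (ler_normD _ _))// (distrC z).
  apply: le_trans (lerD (ltW z2) (ltW z1)) _.
  have : 0 <= (4^-1 : R) ^+ n by rewrite exprn_ge0.
  by rewrite exprS; set a := _ ^+ n; lra.
have [l lx] := rapid_cvg xS.
apply/cvg_ex; exists l; apply/cvgrPdist_le => /= e e_gt0.
have [n ne] : exists n, 3 * 4^-1 ^+ n <= e.
  have : 3 * (4^-1 : R) ^+ n @[n --> \oo] --> (3 * 0 : R).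
    by apply: cvgM; [exact: cvg_cst|apply: cvg_expr; rewrite ger0_norm//; lra].
  rewrite mulr0 => /cvgrPdist_le /(_ _ e_gt0) [n _ /(_ n (leqnn n))].
  rewrite /= sub0r normrN ger0_norm ?mulr_ge0 ?exprn_ge0//.
  by exists n.
apply: filterS (xF n) => z; rewrite -ball_normE /= => xz.
rewrite -(subrKA (x n)) (le_trans (ler_normD _ _))//.
apply: le_trans (lerD (lx n) (ltW xz)) _; apply: le_trans ne.
have : 0 <= (4^-1 : R) ^+ n by rewrite exprn_ge0.
by set a := _ ^+ n; lra.
Qed.

HB.instance Definition _ := isPointed.Build (L2 mu) 0.
HB.instance Definition _ := Uniform_isComplete.Build (L2 mu) L2_complete.

End L2_hilbert.

(** * Simple maps and strong measurability *)

Section simple_maps.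
Import HBNNSimple.
Context {R : realType}.
Local Notation leb := (@lebesgue_measure R).
Implicit Types (a b : R).

(** The main source of new simple maps: a level set of the image is a finite
union of intersections of level sets. *)
Lemma simple_map2 (U V W : normedModType R) (f : R -> U) (g : R -> V)
    (phi : U -> V -> W) :
  simple_map f -> simple_map g -> simple_map (fun t => phi (f t) (g t)).
Proof.
move=> [ff mf] [fg mg]; split.
  apply: (@sub_finite_set _ _ [set phi u v | u in range f & v in range g]).
    by move=> _ [t _ <-]; exists (f t); [exists t|exists (g t); [exists t|]].
  exact: finite_image2.
move=> w; pose D := [set p : U * V | [/\ range f p.1, range g p.2 & phi p.1 p.2 = w]].
rewrite (_ : _ @^-1` _ = \bigcup_(p in D) (f @^-1` [set p.1] `&` g @^-1` [set p.2])).
  apply: fin_bigcup_measurable => [|p _]; last exact: measurableI.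
  apply: (@sub_finite_set _ _ (range f `*` range g)); first by move=> p [].
  exact: finite_setX.
apply/seteqP; split=> [t /= tw|t [p [_ _ <-] /= [-> ->]]//].
by exists (f t, g t) => //; split => //=; exists t.
Qed.

Lemma simple_map1 (U W : normedModType R) (f : R -> U) (phi : U -> W) :
  simple_map f -> simple_map (phi \o f).
Proof. by move=> sf; apply: (simple_map2 (fun u _ => phi u) sf sf). Qed.

Lemma simple_map_measurable (f : R -> R) D : simple_map f ->
  measurable_fun (D : set (measurableTypeR R)) f.
Proof.
move=> [ff mf]; apply: (@measurable_funS _ _ _ _ setT) => // _ Y mY.
rewrite setTI (_ : _ @^-1` _ = \bigcup_(v in range f `&` Y) f @^-1` [set v]).
  by apply: fin_bigcup_measurable => //; exact: finite_setIl.
apply/seteqP; split => [t /= Yt|t [v [_ Yv] /= ->]//].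
by exists (f t) => //; split => //; exists t.
Qed.

Lemma simple_map_indic (E : set (measurableTypeR R)) : measurable E ->
  simple_map (\1_E : R -> R).
Proof.
move=> mE; split.
  apply: (@sub_finite_set _ _ [set 0; 1]); last by [].
  by move=> _ [t _ <-] /=; rewrite indicE; case: (_ \in _); [right|left].
move=> v; rewrite -[_ @^-1` _]setTI.
by apply: measurable_indic.
Qed.

Lemma simple_map_integrable a b (f : R -> R) : simple_map f ->
  leb.-integrable `[a, b] (EFin \o f).
Proof.
move=> sf; apply: measurable_bounded_integrable => //.
- by rewrite /= lebesgue_measure_itv /=; case: ifP => // _; rewrite -EFinB ltry.
- exact: simple_map_measurable.
have [M fM] : exists M, forall t, `|f t| <= M.
  exists (\sum_(v \in range f) `|v|) => t.
  rewrite (fsbig_finite _ _ sf.1) /= (bigD1_seq (f t)) ?finmap.fset_uniq//=.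
    by rewrite lerDl sumr_ge0.
  by rewrite (in_fset_set sf.1) inE; exists t.
exists M; split; first exact: num_real.
by move=> x Mx t _ /=; rewrite (le_trans (fM t))// ltW.
Qed.

(** Stated for an arbitrary real function of the values, so that it serves for
all functionals of a simple map at once. *)
Lemma simple_map_sum (V : normedModType R) a b (f : R -> V) (psi : V -> R) :
  simple_map f ->
  \int[leb]_(t in `[a, b]) psi (f t) =
  \sum_(v \in range f) fine (leb (`[a, b] `&` f @^-1` [set v])) * psi v.
Proof.
move=> sf; have fE t : psi (f t) =
    \sum_(v <- finmap.enum_fset (fset_set (range f)))
      psi v * \1_(f @^-1` [set v]) t.
  rewrite (bigD1_seq (f t)) ?finmap.fset_uniq//=; last first.
    by rewrite (in_fset_set sf.1) inE; exists t.
  rewrite indicE mem_set// mulr1 big1 ?addr0// => v vt.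
  by rewrite indicE memNset ?mulr0//= => /esym /eqP; rewrite (negbTE vt).
have mI (v : V) : simple_map (fun t => psi v * \1_(f @^-1` [set v]) t).
  by apply: (simple_map1 (fun x : R => psi v * x)); apply: simple_map_indic; exact: sf.2.
rewrite (fsbig_finite _ _ sf.1) /= /Rintegral.
under eq_integral do rewrite fE -sumEFin.
rewrite integral_sum//=; last by move=> v; exact: simple_map_integrable.
transitivity (fine (\sum_(v <- finmap.enum_fset (fset_set (range f)))
    (fine (leb (`[a, b] `&` f @^-1` [set v])) * psi v)%:E)%E); last first.
  by rewrite sumEFin.
congr fine; apply: eq_bigr => v _.
rewrite -[LHS]fineK; last first.
  by apply: integrable_fin_num => //; exact: simple_map_integrable.
congr EFin; rewrite -[LHS]/(Rintegral _ _ _) RintegralZl//.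
  by rewrite mulrC /Rintegral integral_indic// 1?setIC//; exact: sf.2.
by apply: simple_map_integrable; apply: simple_map_indic; exact: sf.2.
Qed.

Lemma simple_integral_functional (V : normedModType R) a b (f : R -> V)
    (l : V -> R) : linear (l : V -> R^o) -> simple_map f ->
  l (simple_integral a b f) = \int[leb]_(t in `[a, b]) l (f t).
Proof.
move=> ll sf; rewrite simple_map_sum// /simple_integral !(fsbig_finite _ _ sf.1) /=.
elim/big_ind2: _ => [|x y u v <- <-|v _].
- exact: (lin0 ll).
- exact: (linD ll).
- exact: (linZ ll).
Qed.

(** Only sequential continuity at the pairs of values taken is asked for, so that
the lemma applies to [(s, v) |-> S(T - s) v] for a strongly continuous [S]. *)
Lemma strongly_measurable2 (U V W : normedModType R) a b (f : R -> U)
    (g : R -> V) (phi : U -> V -> W) :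
  strongly_measurable a b f -> strongly_measurable a b g ->
  (forall t (u : U^nat) (v : V^nat), t \in `[a, b] -> u @ \oo --> f t ->
     v @ \oo --> g t -> phi (u n) (v n) @[n --> \oo] --> phi (f t) (g t)) ->
  strongly_measurable a b (fun t => phi (f t) (g t)).
Proof.
move=> [f_ [sf fE]] [g_ [sg gE]] cphi.
exists (fun n t => phi (f_ n t) (g_ n t)); split.
  by move=> n; exact: simple_map2.
by move=> t tab; apply: cphi => //; [exact: fE|exact: gE].
Qed.

Lemma strongly_measurable1 (U W : normedModType R) a b (f : R -> U)
    (phi : U -> W) : strongly_measurable a b f -> continuous phi ->
  strongly_measurable a b (phi \o f).
Proof.
move=> sf cphi; apply: (strongly_measurable2 (phi := fun u _ => phi u) sf sf).
by move=> t u v _ ut _; apply: continuous_cvg => //; exact: cphi.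
Qed.

Lemma strongly_measurable_measurable a b (f : R -> R) :
  strongly_measurable a b f ->
  measurable_fun (`[a, b]%classic : set (measurableTypeR R)) f.
Proof.
move=> [f_ [sf fE]]; apply: (@measurable_fun_cvg _ _ _ _ f_).
  by move=> m; exact: simple_map_measurable.
by move=> t tab; apply: fE; rewrite inE in tab *.
Qed.

(** A nonnegative measurable function is a limit of simple ones, and [t - a] is
nonnegative on the interval. *)
Lemma strongly_measurable_id a b : strongly_measurable a b (id : R -> R).
Proof.
pose D : set (measurableTypeR R) := `[a, b]%classic.
have mD : measurable D by exact: measurable_itv.
pose h (t : measurableTypeR R) : \bar R := (t - a)%:E.
have mh : measurable_fun D h.
  apply/measurable_EFinP; apply: measurable_funB => //.
have h0 t : D t -> (0 <= h t)%E.
  by rewrite /D /= in_itv /= lee_fin subr_ge0 => /andP[].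
exists (fun n t => a + nnsfun_approx mD mh n t); split=> [n|t tab].
  apply: (simple_map1 (fun x : R => a + x)); split.
    exact: (@fimfunP _ _ (nnsfun_approx mD mh n)).
  by move=> v; exact: measurable_funPTI.
rewrite -[X in _ --> X](subrKC a); apply: cvgD; first exact: cvg_cst.
have Dt : D t by [].
have := cvg_nnsfun_approx mD mh h0 Dt.
by move/fine_cvg.
Qed.

Lemma strongly_measurable_continuous (U : normedModType R) a b (f : R -> U) :
  continuous f -> strongly_measurable a b f.
Proof.
by move=> cf; exact: (strongly_measurable1 (strongly_measurable_id a b) cf).
Qed.

Lemma strongly_measurable_eq (U : normedModType R) a b (f g : R -> U) :
  (forall t, t \in `[a, b] -> f t = g t) ->
  strongly_measurable a b f -> strongly_measurable a b g.
Proof.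
move=> fg [f_ [sf fE]]; exists f_; split => // t tab.
by rewrite -fg//; exact: fE.
Qed.

Lemma strongly_measurable_norm (U : normedModType R) a b (f : R -> U) :
  strongly_measurable a b f ->
  measurable_fun (`[a, b]%classic : set (measurableTypeR R)) (fun t => `|f t|).
Proof.
move=> sf; apply: strongly_measurable_measurable.
by apply: (strongly_measurable1 (phi := fun u : U => `|u| : R) sf); exact: norm_continuous.
Qed.

Lemma strongly_measurableB (U : normedModType R) a b (f g : R -> U) :
  strongly_measurable a b f -> strongly_measurable a b g ->
  strongly_measurable a b (fun t => f t - g t).
Proof.
move=> sf sg; apply: (strongly_measurable2 (phi := fun u v => u - v) sf sg).
by move=> t u v _ ut vt; exact: cvgB.
Qed.

End simple_maps.

(** * The Bochner integral *)

Section real_integrable.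
Context d (T : measurableType d) (R : realType) (mu : {measure set T -> \bar R}).
Context (D : set T) (mD : measurable D).
Implicit Types f g : T -> R.

Lemma RintegrableD f g : mu.-integrable D (EFin \o f) ->
  mu.-integrable D (EFin \o g) -> mu.-integrable D (EFin \o (fun t => f t + g t)).
Proof. by move=> fi gi; exact: (integrableD mD fi gi). Qed.

Lemma RintegrableB f g : mu.-integrable D (EFin \o f) ->
  mu.-integrable D (EFin \o g) -> mu.-integrable D (EFin \o (fun t => f t - g t)).
Proof. by move=> fi gi; exact: (integrableB mD fi gi). Qed.

Lemma RintegrableZl c f : mu.-integrable D (EFin \o f) ->
  mu.-integrable D (EFin \o (fun t => c * f t)).
Proof. exact: integrableZl. Qed.

Lemma RintegrableZr c f : mu.-integrable D (EFin \o f) ->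
  mu.-integrable D (EFin \o (fun t => f t * c)).
Proof. exact: integrableZr. Qed.

Lemma Rintegrable_eq f g : (forall t, D t -> f t = g t) ->
  mu.-integrable D (EFin \o f) -> mu.-integrable D (EFin \o g).
Proof.
by move=> fg; apply: eq_integrable => // t; rewrite inE => Dt /=; rewrite fg.
Qed.

Lemma Rintegrable_le f g : measurable_fun D f -> mu.-integrable D (EFin \o g) ->
  (forall t, D t -> `|f t| <= g t) -> mu.-integrable D (EFin \o f).
Proof.
move=> mf ig fg; apply: le_integrable ig => //; first exact/measurable_EFinP.
by move=> t Dt /=; rewrite lee_fin (le_trans (fg _ Dt))// ler_norm.
Qed.

End real_integrable.

Section bochner_theory.
Context {R : realType} {V : completeNormedModType R} (dot : V -> V -> R).
Context (ip : inner_product dot).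
Local Notation leb := (@lebesgue_measure R).
Implicit Types (a b : R) (f g : R -> V) (l : V -> R).

Let mI a b : measurable (`[a, b]%classic : set (measurableTypeR R)).
Proof. exact: measurable_itv. Qed.

Definition bochner_integrable a b f :=
  strongly_measurable a b f /\
  leb.-integrable `[a, b] (EFin \o (fun t => `|f t|)).

Lemma bochner_integrableP a b f : strongly_measurable a b f ->
  (\int[leb]_(t in `[a, b]) (`|f t|)%:E < +oo)%E -> bochner_integrable a b f.
Proof.
move=> sf fi; split => //; apply/integrableP; split.
  by apply/measurable_EFinP; exact: strongly_measurable_norm.
by under eq_integral do rewrite /= normr_id.
Qed.

Lemma bochner_integrable_le a b f (g : R -> R) : strongly_measurable a b f ->
  leb.-integrable `[a, b] (EFin \o g) ->
  (forall t, t \in `[a, b] -> `|f t| <= g t) -> bochner_integrable a b f.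
Proof.
move=> sf ig fg; split=> //; apply: le_integrable ig => //.
  by apply/measurable_EFinP; exact: strongly_measurable_norm.
by move=> t tab /=; rewrite lee_fin normr_id (le_trans (fg _ _))// ler_norm.
Qed.

Lemma bochner_integrable_eq a b f g : (forall t, t \in `[a, b] -> f t = g t) ->
  bochner_integrable a b f -> bochner_integrable a b g.
Proof.
move=> fg [sf fi]; apply: bochner_integrable_le fi _.
  exact: strongly_measurable_eq sf.
by move=> t tab; rewrite fg.
Qed.

Lemma simple_bochner_integrable a b f : simple_map f -> bochner_integrable a b f.
Proof.
move=> sf; split; last by apply: simple_map_integrable; exact: simple_map1.
by exists (fun=> f); split => // t _; exact: cvg_cst.
Qed.

Lemma bochner_integrableD a b c f g : bochner_integrable a b f ->
  bochner_integrable a b g -> bochner_integrable a b (fun t => c *: f t + g t).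
Proof.
move=> [sf fi] [sg gi].
apply: (@bochner_integrable_le _ _ _ (fun t => `|c| * `|f t| + `|g t|)).
- apply: (strongly_measurable2 (phi := fun u v => c *: u + v) sf sg).
  by move=> t u v _ ut vt; apply: cvgD => //; exact: cvgZl_tmp.
- by apply: RintegrableD => //; exact: RintegrableZl.
- by move=> t _; rewrite (le_trans (ler_normD _ _))// normrZ.
Qed.

Lemma bochner_integrableB a b f g : bochner_integrable a b f ->
  bochner_integrable a b g -> bochner_integrable a b (fun t => f t - g t).
Proof.
move=> fi gi; apply: (@bochner_integrable_eq _ _ (fun t => -1 *: g t + f t)).
  by move=> t _; rewrite scaleN1r addrC.
exact: bochner_integrableD.
Qed.

Lemma functional_integrable a b f l : linear (l : V -> R^o) ->
  (exists M, forall x, `|l x| <= M * `|x|) -> bochner_integrable a b f ->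
  leb.-integrable `[a, b] (EFin \o (l \o f)).
Proof.
move=> ll [M lM] [sf fi].
apply: (Rintegrable_le (mI a b) _ (RintegrableZl (mI a b) M fi)) => //.
  apply: strongly_measurable_measurable.
  by apply: (strongly_measurable1 (phi := l : V -> R^o) sf); exact: lin_continuous lM.
by move=> t _ /=.
Qed.

(** Testing against [z] is the instance of bounded functionals that
separates vectors. *)
Lemma dot_functional z : linear (dot ^~ z : V -> R^o) /\
  exists M, forall x, `|dot x z| <= M * `|x|.
Proof.
split; first by move=> c x y; rewrite (dot_linearl ip).
by exists `|z| => x; rewrite mulrC (cauchy_schwarz ip).
Qed.

Lemma dot_integrable a b f z : bochner_integrable a b f ->
  leb.-integrable `[a, b] (EFin \o (fun t => dot (f t) z)).
Proof.
by move=> fi; have [ll lM] := dot_functional z; exact: (functional_integrable ll lM fi).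
Qed.

Lemma norm_le_dot (D : V) c : dot D D <= c * `|D| -> 0 <= c -> `|D| <= c.
Proof.
move=> Dc c0; have [->|D0] := eqVneq D 0; first by rewrite normr0.
by rewrite -(@ler_pM2r _ `|D|) ?normr_gt0// -expr2 -(dot_self ip).
Qed.

Lemma simple_integral_dist a b f g : simple_map f -> simple_map g ->
  `|simple_integral a b f - simple_integral a b g| <=
  \int[leb]_(t in `[a, b]) `|f t - g t|.
Proof.
move=> sf sg; set D := _ - _; have [ll lM] := dot_functional D.
have fi := simple_bochner_integrable a b sf.
have gi := simple_bochner_integrable a b sg.
have fgi := bochner_integrableB fi gi.
apply: norm_le_dot; last by apply: Rintegral_ge0 => t _.
rewrite {1}/D (dotBl ip) !(@simple_integral_functional _ _ _ _ _ (dot ^~ D))//.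
rewrite -RintegralB//; [|exact: dot_integrable|exact: dot_integrable].
rewrite -RintegralZr//; last exact: fgi.2.
apply: le_Rintegral => //.
- apply: (Rintegrable_eq (mI a b) (f := fun t => dot (f t - g t) D)) => //.
    by move=> t _ /=; rewrite (dotBl ip).
  exact: (dot_integrable D fgi).
- by apply: RintegrableZr => //; exact: fgi.2.
- move=> t _ /=; rewrite -(dotBl ip) (le_trans (ler_norm _))//.
  exact: (cauchy_schwarz ip).
Qed.

(** The approximating simple maps need not be dominated; each of them is
truncated to the set where its norm is at most twice that of [f], after which
the dominated convergence theorem applies with [3 |f|]. *)
Lemma bochner_approx a b f : bochner_integrable a b f ->
  exists2 f_ : nat -> R -> V, (forall n, simple_map (f_ n)) &
  (\int[leb]_(t in `[a, b]) (`|f t - f_ n t|)%:E)%E @[n --> \oo] --> 0%E.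
Proof.
move=> [sf fi]; have [s_ [ss sE]] := sf.
pose D : set (measurableTypeR R) := `[a, b]%classic.
pose E n : set (measurableTypeR R) := D `&` [set t | `|s_ n t| <= 2 * `|f t|].
have mE n : measurable (E n).
  have m1 : measurable_fun D (fun t => `|s_ n t|).
    by apply: simple_map_measurable; exact: simple_map1.
  have m2 : measurable_fun D (fun t => 2 * `|f t|).
    by apply: measurable_funM => //; exact: strongly_measurable_norm.
  exact: (measurable_fun_le (mI a b) m1 m2).
pose f_ n t : V := (\1_(E n) t : R) *: s_ n t.
have sf_ n : simple_map (f_ n).
  apply: (simple_map2 (fun (c : R) v => c *: v)) => //.
  exact: simple_map_indic.
exists f_ => //.
have bd n t : D t -> `|f_ n t| <= 2 * `|f t|.
  move=> Dt; rewrite /f_ indicE; case: (boolP (t \in E n)) => [|_]; last first.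
    by rewrite scale0r normr0 mulr_ge0.
  by rewrite inE scale1r => -[].
have f_f t : D t -> f_ n t @[n --> \oo] --> f t.
  move=> Dt; have st : s_ n t @[n --> \oo] --> f t by exact: sE.
  have [f0|f0] := eqVneq (f t) 0.
    have c0 : (fun _ : nat => 0 : V) @ \oo --> (0 : V) by exact: cvg_cst.
    rewrite f0; apply: cvg_trans c0; apply: near_eq_cvg.
    near=> n; apply/esym/eqP; rewrite -normr_le0.
    by rewrite (le_trans (bd n t Dt))// f0 normr0 mulr0.
  apply: cvg_trans (st); apply: near_eq_cvg; near=> n.
  rewrite /f_ indicE mem_set ?scale1r//; split => //=.
  have : `|f t - s_ n t| <= `|f t|.
    by near: n; move/cvgrPdist_le : st; apply; rewrite normr_gt0.
  move=> H; rewrite -[s_ n t](subKr (f t)) (le_trans (ler_normB _ _))//.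
  by rewrite mulr_natl mulr2n lerD2l.
have mn n : measurable_fun D (fun t => `|f t - f_ n t|).
  apply: strongly_measurable_norm; apply: strongly_measurableB => //.
  exact: (simple_bochner_integrable a b (sf_ n)).1.
have [] := @dominated_convergence _ _ _ leb D _ (fun n t => (`|f t - f_ n t|)%:E)
  (cst 0%E) (fun t => (3 * `|f t|)%:E) _ _ _ _ _.
- exact: measurable_itv.
- by move=> n; exact/measurable_EFinP.
- exact: measurable_cst.
- apply: aeW => t Dt; apply: cvg_EFin; first exact: nearW.
  rewrite [X in _ --> X](_ : _ = `|f t - f t|); last by rewrite subrr normr0.
  by apply: cvg_norm; apply: cvgB; [exact: cvg_cst|exact: f_f].
- exact: (RintegrableZl _ _ fi).
- apply: aeW => t n Dt /=; rewrite lee_fin normr_id (le_trans (ler_normB _ _))//.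
  by move: (bd n t Dt); lra.
by move=> _ _; rewrite integral0.
Unshelve. all: by end_near. Qed.

Lemma bochner_integrable_of_approx a b f (f_ : nat -> R -> V) : strongly_measurable a b f ->
  (forall n, simple_map (f_ n)) ->
  (\int[leb]_(t in `[a, b]) (`|f t - f_ n t|)%:E)%E @[n --> \oo] --> 0%E ->
  bochner_integrable a b f /\
  \int[leb]_(t in `[a, b]) `|f t - f_ n t| @[n --> \oo] --> 0.
Proof.
move=> sf ss i0; split; last by move/fine_cvg : i0.
have [n ni] : exists n, (\int[leb]_(t in `[a, b]) (`|f t - f_ n t|)%:E < +oo)%E.
  move/fine_cvgP : i0 => [[n _ /(_ n (leqnn n))] /= + _].
  by rewrite ge0_fin_numE ?integral_ge0//; exists n.
have si := simple_bochner_integrable a b (ss n).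
have di : bochner_integrable a b (fun t => f t - f_ n t).
  by apply: bochner_integrableP => //; apply: strongly_measurableB => //; exact: si.1.
apply: (@bochner_integrable_eq _ _ (fun t => 1 *: (f t - f_ n t) + f_ n t)).
  by move=> t _; rewrite scale1r subrK.
exact: bochner_integrableD.
Qed.

(** The integrals of approximating simple maps form a Cauchy sequence in [V],
by [simple_integral_dist]. *)
Lemma bochner_ex a b f : bochner_integrable a b f ->
  exists z, is_bochner_integral a b f z.
Proof.
move=> bf; have [f_ ss f0] := bochner_approx bf.
have [_ f0'] := bochner_integrable_of_approx bf.1 ss f0.
suff : cvgn (fun n => simple_integral a b (f_ n)).
  by move=> c; exists (limn (fun n => simple_integral a b (f_ n)));
    split; [exact: bf.1|exists f_].
apply/cauchy_cvgP; apply: cauchy_exP => e e0.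
have e20 : 0 < e / 2 by rewrite divr_gt0.
move/cvgrPdist_lt : f0' => /(_ _ e20) [N _ NE].
exists (simple_integral a b (f_ N)); exists N => // m Nm /=.
rewrite -ball_normE /= (le_lt_trans (simple_integral_dist _ _ _ _))//.
have sN n := simple_bochner_integrable a b (ss n).
have dN n := bochner_integrableB bf (sN n).
have := ltrD (NE N (leqnn N)) (NE m Nm); rewrite /= !sub0r !normrN -splitr.
rewrite !ger0_norm; try by apply: Rintegral_ge0.
apply: le_lt_trans; rewrite -RintegralD//; [|exact: (dN N).2|exact: (dN m).2].
apply: le_Rintegral => //; first exact: (bochner_integrableB (sN N) (sN m)).2.
  by apply: RintegrableD => //; [exact: (dN N).2|exact: (dN m).2].
by move=> t _; rewrite -(subrKA (f t)) (le_trans (ler_normD _ _))// (distrC (f_ N t)).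
Qed.

(** Both sides are the limit of the values of [l] at the integrals of
approximating simple maps. In particular the Bochner integral does not depend on the
approximation, since functionals separate vectors. *)
Lemma bochner_functional a b f l : linear (l : V -> R^o) ->
  (exists M, forall x, `|l x| <= M * `|x|) -> bochner_integrable a b f ->
  l (bochner_integral a b f) = \int[leb]_(t in `[a, b]) l (f t).
Proof.
move=> ll lM bf; have [M lM'] := lM.
have := xgetPex 0 (bochner_ex bf); rewrite -/(bochner_integral a b f).
set z := bochner_integral a b f => -[sf [f_ [ss f0 fz]]].
have [_ f0'] := bochner_integrable_of_approx sf ss f0.
have c1 : l (simple_integral a b (f_ n)) @[n --> \oo] --> l z.
  by apply: (continuous_cvg _ _ fz); exact: (lin_continuous ll lM').
have c2 : l (simple_integral a b (f_ n)) @[n --> \oo] -->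
    \int[leb]_(t in `[a, b]) l (f t).
  apply/cvgrPdist_le => e e0.
  have c3 : M * \int[leb]_(t in `[a, b]) `|f t - f_ n t| @[n --> \oo] --> M * 0.
    by apply: cvgM => //; exact: cvg_cst.
  rewrite mulr0 in c3; move/cvgrPdist_le : c3 => /(_ _ e0).
  apply: filterS => n; rewrite sub0r normrN => /ler_normlW; apply: le_trans.
  have sn := simple_bochner_integrable a b (ss n).
  have dn := bochner_integrableB bf sn.
  rewrite simple_integral_functional// -RintegralB//; last 2 first.
    exact: functional_integrable. exact: functional_integrable.
  have li : leb.-integrable `[a, b] (EFin \o (fun t => l (f t) - l (f_ n t))).
    apply: (Rintegrable_eq (mI a b) (f := l \o (fun t => f t - f_ n t))) => //.
      by move=> t _ /=; rewrite (linB ll).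
    exact: functional_integrable.
  rewrite (le_trans (le_normr_Rintegral _ li))// -RintegralZl//; last exact: dn.2.
  apply: le_Rintegral => //.
  - exact: (integrable_norm li).
  - by apply: RintegrableZl => //; exact: dn.2.
  - by move=> t _; rewrite -(linB ll).
by rewrite -(cvg_lim (@Rhausdorff R) c1) (cvg_lim (@Rhausdorff R) c2).
Qed.

Lemma bochner_dot a b f z : bochner_integrable a b f ->
  dot (bochner_integral a b f) z = \int[leb]_(t in `[a, b]) dot (f t) z.
Proof.
by move=> bf; have [ll lM] := dot_functional z; exact: (bochner_functional ll lM bf).
Qed.

Lemma bochner_integral_eq a b f g : (forall t, t \in `[a, b] -> f t = g t) ->
  bochner_integrable a b f -> bochner_integral a b f = bochner_integral a b g.
Proof.
move=> fg bf; have bg := bochner_integrable_eq fg bf.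
apply: (dot_ext ip) => z; rewrite (bochner_dot z bf) (bochner_dot z bg).
by apply: eq_Rintegral => t; rewrite inE => tab; rewrite fg.
Qed.

Lemma bochner_integralP a b c f g : bochner_integrable a b f ->
  bochner_integrable a b g ->
  bochner_integral a b (fun t => c *: f t + g t) =
  c *: bochner_integral a b f + bochner_integral a b g.
Proof.
move=> bf bg; apply: (dot_ext ip) => z.
rewrite (dot_linearl ip) (bochner_dot z bf) (bochner_dot z bg).
rewrite (bochner_dot z (bochner_integrableD c bf bg)).
rewrite -RintegralZl//; last exact: dot_integrable.
rewrite -RintegralD//; last exact: dot_integrable.
  by apply: eq_Rintegral => t _; rewrite (dot_linearl ip).
by apply: RintegrableZl => //; exact: dot_integrable.
Qed.

Lemma bochner_integralB a b f g : bochner_integrable a b f ->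
  bochner_integrable a b g ->
  bochner_integral a b (fun t => f t - g t) =
  bochner_integral a b f - bochner_integral a b g.
Proof.
move=> bf bg; apply: (dot_ext ip) => z.
rewrite (dotBl ip) (bochner_dot z bf) (bochner_dot z bg).
rewrite (bochner_dot z (bochner_integrableB bf bg)).
rewrite -RintegralB//; [|exact: dot_integrable|exact: dot_integrable].
by apply: eq_Rintegral => t _; rewrite (dotBl ip).
Qed.

(** For every [z], the functional [x |-> <L x, z>] commutes with the
integral. *)
Lemma bochner_operator a b f (L : V -> V) : bounded_operator L ->
  bochner_integrable a b f ->
  bochner_integrable a b (L \o f) /\
  L (bochner_integral a b f) = bochner_integral a b (L \o f).
Proof.
move=> [lL cL] bf; have [M M0 LM] := lin_bounded lL cL.
have bLf : bochner_integrable a b (L \o f).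
  apply: (@bochner_integrable_le _ _ _ (fun t => M * `|f t|)).
  - exact: strongly_measurable1 bf.1 cL.
  - by apply: RintegrableZl => //; exact: bf.2.
  - by move=> t _ /=.
split=> //; apply: (dot_ext ip) => z; rewrite bochner_dot//.
apply: (@bochner_functional a b f (fun x => dot (L x) z)) => //.
  by move=> c x y; rewrite lL (dot_linearl ip).
exists (`|z| * M) => x; rewrite (le_trans (cauchy_schwarz ip _ _))//.
by rewrite mulrC -mulrA ler_wpM2l.
Qed.

Lemma bochner_norm a b f (g : R -> R) : bochner_integrable a b f ->
  leb.-integrable `[a, b] (EFin \o g) ->
  (forall t, t \in `[a, b] -> `|f t| <= g t) ->
  `|bochner_integral a b f| <= \int[leb]_(t in `[a, b]) g t.
Proof.
move=> bf ig fg; set z := bochner_integral a b f.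
have g0 t : `[a, b]%classic t -> 0 <= g t.
  by move=> tab; rewrite (le_trans _ (fg _ tab)).
apply: norm_le_dot; last by apply: Rintegral_ge0.
rewrite {1}/z bochner_dot// -RintegralZr//.
apply: le_Rintegral => //; first exact: dot_integrable.
  exact: RintegrableZr.
move=> t tab; rewrite (le_trans (ler_norm _))//.
by rewrite (le_trans (cauchy_schwarz ip _ _))// ler_wpM2r// fg.
Qed.

End bochner_theory.

(** * Derivatives and the fundamental theorem of calculus *)

Section near0.
Context {R : realType}.

Lemma near_dnbhs0P (P : R -> Prop) : (\forall h \near 0^', P h) <->
  exists2 d, 0 < d & forall h, h != 0 -> `|h| < d -> P h.
Proof.
split=> [/nbhs_ballP [d /= d0 dP]|[d d0 dP]].
  exists d => // h h0 hd; apply: dP => //=.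
  by rewrite -ball_normE /= sub0r normrN.
apply/nbhs_ballP; exists d => //= h; rewrite -ball_normE /= sub0r normrN => hd h0.
exact: dP.
Qed.

Lemma at_right_dnbhs0 (P : R -> Prop) : (\forall h \near 0^', P h) ->
  \forall h \near 0^'+, P h.
Proof.
move=> /near_dnbhs0P[d d0 dP]; near=> h; apply: dP.
  by rewrite gt_eqF//; near: h; exact: nbhs_right_gt.
rewrite gtr0_norm; first by near: h; exact: nbhs_right_lt.
by near: h; exact: nbhs_right_gt.
Unshelve. all: by end_near. Qed.

End near0.

Section has_deriv.
Context {R : realType}.

(** Two-sided derivative of a vector-valued function of time, in the form of
difference quotients so that operator-valued product rules apply directly. *)
Definition has_deriv {V : normedModType R} (F : R -> V) (t : R) (D : V) :=
  h^-1 *: (F (h + t) - F t) @[h --> 0^'] --> D.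

Section basic.
Context {V : normedModType R}.
Implicit Types (F : R -> V) (D : V).

Lemma has_derivP F t D : has_deriv F t D <->
  forall e, 0 < e -> exists2 d, 0 < d & forall h, h != 0 -> `|h| < d ->
    `|F (h + t) - F t - h *: D| <= e * `|h|.
Proof.
have eE h e : h != 0 -> (`|D - h^-1 *: (F (h + t) - F t)| <= e) =
    (`|F (h + t) - F t - h *: D| <= e * `|h|).
  move=> h0; rewrite -ler_pdivrMr ?normr_gt0// mulrC -normfV -normrZ.
  by rewrite [h^-1 *: (_ - h *: D)]scalerBr scalerA mulVf// scale1r distrC.
split=> [/cvgrPdist_le H e /H /near_dnbhs0P [d d0 dP]|H].
  by exists d => // h h0 hd; rewrite -eE//; exact: dP.
apply/cvgrPdist_le => e /H [d d0 dP]; apply/near_dnbhs0P; exists d => // h h0 hd.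
by rewrite eE//; exact: dP.
Qed.

Lemma has_deriv_eq F G t D d : 0 < d ->
  (forall s, `|s - t| < d -> F s = G s) -> has_deriv F t D -> has_deriv G t D.
Proof.
move=> d0 FG /has_derivP H; apply/has_derivP => e /H [d' d'0 dP].
exists (Num.min d d'); first by rewrite lt_min d0.
move=> h h0; rewrite lt_min => /andP[hd hd'].
by rewrite -!FG ?addrK ?subrr ?normr0//; exact: dP.
Qed.

Lemma has_deriv_affine F t D a c : c != 0 ->
  has_deriv F (a + c * t) D -> has_deriv (fun s => F (a + c * s)) t (c *: D).
Proof.
move=> c0 /has_derivP H; apply/has_derivP => e e0.
have nc0 : 0 < `|c| by rewrite normr_gt0.
have [d d0 dP] := H (e / `|c|) (divr_gt0 e0 nc0).
exists (d / `|c|); first exact: divr_gt0.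
move=> h h0 hd.
have hc : `|c * h| < d by rewrite normrM mulrC -ltr_pdivlMr.
have := dP (c * h) (mulf_neq0 c0 h0) hc; rewrite normrM mulrA divfK ?gt_eqF//.
rewrite (_ : a + c * (h + t) = c * h + (a + c * t)); last by ring.
by rewrite scalerA (mulrC h).
Qed.

Lemma has_derivD F G t D E : has_deriv F t D -> has_deriv G t E ->
  has_deriv (fun s => F s + G s) t (D + E).
Proof.
move=> HF HG; rewrite /has_deriv (_ : (fun h => _) =
    (fun h => h^-1 *: (F (h + t) - F t) + h^-1 *: (G (h + t) - G t))).
  exact: cvgD.
by apply/funext => h /=; rewrite -scalerDr opprD addrACA.
Qed.

Lemma has_deriv_cst c t : has_deriv (fun=> c : V) t 0.
Proof.
rewrite /has_deriv (_ : (fun h => _) = cst 0); first exact: cvg_cst.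
by apply/funext => h; rewrite subrr scaler0.
Qed.

Lemma has_deriv_lin {W : normedModType R} F t D (L : V -> W) : linear L ->
  continuous L -> has_deriv F t D -> has_deriv (fun s => L (F s)) t (L D).
Proof.
move=> lL cL HF; rewrite /has_deriv.
rewrite (_ : (fun h => _) = L \o (fun h => h^-1 *: (F (h + t) - F t))).
  by apply: continuous_cvg => //; exact: cL.
by apply/funext => h /=; rewrite (linZ lL) (linB lL).
Qed.

Lemma has_derivN F t D : has_deriv F t D -> has_deriv (fun s => - F s) t (- D).
Proof.
move=> H; apply: (has_deriv_lin (L := -%R)) => //; last exact: opp_continuous.
by move=> a x y; rewrite opprD scalerN.
Qed.

Lemma has_derivZ F t D c : has_deriv F t D ->
  has_deriv (fun s => c *: F s) t (c *: D).
Proof.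
move=> H; apply: (has_deriv_lin (L := *:%R c)) => //.
  by move=> a x y; rewrite scalerDr !scalerA mulrC.
by move=> x; apply: cvgZl_tmp.
Qed.

Lemma has_deriv_cvg F t D : has_deriv F t D -> F (h + t) @[h --> 0^'] --> F t.
Proof.
move=> H; rewrite -[X in _ --> X](subrK (F t)) -[X in _ --> X + _](_ : 0 *: D = _);
  last by rewrite scale0r subrr.
have c : (fun h : R => h *: (h^-1 *: (F (h + t) - F t)) + F t) @ 0^' --> 0 *: D + F t.
  apply: cvgD; last exact: cvg_cst.
  by apply: cvgZ => //; exact: cvg_within.
apply: cvg_trans c; apply: near_eq_cvg; apply/near_dnbhs0P; exists 1 => // h h0 _.
by rewrite scalerA mulfV// scale1r subrK.
Qed.

End basic.

(** Strong convergence of the operators suffices, as a uniform bound controls the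
effect of moving the vector. *)
Lemma cvg_op {V W : normedModType R} {T : Type} (F : set_system T) {FF : Filter F}
    (K : T -> V -> W) (z : T -> V) (z0 : V) (w : W) (M : R) : (forall t, linear (K t)) ->
  (\forall t \near F, forall v, `|K t v| <= M * `|v|) ->
  z @ F --> z0 -> K t z0 @[t --> F] --> w -> K t (z t) @[t --> F] --> w.
Proof.
move=> lK bK zz0 Kw.
have -> : (fun t => K t (z t)) = (fun t => K t (z t - z0) + K t z0).
  by apply/funext => t; rewrite (linB (lK t)) subrK.
rewrite -[w]add0r; apply: cvgD => //; apply/cvgrPdist_le => e e0.
have M1 : 0 < `|M| + 1 by rewrite ltr_wpDl.
have /cvgrPdist_le /(_ (e / (`|M| + 1)) (divr_gt0 e0 M1)) := zz0.
apply: filterS2 bK => t Kt zt; rewrite sub0r normrN (le_trans (Kt _))//.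
rewrite distrC in zt; move: zt; rewrite ler_pdivlMr// mulrC => zt.
apply: le_trans zt; rewrite ler_wpM2r//.
by rewrite (le_trans (ler_norm _))// lerDl.
Qed.

(** Product rule for an operator-valued factor that is differentiable only in
the strong sense. *)
Lemma has_deriv_op {V W : normedModType R} (K : R -> V -> W) (u : R -> V) t u' K' M :
  (forall s, linear (K s)) ->
  (\forall h \near 0^', forall v, `|K (h + t) v| <= M * `|v|) ->
  has_deriv u t u' -> has_deriv (K ^~ (u t)) t K' ->
  K (h + t) u' @[h --> 0^'] --> K t u' ->
  has_deriv (fun s => K s (u s)) t (K' + K t u').
Proof.
move=> lK bK Hu HK cK; rewrite /has_deriv.
rewrite (_ : (fun h => _) = (fun h => h^-1 *: (K (h + t) (u t) - K t (u t)) +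
    K (h + t) (h^-1 *: (u (h + t) - u t)))).
  by apply: cvgD => //; apply: (cvg_op (K := fun h => K (h + t)) _ bK Hu cK) => h; exact: lK.
apply/funext => h; rewrite (linZ (lK _)) (linB (lK _)) -scalerDr.
by rewrite [X in _ = _ *: X]addrC addrA subrK.
Qed.

Lemma FTC_real (F G : R -> R) a b : a <= b -> continuous F -> continuous G ->
  (forall t, a < t < b -> has_deriv F t (G t)) ->
  \int[@lebesgue_measure R]_(t in `[a, b]) G t = F b - F a.
Proof.
rewrite le_eqVlt => /predU1P[<- _ _ _|ab cF cG dF].
  by rewrite set_itv1 Rintegral_set1 subrr.
rewrite /Rintegral (@continuous_FTC2 _ G F)//.
- exact: continuous_subspaceT.
- split.
  + move=> t; rewrite in_itv /= => tab.
    apply/cvg_ex; exists (G t); have := dF _ tab; rewrite /has_deriv.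
    set d := (fun _ : R => _); set d' := (fun _ : R => _).
    by suff -> : d' = d by []; apply/funext => h; rewrite /d /d' /= [h%:A](mulr1).
  + by apply: cvg_at_right_filter; exact: cF.
  + by apply: cvg_at_left_filter; exact: cF.
- by move=> t; rewrite in_itv /= => tab; apply: cvg_lim => //; exact: dF.
Qed.

End has_deriv.

Section bochner_calculus.
Context {R : realType} {V : completeNormedModType R} (dot : V -> V -> R).
Context (ip : inner_product dot).
Local Notation leb := (@lebesgue_measure R).

Lemma continuous_integrable (g : R -> R) a b : continuous g ->
  leb.-integrable `[a, b] (EFin \o g).
Proof.
move=> cg; apply: continuous_compact_integrable; first exact: segment_compact.
exact: continuous_subspaceT.
Qed.

Lemma bochner_integrable_continuous (f : R -> V) a b : continuous f ->
  bochner_integrable a b f.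
Proof.
move=> cf; split; first exact: strongly_measurable_continuous.
apply: continuous_integrable => t.
by apply: cvg_norm; exact: cf.
Qed.

Lemma dotl_continuous z : continuous (dot ^~ z : V -> R).
Proof. by move=> x; apply: (cvg_dot ip); [exact: cvg_id|exact: cvg_cst]. Qed.

Lemma has_deriv_dotl (F : R -> V) t D z : has_deriv F t D ->
  has_deriv (fun s => dot (F s) z : R^o) t (dot D z).
Proof.
move=> H; apply: (has_deriv_lin (L := dot ^~ z : V -> R^o)) => //.
  by move=> c x y; rewrite (dot_linearl ip).
exact: dotl_continuous.
Qed.

Lemma has_deriv_dot (F G : R -> V) t D E : has_deriv F t D -> has_deriv G t E ->
  has_deriv (fun s => dot (F s) (G s) : R^o) t (dot D (G t) + dot (F t) E).
Proof.
move=> HF HG; rewrite /has_deriv.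
rewrite (_ : (fun h => _) = (fun h => dot (h^-1 *: (F (h + t) - F t)) (G (h + t)) +
    dot (F t) (h^-1 *: (G (h + t) - G t)))).
  apply: cvgD; apply: (cvg_dot ip) => //; last exact: cvg_cst.
  exact: has_deriv_cvg HG.
apply/funext => h; rewrite (dotZl ip) (dotZr ip) (dotBl ip) (dotBr ip).
by rewrite -mulrDr /GRing.scale /=; congr (_ * _); ring.
Qed.

(** Tested against each [z], this is the real fundamental theorem of calculus. *)
Lemma bochner_FTC (F G f : R -> V) a b : a <= b -> continuous F -> continuous G ->
  (forall t, a < t < b -> has_deriv F t (G t)) ->
  (forall t, t \in `[a, b] -> f t = G t) ->
  bochner_integral a b f = F b - F a.
Proof.
move=> ab cF cG dF fG.
have bG := bochner_integrable_continuous a b cG.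
have Gf t : t \in `[a, b] -> G t = f t by move=> /fG.
rewrite -(bochner_integral_eq ip Gf bG); apply: (dot_ext ip) => z.
rewrite (bochner_dot ip)// (@FTC_real _ (fun t => dot (F t) z))//.
- by rewrite (dotBl ip).
- by move=> t; apply: (cvg_dot ip); [exact: cF|exact: cvg_cst].
- by move=> t; apply: (cvg_dot ip); [exact: cG|exact: cvg_cst].
- by move=> t tab; apply: has_deriv_dotl; exact: dF.
Qed.

(** A form of the mean value inequality that turns integral estimates into
the choice of a primitive. *)
Lemma bochner_norm_primitive (f : R -> V) (F G : R -> R) a b : a <= b ->
  continuous F -> continuous G -> (forall t, has_deriv F t (G t)) ->
  bochner_integrable a b f -> (forall t, t \in `[a, b] -> `|f t| <= G t) ->
  `|bochner_integral a b f| <= F b - F a.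
Proof.
move=> ab cF cG dF bf fG; rewrite -(FTC_real ab cF cG (fun t _ => dF t)).
exact: (bochner_norm ip bf (continuous_integrable a b cG) fG).
Qed.

Lemma has_deriv_linear c (t : R) : has_deriv (fun s : R => c * s) t c.
Proof.
apply/has_derivP => e e0; exists 1 => // h _ _.
rewrite -[h *: _]/(h * c) (_ : c * (h + t) - c * t - h * c = 0); last by ring.
by rewrite normr0 mulr_ge0// ltW.
Qed.

Lemma bochner_norm_cst (f : R -> V) a b M : a <= b -> bochner_integrable a b f ->
  (forall t, t \in `[a, b] -> `|f t| <= M) ->
  `|bochner_integral a b f| <= M * (b - a).
Proof.
move=> ab bf fM; rewrite mulrBr.
apply: (@bochner_norm_primitive f (fun s => M * s) (fun=> M)) => //.
- by move=> t; apply: cvgM; [exact: cvg_cst|exact: cvg_id].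
- by move=> t; exact: cvg_cst.
- by move=> t; exact: has_deriv_linear.
Qed.

Lemma bochner_integral_itv (f : R -> V) a b c : a <= b -> b <= c -> continuous f ->
  bochner_integral a c f = bochner_integral a b f + bochner_integral b c f.
Proof.
move=> ab bc cf; apply: (dot_ext ip) => z.
have bf p q := bochner_integrable_continuous p q cf.
rewrite (dotDl ip) (bochner_dot ip z (bf a c)) (bochner_dot ip z (bf a b)).
rewrite (bochner_dot ip z (bf b c)).
have cd : continuous (fun t => dot (f t) z).
  by move=> t; apply: (cvg_dot ip); [exact: cf|exact: cvg_cst].
have := @Rintegral_itvB _ (fun t => dot (f t) z) (BLeft a) (BRight c) b.
rewrite !bnd_simp => /(_ (continuous_integrable _ _ cd) ab bc) /eqP.
rewrite subr_eq => /eqP ->; rewrite addrC; congr (_ + _).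
rewrite Rintegral_itv_obnd_cbnd//.
apply: integrableS (continuous_integrable b c cd) => //.
by apply: subset_itvr; rewrite bnd_simp.
Qed.

Lemma bochner_integral_cst a b c : a <= b ->
  bochner_integral a b (fun=> c) = (b - a) *: c :> V.
Proof.
move=> ab; apply: (dot_ext ip) => z.
rewrite (bochner_dot ip); last by apply: bochner_integrable_continuous => t; exact: cvg_cst.
rewrite (@FTC_real _ (fun s => dot c z * s))//.
- by rewrite (dotZl ip); ring.
- by move=> t; apply: cvgM; [exact: cvg_cst|exact: cvg_id].
- by move=> t; exact: cvg_cst.
- by move=> t _; exact: has_deriv_linear.
Qed.

Lemma bochner_integral_dist (f : R -> V) a b e t : a <= b -> continuous f ->
  (forall s, s \in `[a, b] -> `|f s - f t| <= e) ->
  `|bochner_integral a b f - (b - a) *: f t| <= e * (b - a).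
Proof.
move=> ab cf fe; rewrite -bochner_integral_cst// -(bochner_integralB ip).
- apply: bochner_norm_cst => //; apply: bochner_integrable_continuous.
  by move=> s; apply: cvgB; [exact: cf|exact: cvg_cst].
- exact: bochner_integrable_continuous.
- by apply: bochner_integrable_continuous => s; exact: cvg_cst.
Qed.

Lemma has_deriv_bochner (f : R -> V) t : 0 < t -> continuous f ->
  has_deriv (fun s => bochner_integral 0 s f) t (f t).
Proof.
move=> t0 cf; apply/has_derivP => e e0.
have /cvgrPdist_le /(_ _ e0) /nbhs_ballP [d /= d0 dP] := cf t.
exists (Num.min d t); first by rewrite lt_min d0.
move=> h h0; rewrite lt_min => /andP[hd ht].
have near a b s : a <= b -> s \in `[a, b] -> b - a = `|h| -> a = t \/ b = t ->
    `|f s - f t| <= e.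
  rewrite in_itv /= => ab /andP[sa sb] bah st; rewrite distrC; apply: dP.
  rewrite -ball_normE /= (le_lt_trans _ hd)// -bah.
  by rewrite ler_distl; case: st => <-; lra.
have [h_gt0|h_le0] := ltP 0 h.
  have th : t <= h + t by rewrite lerDr ltW.
  rewrite (bochner_integral_itv (ltW t0) th cf) [X in X - _ - _]addrC addrK.
  have := @bochner_integral_dist f t (h + t) e t th cf.
  rewrite addrK (gtr0_norm h_gt0); apply => s sI.
  by apply: (near _ _ _ th sI); [rewrite addrK gtr0_norm|left].
have th : h + t <= t by rewrite gerDr.
have h_lt0 : h < 0 by rewrite lt_neqAle h0.
have th0 : 0 <= h + t by move: ht; rewrite ltr0_norm//; lra.
have th' : t - (h + t) = - h by ring.
rewrite (bochner_integral_itv th0 th cf) opprD addNKr -normrN opprD !opprK.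
have := @bochner_integral_dist f (h + t) t e t th cf.
rewrite th' scaleNr opprK (ltr0_norm h_lt0); apply => s sI.
by apply: (near _ _ _ th sI); [rewrite th' ltr0_norm|right].
Qed.

End bochner_calculus.

(** * Semigroups with a symmetric generator *)

(** Banach-Steinhaus for a family of operators, with the bound on the unit ball
turned into an operator norm bound. *)
Lemma uniform_boundedness {R : realType} {V : completeNormedModType R} {I : Type}
    (K : I -> V -> V) : (forall i, bounded_operator (K i)) ->
  (forall x, exists M, forall i, `|K i x| <= M) ->
  exists2 M, 0 < M & forall i x, `|K i x| <= M * `|x|.
Proof.
move=> bK pK.
have [|x|M MK] := @Banach_Steinhauss R V V (range K) _ _ 1.
- move=> _ [i _ <-]; split; last exact: (bK i).1.
  move=> r; have [M M0 KM] := lin_bounded (bK i).1 (bK i).2.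
  by exists (M * r) => x xr; rewrite (le_trans (KM x))// ler_wpM2l// ltW.
- by have [M KM] := pK x; exists M => _ [i _ <-].
exists (`|M| + 1) => [|i x]; first by rewrite ltr_wpDl.
have [->|x0] := eqVneq x 0; first by rewrite (lin0 (bK i).1) !normr0 mulr0.
have nx : 0 < `|x| by rewrite normr_gt0.
have : `|K i (`|x|^-1 *: x)| <= M.
  apply: MK; first by exists i.
  by rewrite normrZ normfV normr_id mulVf// gt_eqF.
rewrite (linZ (bK i).1) normrZ normfV normr_id ler_pdivrMl// mulrC => /le_trans; apply.
by rewrite ler_wpM2r// (le_trans (ler_norm _))// lerDl.
Qed.

Lemma continuous_affine {R : realType} {U : topologicalType} (f : R -> U) (a c : R) :
  continuous f -> continuous (fun s => f (a + c * s)).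
Proof.
move=> cf s; apply: (@continuous_comp _ _ _ (fun s => a + c * s) f); last exact: cf.
by apply: cvgD; [exact: cvg_cst|apply: cvgM; [exact: cvg_cst|exact: cvg_id]].
Qed.

Lemma continuous_rev {R : realType} {U : topologicalType} (f : R -> U) (a : R) :
  continuous f -> continuous (fun s => f (a - s)).
Proof.
move=> cf; rewrite (_ : (fun s => _) = (fun s => f (a + -1 * s))).
  exact: (continuous_affine cf).
by apply/funext => s; rewrite mulN1r.
Qed.

Lemma has_deriv_rev {R : realType} {V : normedModType R} (F : R -> V) t D a :
  has_deriv F (a - t) D -> has_deriv (fun s => F (a - s)) t (- D).
Proof.
move=> H; rewrite (_ : (fun s => _) = (fun s => F (a + -1 * s))).
  rewrite -[- D]scaleN1r; apply: (@has_deriv_affine _ _ F t D a (-1)).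
    by rewrite oppr_eq0 oner_neq0.
  by rewrite mulN1r.
by apply/funext => s; rewrite mulN1r.
Qed.

Section semigroup.
Context {R : realType} {V : completeNormedModType R} (dot : V -> V -> R).
Context (ip : inner_product dot).
Context (S : R -> V -> V) (A : V -> V -> Prop).
Context (AS : generates A S).
Context (symA : forall v w v' w', A v w -> A v' w' -> dot w v' = dot v w').

Let S_op t : 0 <= t -> bounded_operator (S t).
Proof. by have [[h _ _ _] _] := AS; exact: h. Qed.
Let S0 x : S 0 x = x.
Proof. by have [[_ h _ _] _] := AS; exact: h. Qed.
Let SD s t x : 0 <= s -> 0 <= t -> S (s + t) x = S s (S t x).
Proof. by have [[_ _ h _] _] := AS; exact: h. Qed.

Lemma semigroup_right0 x e : 0 < e ->
  exists2 d, 0 < d & forall t, 0 <= t -> t < d -> `|S t x - x| <= e.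
Proof.
move=> e0; have [[_ _ _ /(_ x)/cvgrPdist_le/(_ _ e0) h] _] := AS.
have [d /= d0 dP] := h; exists d => // t t0 td.
have [->|tN0] := eqVneq t 0; first by rewrite S0 subrr normr0 ltW.
have tp : 0 < t by rewrite lt_neqAle eq_sym tN0.
by rewrite distrC; apply: dP => //=; rewrite sub0r normrN gtr0_norm.
Qed.

(** Otherwise there are times [t n] tending to 0 with operators [S (t n)] of norm
at least [n]; these converge pointwise to the identity, which contradicts
Banach-Steinhaus. *)
Lemma semigroup_bound0 : exists2 d, 0 < d & exists2 M, 0 < M &
  forall t x, 0 <= t -> t <= d -> `|S t x| <= M * `|x|.
Proof.
apply: contrapT => nb.
have P n : exists t, exists x, [/\ 0 <= t, t <= n.+1%:R^-1 &
    n.+1%:R * `|x| < `|S t x|].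
  apply: contrapT => nP; apply: nb; exists n.+1%:R^-1; first by rewrite invr_gt0.
  exists n.+1%:R => // t x t0 tn; rewrite leNgt; apply/negP => H.
  by apply: nP; exists t, x.
have {P} [t tP] := choice P; have {tP} [x tP] := choice tP.
have t0 n : 0 <= t n by have [] := tP n.
have [|y|M M0 MS] := @uniform_boundedness R V nat (fun n => S (t n)).
- by move=> n; exact: S_op.
- suff c : S (t n) y @[n --> \oo] --> y.
    have /cvg_seq_bounded [M [_ /(_ (M + 1))]] : cvgn (fun n => S (t n) y).
      by apply/cvg_ex; exists y.
    by rewrite ltrDl => /(_ ltr01) h; exists (M + 1) => n; exact: h.
  apply/cvgrPdist_le => e /(semigroup_right0 y) [d d0 dP].
  near=> n; rewrite distrC; apply: dP => //.
  have [_ tn _] := tP n; apply: le_lt_trans tn _.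
  near: n; exact: near_infty_natSinv_lt (PosNum d0).
pose n := Num.truncn M; have [_ _] := tP n; apply/negP; rewrite -leNgt.
rewrite (le_trans (MS _ _))// ler_wpM2r// ltW//.
by rewrite truncnS_gt.
Unshelve. all: by end_near. Qed.

(** The semigroup law propagates the bound near 0 in steps of fixed length. *)
Lemma semigroup_bound B : exists2 M, 0 < M &
  forall t x, 0 <= t -> t <= B -> `|S t x| <= M * `|x|.
Proof.
have [d d0 [M M0 MS]] := semigroup_bound0.
suff P n : exists2 M, 0 < M & forall t x, 0 <= t -> t <= n%:R * d -> `|S t x| <= M * `|x|.
  have [N N0 NS] := P (Num.truncn (B / d)).+1; exists N => // t x t0 tB.
  apply: NS => //; apply: (le_trans tB); rewrite -ler_pdivrMr// ltW//.
  by rewrite truncnS_gt.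
elim: n => [|n [N N0 NS]].
  exists 1 => // t x t0; rewrite mul0r => tl0.
  have -> : t = 0 by apply/eqP; rewrite eq_le tl0.
  by rewrite S0 mul1r.
exists (Num.max N (M * N)); first by rewrite lt_max N0.
move=> t x t0 tn; have [td|td] := leP t (n%:R * d).
  by rewrite (le_trans (NS _ _ t0 td))// ler_wpM2r// le_max lexx.
have td0 : 0 <= t - n%:R * d by rewrite subr_ge0 ltW.
have nd0 : 0 <= n%:R * d by rewrite mulr_ge0// ltW.
rewrite -(subrK (n%:R * d) t) SD// (le_trans (MS _ _ _ _))//.
  by rewrite lerBlDr (le_trans tn)// -natr1 mulrDl mul1r addrC.
rewrite (@le_trans _ _ (M * (N * `|x|)))//; first by rewrite ler_pM2l// NS.
by rewrite mulrA ler_wpM2r// le_max lexx orbT.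
Qed.

(** The semigroup, made constant on negative times. It is strongly continuous
on the whole line, which spares one-sided limits at the ends of intervals. *)
Definition ext_semigroup t := S (Num.max 0 t).
Local Notation E := ext_semigroup.

Lemma ext_semigroupE t : 0 <= t -> E t = S t.
Proof. by move=> t0; rewrite /E (max_idPr t0). Qed.

Lemma ext_semigroup_op t : bounded_operator (E t).
Proof. by apply: S_op; rewrite le_max lexx. Qed.

Lemma ext_semigroup_lin t : linear (E t).
Proof. exact: (ext_semigroup_op t).1. Qed.

Lemma ext_semigroup0 x : E 0 x = x.
Proof. by rewrite ext_semigroupE. Qed.

Lemma ext_semigroupD s t x : 0 <= s -> 0 <= t -> E (s + t) x = E s (E t x).
Proof. by move=> s0 t0; rewrite !ext_semigroupE ?addr_ge0// SD. Qed.

Lemma ext_semigroupC s t x : E s (E t x) = E t (E s x).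
Proof.
by rewrite /E -!SD ?le_max ?lexx// addrC.
Qed.

Lemma ext_semigroup_bound B : exists2 M, 0 < M &
  forall t x, t <= B -> `|E t x| <= M * `|x|.
Proof.
have [M M0 MS] := semigroup_bound (Num.max 0 B); exists M => // t x tB.
by apply: MS; [rewrite le_max lexx|rewrite ge_max !le_max lexx tB orbT].
Qed.

Lemma ext_semigroup_continuous x : continuous (E ^~ x).
Proof.
move=> t; apply/cvgrPdist_le => e e0.
have [M M0 ME] := ext_semigroup_bound (t + 1).
have [d d0 dP] := semigroup_right0 x (divr_gt0 e0 M0).
near=> s.
have key a b : a <= b -> b - a < d -> a <= t + 1 -> `|E b x - E a x| <= e.
  move=> ab bad at1; pose a' := Num.max 0 a; pose b' := Num.max 0 b.
  have ab' : a' <= b' by rewrite /a' /b' ge_max !le_max lexx /= ab orbT.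
  have bad' : b' - a' < d.
    apply: le_lt_trans bad; rewrite /a' /b'.
    by have [?|?] := leP 0 a; have [?|?] := leP 0 b; lra.
  have a'0 : 0 <= a' by rewrite le_max lexx.
  have bE : b' = a' + (b' - a') by ring.
  rewrite /E -/a' -/b' bE SD ?subr_ge0//.
  rewrite -(linB (S_op a'0).1).
  apply: (le_trans (ME a _ at1)); rewrite mulrC -ler_pdivlMr//.
  by apply: dP; rewrite ?subr_ge0.
have sd : ball t d s by near: s; exact: (nbhsx_ballx t d d0).
have s1 : ball t 1 s by near: s; exact: (nbhsx_ballx t 1 ltr01).
rewrite -ball_normE /= in sd s1; move/ltW in s1.
have [st|ts] := leP s t.
  apply: key => //; first by rewrite (le_lt_trans (ler_norm _)).
  by rewrite (le_trans st)// lerDl.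
rewrite distrC; apply: key; first exact: ltW.
  by rewrite distrC in sd; rewrite (le_lt_trans (ler_norm _)).
by rewrite lerDl.
Unshelve. all: by end_near. Qed.

Lemma generator_domain v w t : 0 <= t -> A v w -> A (E t v) (E t w).
Proof.
move=> t0; have [_ gA] := AS; rewrite !gA => vw.
have [lE cE] := ext_semigroup_op t.
have H : E t (h^-1 *: (S h v - v)) @[h --> 0^'+] --> E t w.
  by apply: (continuous_cvg _ _ vw); exact: cE.
apply: cvg_trans H; apply: near_eq_cvg; near=> h.
have h0 : 0 <= h by apply: ltW; near: h; exact: nbhs_right_gt.
by rewrite (linZ lE) (linB lE) -(ext_semigroupE h0) ext_semigroupC.
Unshelve. all: by end_near. Qed.

(** From either side, the difference quotient at [t] is the image of a right
difference quotient at 0 under the semigroup at the smaller of the two times. *)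
Lemma has_deriv_semigroup v w t : 0 < t -> A v w -> has_deriv (E ^~ v) t (E t w).
Proof.
move=> t0; have [_ gA] := AS; rewrite gA => /cvgrPdist_le vw.
have [M M0 ME] := ext_semigroup_bound (t + 1).
have dq : (fun h : R => `|h|^-1 *: (S `|h| v - v)) @ 0^' --> w.
  apply/cvgrPdist_le => e /vw [d /= d0 dP]; apply/near_dnbhs0P; exists d => // h h0 hd.
  by apply: dP; rewrite /= ?sub0r ?normrN ?normr_id ?normr_gt0.
have cE : E (Num.min t (h + t)) w @[h --> 0^'] --> E t w.
  apply/cvgrPdist_le => e e0.
  have /cvgrPdist_le /(_ _ e0) /nbhs_ballP [d /= d0 dP] := @ext_semigroup_continuous w t.
  apply/near_dnbhs0P; exists d => // h h0 hd; apply: dP; rewrite -ball_normE /=.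
  apply: le_lt_trans hd; have [th|th] := leP t (h + t); first by rewrite subrr normr0.
  by have -> : t - (h + t) = - h; [ring|rewrite normrN].
have bE : \forall h \near 0^', forall x, `|E (Num.min t (h + t)) x| <= M * `|x|.
  by apply/near_dnbhs0P; exists 1 => // h _ _ x; apply: ME; rewrite ge_min lerDl ler01.
have HH : (fun h : R => E (Num.min t (h + t)) (`|h|^-1 *: (S `|h| v - v))) @ 0^'
    --> E t w.
  exact: (cvg_op (fun h => ext_semigroup_lin (Num.min t (h + t))) bE dq cE).
rewrite /has_deriv; apply: cvg_trans HH; apply: near_eq_cvg; apply/near_dnbhs0P.
exists t => // h h0 ht; have lE := ext_semigroup_lin (Num.min t (h + t)).
rewrite (linZ lE) (linB lE) -(@ext_semigroupE `|h|)// -ext_semigroupD//; last first.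
  by rewrite le_min ltW//=; have := ler_norm (- h); rewrite normrN; lra.
have [th|th] := leP t (h + t).
  have h1 : 0 <= h by move: th; rewrite lerDr.
  by rewrite ger0_norm// (addrC t).
have h1 : h < 0 by move: th; rewrite gtrDr.
have -> : h + t + `|h| = t by rewrite ltr0_norm//; ring.
by rewrite ltr0_norm// invrN scaleNr -scalerN opprB.
Unshelve. all: by end_near. Qed.

Definition orbit_integral t x := bochner_integral 0 (Num.max 0 t) (E ^~ x).
Local Notation J := orbit_integral.

Let max_dist (s t : R) : s <= t ->
  Num.max 0 s <= Num.max 0 t /\ Num.max 0 t - Num.max 0 s <= t - s.
Proof.
by move=> st; have [?|?] := leP 0 s; have [?|?] := leP 0 t; split; lra.
Qed.

Lemma orbit_integral_bound B : exists2 M, 0 < M & forall s t x, s <= B -> t <= B ->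
  `|J t x - J s x| <= M * `|t - s| * `|x|.
Proof.
have [M M0 ME] := ext_semigroup_bound (Num.max 0 B); exists M => // s t x.
wlog st : s t / s <= t => [W sB tB|_ tB].
  have [st|/ltW ts] := leP s t; first exact: W.
  by rewrite (distrC (J t x)) (distrC t); exact: W.
have [st1 st2] := max_dist st.
have m0 a : 0 <= Num.max 0 a :> R by rewrite le_max lexx.
rewrite /J (bochner_integral_itv ip (m0 s) st1 (@ext_semigroup_continuous x)).
rewrite [X in X - _]addrC addrK ger0_norm ?subr_ge0//.
apply: le_trans (bochner_norm_cst ip (M := M * `|x|) st1 _ _) _.
- exact: bochner_integrable_continuous (@ext_semigroup_continuous x).
- move=> r; rewrite in_itv /= => /andP[_ rt]; apply: ME; apply: le_trans rt _.
  by rewrite ge_max !le_max lexx tB orbT.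
- by rewrite mulrAC ler_wpM2r// ler_wpM2l// ltW.
Qed.

Lemma orbit_integral_continuous x : continuous (J ^~ x).
Proof.
move=> t; have [M M0 MJ] := orbit_integral_bound (t + 1).
apply/cvgrPdist_le => e e0.
have Mx : 0 < M * (`|x| + 1) by rewrite mulr_gt0// ltr_wpDl.
near=> s.
have s1 : ball t 1 s by near: s; exact: (nbhsx_ballx t 1 ltr01).
have s2 : ball t (e / (M * (`|x| + 1))) s.
  by near: s; exact: (nbhsx_ballx t _ (divr_gt0 e0 Mx)).
rewrite -ball_normE /= in s1 s2; move/ltW in s1; move/ltW in s2.
apply: le_trans (MJ s t x _ _) _; [|by rewrite lerDl|].
  by rewrite distrC in s1; have := le_trans (ler_norm _) s1; lra.
move: s2; rewrite ler_pdivlMr//; apply: le_trans.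
by rewrite -mulrA mulrCA ler_wpM2l// ler_pM2l// lerDl.
Unshelve. all: by end_near. Qed.

Lemma has_deriv_orbit_integral x t : 0 < t -> has_deriv (J ^~ x) t (E t x).
Proof.
move=> t0; have H := has_deriv_bochner ip t0 (@ext_semigroup_continuous x).
apply: (has_deriv_eq t0 _ H) => s.
by rewrite ltr_distl subrr => /andP[s0 _]; rewrite /J (max_idPr (ltW s0)).
Qed.

Lemma orbit_integral0 x : J 0 x = 0.
Proof.
rewrite /J maxxx; apply/eqP; rewrite -normr_le0 -[leRHS](mulr0 (`|x|)).
rewrite -[X in _ * X](subrr 0); apply: (bochner_norm_cst ip) => //.
  exact: bochner_integrable_continuous (@ext_semigroup_continuous x).
move=> t; rewrite in_itv /= -eq_le => /eqP <-.
by rewrite ext_semigroup0.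
Qed.

Lemma orbit_integral_lin t : linear (J t).
Proof.
move=> a x y; have bE z := @bochner_integrable_continuous _ _ _ 0 (Num.max 0 t)
  (@ext_semigroup_continuous z).
transitivity (bochner_integral 0 (Num.max 0 t) (fun s => a *: E s x + E s y)).
  by apply: (bochner_integral_eq ip _ (bE _)) => s _; exact: ext_semigroup_lin.
exact: (bochner_integralP ip a (bE x) (bE y)).
Qed.

Lemma orbit_integral_op t : bounded_operator (J t).
Proof.
split; first exact: orbit_integral_lin.
have [M M0 MJ] := orbit_integral_bound (Num.max 0 t).
apply: (lin_continuous (orbit_integral_lin t) (M := M * `|t|)) => x.
have := MJ 0 t x; rewrite !le_max !lexx orbT orbit_integral0 !subr0.
exact.
Qed.

(** The semigroup shifts the interval of integration. *)
Lemma semigroup_orbit_integral h t x : 0 <= h -> 0 <= t ->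
  E h (J t x) = J (h + t) x - J h x.
Proof.
move=> h0 t0; have bE := @bochner_integrable_continuous _ _ _ 0 t
  (@ext_semigroup_continuous x).
rewrite {1}/J (max_idPr t0) (bochner_operator ip (ext_semigroup_op h) bE).2.
transitivity (J (h + 1 * t) x - J (h + 1 * 0) x); last by rewrite mul1r mulr0 addr0.
apply: (@bochner_FTC _ _ _ ip (fun s => J (h + 1 * s) x) (fun s => E (h + 1 * s) x)).
- exact: t0.
- exact: (continuous_affine (f := J ^~ x) (@orbit_integral_continuous x)).
- exact: (continuous_affine (f := E ^~ x) (@ext_semigroup_continuous x)).
- move=> s /andP[s0 _]; rewrite -[E _ x]scale1r.
  apply: (has_deriv_affine (F := J ^~ x)); first exact: oner_neq0.
  by apply: has_deriv_orbit_integral; rewrite mul1r ltr_wpDl.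
- by move=> s; rewrite in_itv /= mul1r => /andP[s0 _]; rewrite ext_semigroupD.
Qed.

(** By the shift of the interval, the difference quotient of the semigroup at
[J t x] is a difference of quotients of [J] at [t] and at 0. *)
Lemma generator_orbit_integral t x : 0 < t -> A (J t x) (E t x - x).
Proof.
move=> t0; have [_ ->] := AS.
have c1 : h^-1 *: (J (h + t) x - J t x) @[h --> 0^'+] --> E t x.
  have H := @has_deriv_orbit_integral x t t0.
  move=> U /H; exact: at_right_dnbhs0.
have c2 : h^-1 *: J h x @[h --> 0^'+] --> x.
  apply/cvgrPdist_le => e e0.
  have [d d0 dP] := semigroup_right0 x e0.
  near=> h; have h0 : 0 < h by near: h; exact: nbhs_right_gt.
  have hd : h < d by near: h; exact: nbhs_right_lt.
  rewrite distrC -[x in _ - x]scale1r -(mulVf (lt0r_neq0 h0)) -scalerA -scalerBr.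
  rewrite normrZ gtr0_norm ?invr_gt0// ler_pdivrMl// mulrC.
  have := @bochner_integral_dist _ _ _ ip (E ^~ x) 0 h e 0 (ltW h0)
    (@ext_semigroup_continuous x).
  rewrite subr0 ext_semigroup0 /J (max_idPr (ltW h0)); apply => s.
  rewrite in_itv /= => /andP[s0 sh]; rewrite ext_semigroupE//; apply: dP => //.
  exact: le_lt_trans hd.
have HH : h^-1 *: (J (h + t) x - J t x) - h^-1 *: J h x @[h --> 0^'+] --> E t x - x.
  exact: cvgB c1 c2.
apply: cvg_trans HH; apply: near_eq_cvg; near=> h.
have h0 : 0 < h by near: h; exact: nbhs_right_gt.
rewrite -(ext_semigroupE (ltW h0)) semigroup_orbit_integral; [|exact: ltW|exact: ltW].
by rewrite -scalerBr; congr (_ *: _); exact: addrAC.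
Unshelve. all: by end_near. Qed.

(** The averages [t^-1 J t x] lie in the domain and tend to [x]. *)
Lemma generator_dense x e : 0 < e -> exists v w, A v w /\ `|v - x| <= e.
Proof.
move=> e0; have [d d0 dP] := semigroup_right0 x e0.
pose t := d / 2; have t0 : 0 < t by rewrite divr_gt0.
exists (t^-1 *: J t x), (t^-1 *: (E t x - x)); split.
  have [_ gA] := AS; rewrite gA.
  have := generator_orbit_integral x t0; rewrite gA => H.
  have HH : t^-1 *: (h^-1 *: (S h (J t x) - J t x)) @[h --> 0^'+] -->
      t^-1 *: (E t x - x) by exact: cvgZl_tmp.
  apply: cvg_trans HH; apply: near_eq_cvg.
  near=> h; have h0 : 0 <= h by apply: ltW; near: h; exact: nbhs_right_gt.
  by rewrite /= (linZ (S_op h0).1) -scalerBr !scalerA mulrC.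
rewrite -[x in _ - x]scale1r -(mulVf (lt0r_neq0 t0)) -scalerA -scalerBr.
rewrite normrZ gtr0_norm ?invr_gt0// ler_pdivrMl// mulrC.
have := @bochner_integral_dist _ _ _ ip (E ^~ x) 0 t e 0 (ltW t0)
  (@ext_semigroup_continuous x).
rewrite subr0 ext_semigroup0 /J (max_idPr (ltW t0)); apply => s.
rewrite in_itv /= => /andP[s0 st]; rewrite ext_semigroupE//; apply: dP => //.
by apply: le_lt_trans st _; rewrite /t ltr_pdivrMr// mulr_natr mulr2n ltrDl.
Unshelve. all: by end_near. Qed.

(** The function [s |-> <S(s) v, S(t - s) v'>] has derivative zero, by symmetry
of the generator; its values at [t] and at 0 are the two sides. *)
Lemma semigroup_sym_domain t v w v' w' : 0 <= t -> A v w -> A v' w' ->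
  dot (E t v) v' = dot v (E t v').
Proof.
move=> t0 vw vw'.
have := @FTC_real _ (fun s => dot (E s v) (E (t - s) v')) (fun=> 0) 0 t t0.
rewrite Rintegral_cst//= mul0r subrr subr0 !ext_semigroup0.
move=> H; apply/eqP; rewrite -subr_eq0 -H//.
- move=> s; apply: (cvg_dot ip); first exact: ext_semigroup_continuous.
  exact: (continuous_rev (f := E ^~ v') (@ext_semigroup_continuous v')).
- by move=> s; exact: cvg_cst.
move=> s /andP[s0 st].
have ts0 : 0 < t - s by rewrite subr_gt0.
have d1 := has_deriv_semigroup s0 vw.
have d2 := has_deriv_rev (has_deriv_semigroup ts0 vw').
have := has_deriv_dot ip d1 d2.
rewrite (dotNr ip) (symA (generator_domain (ltW s0) vw)
  (generator_domain (ltW ts0) vw')) subrr.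
exact.
Qed.

Lemma generator_dense_eq0 (g : V -> R) : continuous g ->
  (forall v w, A v w -> g v = 0) -> forall x, g x = 0.
Proof.
move=> cg g0 x; apply/eqP; rewrite -normr_le0; apply/ler_addgt0Pl => e e0.
have /cvgrPdist_le /(_ _ e0) /nbhs_ballP [d /= d0 dP] := cg x.
have [v [w [vw vx]]] := generator_dense x (divr_gt0 d0 (ltr0n R 2)).
have := dP v; rewrite (g0 _ _ vw) subr0 addr0; apply.
rewrite -ball_normE /= distrC (le_lt_trans vx)//.
by rewrite ltr_pdivrMr// mulr_natr mulr2n ltrDl.
Qed.

(** Density of the domain extends symmetry to one argument and then to the
other. *)
Lemma semigroup_sym t x y : dot (E t x) y = dot x (E t y).
Proof.
have Et z : E t z = E (Num.max 0 t) z by rewrite /E maxA maxxx.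
have cE z : continuous (fun x => dot (E t x) z : R).
  by move=> x'; apply: (cvg_dot ip); [exact: (ext_semigroup_op t).2|exact: cvg_cst].
have cid z : continuous (fun x => dot x z : R) by exact: dotl_continuous.
have H z v w : A v w -> dot (E t z) v = dot z (E t v).
  move=> vw; apply/eqP; rewrite -subr_eq0; apply/eqP; move: z.
  apply: generator_dense_eq0 => [z|z z' zz].
    by apply: cvgB; [exact: cE|exact: cid].
  rewrite !Et (semigroup_sym_domain _ zz vw) ?subrr//.
  by rewrite le_max lexx.
apply/eqP; rewrite -subr_eq0; apply/eqP; move: y.
apply: generator_dense_eq0 => [z|z z' zz]; last by rewrite (H _ _ _ zz) subrr.
apply: cvgB; apply: (cvg_dot ip); [exact: cvg_cst|exact: cvg_id|exact: cvg_cst|].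
exact: (ext_semigroup_op t).2.
Qed.

End semigroup.

(** * The Gramian and its resolvent *)

Lemma continuous_shift {R : realType} {V : normedModType R} (f : R -> V) t :
  continuous f -> f (h + t) @[h --> 0^'] --> f t.
Proof.
move=> cf; rewrite -{2}[t]add0r; apply: cvg_within_filter.
apply: (@continuous_comp _ _ _ (fun h : R => h + t) f 0); last exact: cf.
by apply: cvgD; [exact: cvg_id|exact: cvg_cst].
Qed.

Section gramian.
Context {R : realType} {V : completeNormedModType R} (dot : V -> V -> R).
Context (ip : inner_product dot).
Context (S : R -> V -> V) (A : V -> V -> Prop).
Context (AS : generates A S).
Context (symA : forall v w v' w', A v w -> A v' w' -> dot w v' = dot v w').
Context (gamma : R).
Context (gamma0 : 0 < gamma).

Local Notation E := (ext_semigroup S).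
Local Notation J := (orbit_integral S).
Let E_op t : bounded_operator (E t) := ext_semigroup_op AS t.
Let E_lin t : linear (E t) := ext_semigroup_lin AS t.
Let E_cont x : continuous (E ^~ x) := @ext_semigroup_continuous _ _ _ _ AS x.
Let E0 := ext_semigroup0 AS.
Let ED := ext_semigroupD AS.
Let EC := ext_semigroupC AS.
Let E_sym := semigroup_sym ip AS symA.

Lemma semigroup_comp_continuous (u : R -> V) : continuous u ->
  continuous (fun s => E s (u s)).
Proof.
move=> cu t; have [M M0 ME] := ext_semigroup_bound AS (t + 1).
apply: (cvg_op (K := E) (F := nbhs t) E_lin (M := M) _ (cu t) (@E_cont _ t)).
near=> s => x; apply: ME.
have : ball t 1 s by near: s; exact: (nbhsx_ballx t 1 ltr01).
by rewrite -ball_normE /= ltr_distlC => /andP[_ /ltW].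
Unshelve. all: by end_near. Qed.

Lemma orbit_integral_comm (L : V -> V) t x : bounded_operator L ->
  (forall r z, L (E r z) = E r (L z)) -> L (J t x) = J t (L x).
Proof.
move=> bL LE; have bE := bochner_integrable_continuous 0 (Num.max 0 t) (@E_cont x).
have [bLE ->] := bochner_operator ip bL bE.
by apply: (bochner_integral_eq ip) => // s _ /=; rewrite LE.
Qed.

Lemma orbit_integral_sym t x y : dot (J t x) y = dot x (J t y).
Proof.
have bE z := bochner_integrable_continuous 0 (Num.max 0 t) (@E_cont z).
rewrite (dotC ip x) (bochner_dot ip y (bE x)) (bochner_dot ip x (bE y)).
by apply: eq_Rintegral => s _; rewrite E_sym (dotC ip).
Qed.

(** The semigroup at time [s] is the square of the symmetric operator at time
[s / 2]. *)
Lemma orbit_integral_ge0 t x : 0 <= dot (J t x) x.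
Proof.
rewrite (bochner_dot ip); last exact: bochner_integrable_continuous.
apply: Rintegral_ge0 => s; rewrite /= in_itv /= => /andP[s0 _].
have s20 : 0 <= s / 2 by rewrite divr_ge0.
by rewrite [s]splitr ED// E_sym (dot_self ip) sqr_ge0.
Qed.

(** The Gramian [int_0^t S(2 s) ds], written through the orbit integral so that
it inherits its properties. *)
Definition gramian t x := 2^-1 *: J (2 * t) x.
Local Notation Q := gramian.

Lemma gramian_op t : bounded_operator (Q t).
Proof. exact: (bounded_operatorZ 2^-1 (orbit_integral_op ip AS (2 * t))). Qed.

Lemma gramian0 x : Q 0 x = 0.
Proof. by rewrite /Q mulr0 (orbit_integral0 ip AS) scaler0. Qed.

Lemma gramian_comm (L : V -> V) t x : bounded_operator L ->
  (forall r z, L (E r z) = E r (L z)) -> L (Q t x) = Q t (L x).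
Proof. by move=> bL LE; rewrite /Q (linZ bL.1) orbit_integral_comm. Qed.

(** Additivity over consecutive intervals, the second one being shifted by the
semigroup. *)
Lemma gramianD s t x : 0 <= s -> 0 <= t -> Q (s + t) x = Q s x + E (2 * s) (Q t x).
Proof.
move=> s0 t0; rewrite /Q (linZ (E_lin _)) (semigroup_orbit_integral ip AS) ?mulr_ge0//.
by rewrite scalerBr mulrDr [RHS]addrC subrK.
Qed.

Lemma has_deriv_gramian x t : 0 < t -> has_deriv (Q ^~ x) t (E (2 * t) x).
Proof.
move=> t0; rewrite -[E _ x](scalerK (_ : (2 : R) != 0)) ?pnatr_eq0//.
apply: has_derivZ; rewrite (_ : (fun s => _) = (fun s => J (0 + 2 * s) x)).
  apply: (@has_deriv_affine _ _ (J ^~ x)); first by rewrite pnatr_eq0.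
  by rewrite add0r; apply: (has_deriv_orbit_integral ip AS); rewrite mulr_gt0.
by apply/funext => s; rewrite add0r.
Qed.

Lemma gramian_continuous x : continuous (Q ^~ x).
Proof.
have c : continuous (fun s : R => J (2 * s) x).
  rewrite (_ : (fun s => _) = (fun s => J (0 + 2 * s) x)).
    exact: (continuous_affine (@orbit_integral_continuous _ _ _ ip _ _ AS x)).
  by apply/funext => s; rewrite add0r.
by move=> t; apply: cvgZl_tmp; exact: c.
Qed.

(** The operator [1 + gamma Q(t)], coercive because the Gramian is
nonnegative. *)
Definition coercive_gramian t x := x + gamma *: Q t x.
Local Notation B := coercive_gramian.

Lemma coercive_gramian_op t : bounded_operator (B t).
Proof.
have [lQ cQ] := bounded_operatorZ gamma (gramian_op t); split=> [a x y|x].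
  by rewrite [a *: B t x]scalerDr [RHS]addrACA; congr (_ + _); exact: lQ.
by apply: cvgD; [exact: cvg_id|exact: cQ].
Qed.

Lemma coercive_gramian_coercive t x : `|x| ^+ 2 <= dot (B t x) x.
Proof.
rewrite /B (dotDl ip) (dot_self ip) lerDl !(dotZl ip).
by rewrite !mulr_ge0 ?invr_ge0 ?orbit_integral_ge0// ltW.
Qed.

Definition resolvent t x : V :=
  sval (cid (coercive_surj ip (coercive_gramian_op t) (coercive_gramian_coercive t) x)).
Local Notation N := resolvent.

Lemma resolventK t x : B t (N t x) = x.
Proof. by rewrite /N; case: cid. Qed.

Lemma coercive_gramianK t x : N t (B t x) = x.
Proof.
apply: (coercive_inj ip (coercive_gramian_op t) (coercive_gramian_coercive t)).
by rewrite resolventK.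
Qed.

Lemma resolvent_lin t : linear (N t).
Proof.
move=> a x y; rewrite -[RHS](coercive_gramianK t).
by rewrite (coercive_gramian_op t).1 !resolventK.
Qed.

Lemma resolvent_norm t x : `|N t x| <= `|x|.
Proof.
by rewrite -{2}(resolventK t x) (coercive_norm ip (coercive_gramian_coercive t)).
Qed.

Lemma resolvent_op t : bounded_operator (N t).
Proof.
split; first exact: resolvent_lin.
apply: (lin_continuous (resolvent_lin t) (M := 1)) => x.
by rewrite mul1r resolvent_norm.
Qed.

Lemma resolvent_comm (L : V -> V) t x : bounded_operator L ->
  (forall r z, L (E r z) = E r (L z)) -> L (N t x) = N t (L x).
Proof.
move=> bL LE; rewrite -{2}(resolventK t x) -[LHS](coercive_gramianK t); congr (N t _).
by rewrite /B (linD bL.1) (linZ bL.1) (gramian_comm _ _ bL LE).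
Qed.

Lemma resolventC r t x : E r (N t x) = N t (E r x).
Proof. by apply: resolvent_comm => // s z; rewrite EC. Qed.

Lemma resolvent_sym t x y : dot (N t x) y = dot x (N t y).
Proof.
have B_sym u v : dot (B t u) v = dot u (B t v).
  rewrite /B (dotDl ip) (dotDr ip) !(dotZl ip) !(dotZr ip).
  by rewrite orbit_integral_sym.
by rewrite -{1}(resolventK t y) -B_sym resolventK.
Qed.

Lemma resolvent0 x : N 0 x = x.
Proof. by rewrite -{1}[x](_ : B 0 x = x) ?coercive_gramianK// /B gramian0 scaler0 addr0. Qed.

(** The resolvent identity. It reduces the continuity and the derivative of the
inverse to those of the Gramian. *)
Lemma resolventB s t x :
  N s x - N t x = - gamma *: N s (Q s (N t x) - Q t (N t x)).
Proof.
have lN := resolvent_lin s; rewrite -(linZ lN).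
move: (resolventK t x); move: (N t x) => y <-.
rewrite -[X in _ - X](coercive_gramianK s y) -(linB lN). congr (N s _).
by rewrite /B opprD addrACA subrr add0r -scalerBr scaleNr -scalerN opprB.
Qed.

Lemma resolvent_continuous x : continuous (N ^~ x).
Proof.
move=> t; have H : (fun s => N s x - N t x) @ nbhs t --> (0 : V).
  rewrite (_ : (fun s => _) = (fun s => N s (- gamma *: (Q s (N t x) - Q t (N t x))))).
    apply: (cvg_op (z0 := 0) (M := 1) resolvent_lin).
    - by near=> s => y; rewrite mul1r resolvent_norm.
    - rewrite -(scaler0 _ (- gamma)); apply: cvgZl_tmp.
      rewrite -(subrr (Q t (N t x))); apply: cvgB; last exact: cvg_cst.
      exact: gramian_continuous.
    - rewrite (_ : (fun s => _) = cst 0); first exact: cvg_cst.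
      by apply/funext => s; rewrite (lin0 (resolvent_lin s)).
  by apply/funext => s; rewrite resolventB (linZ (resolvent_lin s)).
have H2 : (fun s => N s x - N t x + N t x) @ nbhs t --> 0 + N t x.
  by apply: cvgD => //; exact: cvg_cst.
rewrite add0r in H2; move: H2.
by rewrite (_ : (fun s => _) = N ^~ x)//; apply/funext => s; rewrite subrK.
Unshelve. all: by end_near. Qed.

Lemma resolvent_comp_continuous (u : R -> V) : continuous u ->
  continuous (fun s => N s (u s)).
Proof.
move=> cu t.
apply: (cvg_op (K := N) (F := nbhs t) resolvent_lin (M := 1) _ (cu t) (@resolvent_continuous _ t)).
by near=> s => x; rewrite mul1r resolvent_norm.
Unshelve. all: by end_near. Qed.

(** The derivative [- gamma N S(2 t) N] of an inverse; only strong
continuity is available, and it suffices since the resolvents are contractions. *)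
Lemma has_deriv_resolvent x t : 0 < t ->
  has_deriv (N ^~ x) t (- gamma *: N t (E (2 * t) (N t x))).
Proof.
move=> t0; rewrite /has_deriv -(linZ (resolvent_lin t)).
rewrite (_ : (fun h => _) = (fun h => N (h + t) (- gamma *:
    (h^-1 *: (Q (h + t) (N t x) - Q t (N t x)))))); last first.
  apply/funext => h; rewrite resolventB !(linZ (resolvent_lin _)).
  by rewrite !scalerA mulrC.
apply: (cvg_op (K := fun h => N (h + t)) (M := 1)).
- by move=> h; exact: resolvent_lin.
- by near=> h => y; rewrite mul1r resolvent_norm.
- by apply: cvgZl_tmp; exact: has_deriv_gramian.
- exact: continuous_shift (@resolvent_continuous _).
Unshelve. all: by end_near. Qed.

Lemma has_deriv_resolvent_comp (u : R -> V) t u' : 0 < t -> has_deriv u t u' ->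
  has_deriv (fun s => N s (u s)) t
    (- gamma *: N t (E (2 * t) (N t (u t))) + N t u').
Proof.
move=> t0 Hu; apply: (has_deriv_op (M := 1) resolvent_lin _ Hu).
- by near=> h => y; rewrite mul1r resolvent_norm.
- exact: has_deriv_resolvent.
- exact: continuous_shift (@resolvent_continuous _).
Unshelve. all: by end_near. Qed.

End gramian.

(** * Explicit solutions of the optimality equations *)

Lemma op_continuous {R : realType} {V : normedModType R} (L : V -> V) (u : R -> V) :
  bounded_operator L -> continuous u -> continuous (fun s => L (u s)).
Proof.
by move=> [_ cL] cu s; apply: (@continuous_comp _ _ _ u L); [exact: cu|exact: cL].
Qed.

Section explicit_solution.
Context {R : realType} {V : completeNormedModType R} (dot : V -> V -> R).
Context (ip : inner_product dot).
Context (S : R -> V -> V) (A : V -> V -> Prop).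
Context (AS : generates A S).
Context (symA : forall v w v' w', A v w -> A v' w' -> dot w v' = dot v w').
Context (gamma : R).
Context (gamma0 : 0 < gamma).

Local Notation E := (ext_semigroup S).
Local Notation Q := (gramian S).
Local Notation N := (resolvent ip AS symA gamma0).
Let E_op t : bounded_operator (E t) := ext_semigroup_op AS t.
Let E_lin t : linear (E t) := ext_semigroup_lin AS t.
Let E_cont x : continuous (E ^~ x) := @ext_semigroup_continuous _ _ _ _ AS x.
Let E0 := ext_semigroup0 AS.
Let ED := ext_semigroupD AS.
Let EC := ext_semigroupC AS.
Let ES := @ext_semigroupE _ _ S.
Let E_sym := semigroup_sym ip AS symA.
Let N_lin := resolvent_lin ip AS symA gamma0.
Let NE := resolventC ip AS symA gamma0.
Let N0 := resolvent0 ip AS symA gamma0.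

(** The scalar solution of [p' = 2 a p - p ^ 2], [p(0) = gamma], with [A] in place
of [a]. *)
Definition riccati t x := gamma *: E (2 * t) (N t x).
Local Notation P := riccati.

Lemma riccati_op t : bounded_operator (P t).
Proof.
apply: bounded_operatorZ; apply: (bounded_operator_comp (E_op _)).
exact: resolvent_op.
Qed.

Lemma semigroup2_comp_continuous (u : R -> V) : continuous u ->
  continuous (fun s : R => E (2 * s) (u s)).
Proof.
move=> cu; have c1 : continuous (fun s : R => u (0 + 2^-1 * s)) by exact: continuous_affine.
have c2 := semigroup_comp_continuous AS c1.
have := continuous_affine (a := 0) (c := 2) c2.
rewrite (_ : (fun s => _) = (fun s => E (2 * s) (u s)))//.
by apply/funext => s; rewrite !add0r mulrA mulVf ?pnatr_eq0// mul1r.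
Qed.

Lemma riccati_continuous x : continuous (P ^~ x).
Proof.
have c : continuous (fun s : R => E (2 * s) (N s x)).
  by apply: semigroup2_comp_continuous; exact: resolvent_continuous.
by move=> t; apply: cvgZl_tmp; exact: c.
Qed.

Lemma riccati_sym t x y : dot (P t x) y = dot x (P t y).
Proof.
by rewrite /P (dotZl ip) (dotZr ip) E_sym resolvent_sym NE.
Qed.

(** By commutation the integrand is
[gamma ^ 2 S(2 t) S(2 s) N(s) ^ 2 x], the derivative of
[- gamma S(2 t) N(s) x]. The value of this primitive at [s = 0] is the first
term of the equation. *)
Lemma riccati_equation t x : 0 <= t -> P t x = gamma *: S (2 * t) x -
  bochner_integral 0 t (fun s => S (t - s) (P s (P s (S (t - s) x)))).
Proof.
move=> t0; pose G s := (gamma * gamma) *: E (2 * t) (N s (E (2 * s) (N s x))).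
rewrite (@bochner_FTC _ _ _ ip (fun s => - (gamma *: E (2 * t) (N s x))) G _ 0 t t0).
- by rewrite /P N0 -ES ?mulr_ge0// opprK opprD opprK addrC subrK.
- move=> s; apply: cvgN; apply: cvgZl_tmp.
  by apply: op_continuous => //; exact: resolvent_continuous.
- have c1 : continuous (fun s : R => N s (E (2 * s) (N s x))).
    by apply: resolvent_comp_continuous; apply: semigroup2_comp_continuous; exact: resolvent_continuous.
  move=> s; apply: cvgZl_tmp.
  exact: op_continuous.
- move=> s /andP[s0 st]; rewrite /G.
  have := @has_deriv_resolvent _ _ _ ip _ _ AS symA _ gamma0 x s s0.
  move/(has_deriv_lin (E_lin (2 * t)) (E_op (2 * t)).2).
  move/(has_derivZ (c := gamma))/has_derivN.
  by rewrite (linZ (E_lin _)) scalerA mulrN scaleNr opprK.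
- move=> s; rewrite in_itv /= => /andP[s0 st]; rewrite /G /P.
  have [d d0 dE] : exists2 d, 0 <= d & t - s = d.
    by exists (t - s); rewrite ?subr_ge0.
  rewrite dE -!(ES d0) !(linZ (N_lin _), linZ (E_lin _)) scalerA; congr (_ *: _).
  rewrite !NE -!ED ?addr_ge0 ?mulr_ge0//.
  by congr (N _ (N _ (E _ _))); rewrite -dE; ring.
Qed.

Section tracking.
Context (h Ah x0 : V) (T : R).
Context (hA : A h Ah) (T0 : 0 < T).
Let f := - Ah.

(** The defect [h - S(s) h] of the target from being an equilibrium; it has
derivative [S(s) f]. *)
Definition gap s := h - E s h.
Local Notation k := gap.

Lemma gap_continuous : continuous k.
Proof. by move=> s; apply: cvgB; [exact: cvg_cst|exact: E_cont]. Qed.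

Lemma has_deriv_gap s : 0 < s -> has_deriv k s (E s f).
Proof.
move=> s0; rewrite -[E s f]add0r; apply: has_derivD; first exact: has_deriv_cst.
by rewrite (linN (E_lin _)); apply: has_derivN;
  exact: (has_deriv_semigroup AS s0 hA).
Qed.

(** The part of the optimal feedback that does not depend on the state, as a
function of the remaining time. *)
Definition feedforward s := gamma *: E s (N s (k s)).
Local Notation rho := feedforward.

Lemma feedforward_continuous : continuous rho.
Proof.
have c : continuous (fun s : R => E s (N s (k s))).
  apply: (semigroup_comp_continuous AS); apply: resolvent_comp_continuous; exact: gap_continuous.
by move=> s; apply: cvgZl_tmp; exact: c.
Qed.

Definition feedforward_rev t := rho (T - t).

Lemma feedforward_rev_continuous : continuous feedforward_rev.
Proof. exact: (continuous_rev feedforward_continuous). Qed.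

(** The integrand is the derivative in [s] of
[- gamma S(T - t) N(T - s) k(T - s)], where [k] is the gap. This primitive vanishes
at [s = T]. *)
Lemma feedforward_rev_equation t : 0 <= t -> t <= T ->
  feedforward_rev t = bochner_integral t T
    (fun s => S (s - t) (P (T - s) f - P (T - s) (feedforward_rev s))).
Proof.
move=> t0 tT; pose g s := - gamma *: N s (E (2 * s) (N s (k s))) + N s (E s f).
pose G s := gamma *: E (T - t) (g (T - s)).
pose F s := - (gamma *: E (T - t) (N (T - s) (k (T - s)))).
have cN : continuous (fun s : R => N s (k s)).
  by apply: resolvent_comp_continuous; exact: gap_continuous.
have cg : continuous g.
  move=> s; apply: cvgD.
    apply: cvgZl_tmp; apply: resolvent_comp_continuous; exact: semigroup2_comp_continuous.
  exact: resolvent_comp_continuous.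
have tau0 : 0 <= T - t by rewrite subr_ge0.
rewrite (@bochner_FTC _ _ _ ip F G _ t T tT).
- rewrite /F /feedforward_rev /feedforward subrr /gap E0 subrr (lin0 (N_lin _)).
  by rewrite (lin0 (E_lin _)) scaler0 oppr0 add0r opprK.
- move=> s; apply: cvgN; apply: cvgZl_tmp.
  apply: (op_continuous (u := fun s => N (T - s) (k (T - s))) (E_op (T - t))).
  exact: (continuous_rev cN).
- move=> s; apply: cvgZl_tmp.
  apply: (op_continuous (u := fun s => g (T - s)) (E_op (T - t))).
  exact: (continuous_rev cg).
- move=> s /andP[ts sT]; have Ts0 : 0 < T - s by rewrite subr_gt0.
  have := @has_deriv_resolvent_comp _ _ _ ip _ _ AS symA _ gamma0 _ _ _ Ts0
    (has_deriv_gap Ts0).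
  rewrite -/(g (T - s)) => /(@has_deriv_rev _ _ (fun s => N s (k s))).
  move/(has_deriv_lin (E_lin (T - t)) (E_op (T - t)).2).
  move/(has_derivZ (c := gamma))/has_derivN.
  by rewrite (linN (E_lin _)) scalerN opprK.
- move=> s; rewrite in_itv /= => /andP[ts sT].
  have [q q0 qE] : exists2 q, 0 <= q & T - s = q.
    by exists (T - s); rewrite ?subr_ge0.
  have [d d0 dE] : exists2 d, 0 <= d & s - t = d.
    by exists (s - t); rewrite ?subr_ge0.
  have -> : G s = gamma *: E (d + q) (g q).
    by rewrite /G qE -qE -dE; congr (_ *: E _ _); ring.
  rewrite /feedforward_rev qE dE -(ES d0) /g /feedforward /P; set K := k q.
  rewrite !(linB (E_lin _)) (linD (E_lin _)) !(linZ (N_lin _), linZ (E_lin _)).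
  rewrite scalerDr [RHS]addrC !scaleNr !scalerN !NE -!ED ?addr_ge0 ?mulr_ge0//.
  congr (_ *: N _ (E _ _) - _ *: (_ *: N _ (N _ (E _ _)))); ring.
Qed.

(** The final value of the adjoint state: the optimal control is
[t |-> S(T - t) p], and [p = - gamma (x(T) - h)]. *)
Definition final_adjoint := gamma *: N T (h - E T x0).
Local Notation p := final_adjoint.

Lemma final_adjointE : gamma *: (h - E T x0) = p + gamma *: Q T p.
Proof.
rewrite -{1}(resolventK ip AS symA gamma0 T (h - E T x0)) /coercive_gramian.
by rewrite scalerDr /p (linZ (gramian_op ip AS T).1).
Qed.

(** The distance [h - x(t)] to the target for the state driven by
[S(T - s) p], whose integral over [[0, t]] is [S(T - t) Q(t) p]. *)
Definition closed_loop t := h - E t x0 - E (T - t) (Q t p).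
Local Notation y := closed_loop.

Lemma closed_loop_continuous : continuous y.
Proof.
have c1 : continuous (fun s : R => E s (Q (T - s) p)).
  apply: (semigroup_comp_continuous AS).
  exact: (continuous_rev (@gramian_continuous _ _ _ ip _ _ AS p)).
have c2 : continuous (fun s => E (T - s) (Q s p)).
  rewrite (_ : (fun s => _) = (fun s => E (T - s) (Q (T - (T - s)) p))).
    exact: (continuous_rev c1).
  by apply/funext => s; rewrite subKr.
by move=> s; apply: cvgB; [apply: cvgB; [exact: cvg_cst|exact: E_cont]|exact: c2].
Qed.

(** Using [gamma (h - S(T) x0) = (1 + gamma Q(T)) p] and
[Q(T) = Q(T - t) + S(2 (T - t)) Q(t)], the left-hand side becomes
[S(T - t) N(T - t) (1 + gamma Q(T - t)) p]. *)
Lemma feedback t : 0 <= t -> t <= T ->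
  P (T - t) (y t) + feedforward_rev t = E (T - t) p.
Proof.
move=> t0 tT; have tau0 : 0 <= T - t by rewrite subr_ge0.
have Tt : T - t + t = T by rewrite subrK.
have e1 : E (T - t) (y t) + k (T - t) =
    (h - E T x0) - E (2 * (T - t)) (Q t p).
  rewrite /y /k !(linB (E_lin _)) -!ED// Tt mulr_natl mulr2n.
  by rewrite [LHS]addrC addrA [X in X - _](_ : _ = h - E T x0)// addrA subrK.
have e3 : Q T p = Q (T - t) p + E (2 * (T - t)) (Q t p).
  by have := gramianD ip AS p tau0 t0; rewrite Tt.
rewrite /P /feedforward_rev /feedforward mulr_natl mulr2n ED// -scalerDr -(linD (E_lin _)).
rewrite (NE (T - t)) -(linD (N_lin _)) e1 -(linZ (E_lin _)) -(linZ (N_lin _)).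
rewrite scalerBr final_adjointE e3 scalerDr addrA addrK.
by rewrite -[p + _]/(coercive_gramian S gamma (T - t) p) coercive_gramianK.
Qed.

(** By [feedback] the integrand is [S(t - s) (f - S(T - s) p)], which has the
primitive [S(t - s) h + S(T - t) Q(t - s) p]. *)
Lemma closed_loop_equation t : 0 <= t -> t <= T ->
  y t = S t (h - x0) + bochner_integral 0 t
    (fun s => S (t - s) (- P (T - s) (y s) - feedforward_rev s + f)).
Proof.
move=> t0 tT; have tau0 : 0 <= T - t by rewrite subr_ge0.
pose F s := E (t - s) h + E (T - t) (Q (t - s) p).
pose G s := E (t - s) f - E (T - t) (E (2 * (t - s)) p).
rewrite (@bochner_FTC _ _ _ ip F G _ 0 t t0).
- rewrite /F !subr0 (subrr t) E0 (gramian0 ip AS) (lin0 (E_lin _)) addr0.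
  rewrite -(ES t0) (linB (E_lin _)) /y opprD (addrA h) [RHS]addrA.
  by congr (_ - _); rewrite [RHS]addrC addrA subrK.
- move=> s; apply: cvgD; first exact: (continuous_rev (f := E ^~ h) (@E_cont h)).
  apply: (op_continuous (u := fun s => Q (t - s) p) (E_op (T - t))).
  exact: (continuous_rev (@gramian_continuous _ _ _ ip _ _ AS p)).
- move=> s; apply: cvgB; first exact: (continuous_rev (f := E ^~ f) (@E_cont f)).
  apply: (op_continuous (u := fun s => E (2 * (t - s)) p) (E_op (T - t))).
  have c : continuous (fun s : R => E (2 * s) p).
    by apply: (semigroup2_comp_continuous (u := fun=> p)) => r; exact: cvg_cst.
  exact: (continuous_rev c).
- move=> s /andP[s0 st]; have ts0 : 0 < t - s by rewrite subr_gt0.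
  apply: has_derivD.
    rewrite (linN (E_lin _)); apply: (has_deriv_rev (F := E ^~ h)).
    exact: (has_deriv_semigroup AS ts0 hA).
  rewrite -(linN (E_lin _)); apply: (has_deriv_lin (E_lin _) (E_op _).2).
  apply: (has_deriv_rev (F := Q ^~ p)).
  exact: (has_deriv_gramian ip AS).
- move=> s; rewrite in_itv /= => /andP[s0 st].
  have ts0 : 0 <= t - s by rewrite subr_ge0.
  have Ts0 : 0 <= T - s by rewrite subr_ge0 (le_trans st).
  rewrite -opprD feedback ?(le_trans st)// -(ES ts0) [X in E _ X]addrC (linB (E_lin _)).
  rewrite /G; congr (_ - _); rewrite -!ED ?mulr_ge0//.
  by congr (E _ _); ring.
Qed.

End tracking.
End explicit_solution.

(** * Uniqueness *)

Section clamp.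
Context {R : realType}.
Implicit Types T s t : R.

(** The retraction of the line onto the interval. Composing with it extends
functions that are continuous within the interval to the whole line. *)
Definition clamp T s := Num.max 0 (Num.min T s).

Lemma clamp_itv T s : 0 <= T -> clamp T s \in `[0, T].
Proof.
by move=> T0; rewrite in_itv /= /clamp le_max lexx /= ge_max T0 ge_min lexx.
Qed.

Lemma clamp_id T s : s \in `[0, T] -> clamp T s = s.
Proof.
by rewrite in_itv /= => /andP[s0 sT]; rewrite /clamp (min_idPr sT) (max_idPr s0).
Qed.

Lemma clamp_dist T s t : 0 <= T -> `|clamp T s - clamp T t| <= `|s - t|.
Proof.
move=> T0; wlog st : s t / s <= t => [W|].
  have [/W//|/ltW /W] := leP s t.
  by rewrite distrC [X in _ <= X]distrC.
have : clamp T s <= clamp T t /\ clamp T t - clamp T s <= t - s.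
  rewrite /clamp.
  by have [?|?] := leP T s; have [?|?] := leP T t; have [?|?] := leP 0 T;
    have [?|?] := leP 0 s; have [?|?] := leP 0 t; split; lra.
by move=> [c1 c2]; rewrite !ler0_norm ?subr_le0// !opprB.
Qed.

Lemma clamp_continuous T {U : topologicalType} (f : R -> U) : 0 <= T ->
  {within `[0, T], continuous f} -> continuous (f \o clamp T).
Proof.
move=> T0 /subspace_continuousP cf s W /(cf _ (clamp_itv s T0)) /=.
move=> /nbhs_ballP [d /= d0 dP]; apply/nbhs_ballP; exists d => // t.
rewrite -ball_normE /= => st; apply: dP; last exact: clamp_itv.
by rewrite -ball_normE /= (le_lt_trans (clamp_dist _ _ T0)).
Qed.

Lemma continuous_bounded T (g : R -> R) : 0 <= T -> {within `[0, T], continuous g} ->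
  exists2 C, 0 <= C & forall t, t \in `[0, T] -> g t <= C.
Proof.
move=> T0 cg; have [c _ gc] := EVT_max T0 cg.
by exists `|g c| => // t tT; rewrite (le_trans (gc _ tT))// ler_norm.
Qed.

End clamp.

(** The form of Gronwall's lemma used here: if every bound of [phi] relative to the weight
[w] can be halved, then the bounds tend to zero. *)
Lemma halving_le0 {R : realType} {I : Type} (D : I -> Prop) (phi w : I -> R) (C : R) :
  0 <= C -> (forall i, D i -> phi i <= C * w i) ->
  (forall K, 0 <= K -> (forall i, D i -> phi i <= K * w i) ->
    forall i, D i -> phi i <= K / 2 * w i) ->
  forall i, D i -> phi i <= 0.
Proof.
move=> C0 phiC half i Di.
have H n : 0 <= C * 2^-1 ^+ n /\ forall i, D i -> phi i <= C * 2^-1 ^+ n * w i.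
  elim: n => [|n [K0 ih]]; first by rewrite expr0 mulr1.
  rewrite exprSr mulrA; split; last exact: half.
  by rewrite divr_ge0.
have c : C * 2^-1 ^+ n * w i @[n --> \oo] --> (C * 0 * w i : R).
  apply: cvgM; last exact: cvg_cst.
  by apply: cvgM; [exact: cvg_cst|apply: cvg_expr; rewrite ger0_norm//; lra].
rewrite mulr0 mul0r in c; have cp : phi i @[_ --> \oo] --> phi i by exact: cvg_cst.
by apply: (ler_cvg_to cp c); apply: nearW => n; exact: (H n).2.
Qed.

Lemma has_deriv_exp {R : realType} (c a t : R) :
  has_deriv (fun s => c * expR (a * s) : R) t (c * (a * expR (a * t))).
Proof.
have He (x : R) : has_deriv (expR : R -> R) x (expR x).
  have H : (fun h => h^-1 *: ((expR \o shift x) h%:A - expR x)) @ 0^' --> 'D_1 expR x.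
    exact: (@derivable_expR R x).
  rewrite -[X in has_deriv _ _ X](congr1 (fun f => f x) (@derive_expR R)).
  move: H; rewrite /has_deriv.
  set d := (fun _ : R => _); set d' := (fun _ : R => _).
  by suff -> : d' = d by []; apply/funext => h; rewrite /d /d' /= [h%:A](mulr1).
have [->|a0] := eqVneq a 0.
  rewrite mul0r mulr0 (_ : (fun s => _) = cst c); first exact: has_deriv_cst.
  by apply/funext => s; rewrite mul0r expR0 mulr1.
apply: (has_derivZ (c := c)); rewrite (_ : (fun s => _) = (fun s => expR (0 + a * s))).
  by apply: has_deriv_affine => //; rewrite add0r; exact: He.
by apply/funext => s; rewrite add0r.
Qed.

Lemma continuous_exp {R : realType} (c a : R) : continuous (fun s => c * expR (a * s) : R).
Proof.
move=> s; apply: cvgM; first exact: cvg_cst.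
apply: (@continuous_comp _ _ _ (fun s => a * s) expR); last exact: continuous_expR.
by apply: cvgM; [exact: cvg_cst|exact: cvg_id].
Qed.

Section uniqueness.
Context {R : realType} {V : completeNormedModType R} (dot : V -> V -> R).
Context (ip : inner_product dot).
Context (S : R -> V -> V) (A : V -> V -> Prop).
Context (AS : generates A S).
Context (T : R).
Context (T0 : 0 < T).

Local Notation E := (ext_semigroup S).
Let E_op t : bounded_operator (E t) := ext_semigroup_op AS t.
Let E_lin t : linear (E t) := ext_semigroup_lin AS t.
Let E_cont x : continuous (E ^~ x) := @ext_semigroup_continuous _ _ _ _ AS x.
Let ES := @ext_semigroupE _ _ S.

(** An exponential weight of rate [2 a] has the primitive that absorbs the
Lipschitz constant [a] and leaves the factor 1/2 required by
[halving_le0]. *)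
Lemma volterra_forward (f : R -> V) a K t : 0 <= t -> 0 <= K ->
  bochner_integrable 0 t f ->
  (forall s, s \in `[0, t] -> `|f s| <= a * (K * expR (2 * a * s))) ->
  `|bochner_integral 0 t f| <= K / 2 * expR (2 * a * t).
Proof.
move=> t0 K0 bf fK.
apply: (@le_trans _ _ (K / 2 * expR (2 * a * t) - K / 2 * expR (2 * a * 0))).
  apply: (bochner_norm_primitive ip (F := fun s => K / 2 * expR (2 * a * s))
    (G := fun s => a * K * expR (2 * a * s)) t0 _ _ _ bf).
  - exact: continuous_exp.
  - exact: continuous_exp.
  - move=> s; rewrite (_ : a * K * _ = K / 2 * (2 * a * expR (2 * a * s))).
      exact: has_deriv_exp.
    by field.
  - by move=> s sI; rewrite -mulrA fK.
by rewrite gerBl mulr_ge0 ?expR_ge0// divr_ge0.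
Qed.

(** The same with the weight running in the remaining time. *)
Lemma volterra_backward (f : R -> V) a K t : t <= T -> 0 <= K ->
  bochner_integrable t T f ->
  (forall s, s \in `[t, T] -> `|f s| <= a * (K * expR (2 * a * (T - s)))) ->
  `|bochner_integral t T f| <= K / 2 * expR (2 * a * (T - t)).
Proof.
move=> tT K0 bf fK.
apply: (@le_trans _ _ (- (K / 2 * expR (2 * a * (T - T))) -
    - (K / 2 * expR (2 * a * (T - t))))).
  apply: (bochner_norm_primitive ip (F := fun s => - (K / 2 * expR (2 * a * (T - s))))
    (G := fun s => a * K * expR (2 * a * (T - s))) tT _ _ _ bf).
  - by move=> s; apply: cvgN; apply: (continuous_rev (continuous_exp (c := K / 2) (a := 2 * a))).
  - exact: (continuous_rev (continuous_exp (c := a * K) (a := 2 * a))).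
  - move=> s; rewrite (_ : a * K * _ = - - (K / 2 * (2 * a * expR (2 * a * (T - s))))).
      apply: has_derivN; apply: (has_deriv_rev (F := fun s : R => K / 2 * expR (2 * a * s))).
      exact: has_deriv_exp.
    by field.
  - by move=> s sI; rewrite -mulrA fK.
by rewrite opprK addrC gerBl mulr_ge0 ?expR_ge0// divr_ge0.
Qed.

Section operator_family.
Context (P : R -> V -> V).
Context (P_op : forall t, t \in `[0, T] -> bounded_operator (P t))
  (P_cont : forall x, {within `[0, T], continuous (P ^~ x)}).

(** Orbits are continuous on a compact interval, hence bounded, and
Banach-Steinhaus makes the bound uniform. *)
Lemma family_bound : exists2 M, 0 < M & forall t x, t \in `[0, T] -> `|P t x| <= M * `|x|.
Proof.
have [|x|M M0 PM] := @uniform_boundedness R V R (fun t => P (clamp T t)).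
- by move=> t; apply: P_op; exact: clamp_itv (ltW T0).
- have cn : {within `[0, T], continuous (fun t => `|P t x|)}.
    by move=> t; apply: cvg_norm; exact: P_cont.
  have [C C0 PC] := continuous_bounded (ltW T0) cn.
  by exists C => t; apply: PC; exact: clamp_itv (ltW T0).
- by exists M => // t x tT; rewrite -{1}(clamp_id tT).
Qed.

Lemma family_comp_continuous (u : R -> V) : continuous u ->
  continuous (fun s => P (clamp T s) (u s)).
Proof.
have [M M0 PM] := family_bound; move=> cu t.
apply: (cvg_op (K := fun s => P (clamp T s)) (F := nbhs t) (M := M) _ _ (cu t) _).
- by move=> s; exact: (P_op (clamp_itv _ (ltW T0))).1.
- by near=> s => x; apply: PM; exact: clamp_itv (ltW T0).
- exact: (clamp_continuous (ltW T0) (@P_cont _)).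
Unshelve. all: by end_near. Qed.

Lemma family_lin t : t \in `[0, T] -> linear (P t).
Proof. by move=> tT; exact: (P_op tT).1. Qed.

Let rev_itv s : s \in `[0, T] -> T - s \in `[0, T].
Proof. by rewrite !in_itv /= subr_ge0 gerBl andbC. Qed.

Lemma rev_clamp s : s \in `[0, T] -> clamp T (T - s) = T - s.
Proof. by move=> /rev_itv /clamp_id. Qed.

Lemma family_rev_continuous (u : R -> V) : continuous u ->
  continuous (fun s => P (clamp T (T - s)) (u s)).
Proof.
move=> cu; have c1 := continuous_rev (a := T) cu.
have := continuous_rev (a := T) (family_comp_continuous c1).
rewrite (_ : (fun s => _) = (fun s => P (clamp T (T - s)) (u s)))//.
by apply/funext => s /=; rewrite subKr.
Qed.

Lemma semigroup_comp_shift (u : R -> V) t : continuous u ->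
  continuous (fun s => E (s - t) (u s)).
Proof.
move=> cu; have c1 := continuous_affine (a := t) (c := 1) cu.
have := continuous_affine (a := - t) (c := 1) (semigroup_comp_continuous AS c1).
rewrite (_ : (fun s => _) = (fun s => E (s - t) (u s)))//.
by apply/funext => s /=; rewrite !mul1r addrC (addrC t) subrK.
Qed.

Lemma semigroup_comp_rev (u : R -> V) t : continuous u ->
  continuous (fun s => E (t - s) (u s)).
Proof.
move=> cu; have c1 := continuous_rev (a := t) cu.
have := continuous_rev (a := t) (semigroup_comp_continuous AS c1).
rewrite (_ : (fun s => _) = (fun s => E (t - s) (u s)))//.
by apply/funext => s /=; rewrite subKr.
Qed.

Lemma feedforward_rev_unique f r r' :
  {within `[0, T], continuous r} -> {within `[0, T], continuous r'} ->
  (forall t, t \in `[0, T] -> r t = bochner_integral t T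
      (fun s => S (s - t) (P (T - s) f - P (T - s) (r s)))) ->
  (forall t, t \in `[0, T] -> r' t = bochner_integral t T
      (fun s => S (s - t) (P (T - s) f - P (T - s) (r' s)))) ->
  forall t, t \in `[0, T] -> r' t = r t.
Proof.
move=> cr cr' rE r'E.
have [ME ME0 EM] := ext_semigroup_bound AS T.
have [M M0 PM] := family_bound.
pose a := ME * M.
have aE X : a * X = ME * (M * X) by rewrite /a mulrA.
have a0 : 0 <= a by rewrite mulr_ge0// ltW.
pose F (q : R -> V) t s := S (s - t) (P (T - s) f - P (T - s) (q s)).
have bF q t : {within `[0, T], continuous q} -> t \in `[0, T] ->
    bochner_integrable t T (F q t).
  move=> cq; rewrite in_itv /= => /andP[t0 tT].
  pose G s := E (s - t) (P (clamp T (T - s)) (f - q (clamp T s))).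
  apply: (@bochner_integrable_eq _ _ _ _ G).
    move=> s; rewrite in_itv /= => /andP[ts sT].
    have sI : s \in `[0, T] by rewrite in_itv /= (le_trans t0 ts).
    rewrite /G /F (clamp_id sI) rev_clamp// ES ?subr_ge0//.
    by rewrite (linB (family_lin (rev_itv sI))).
  apply: bochner_integrable_continuous; apply: semigroup_comp_shift.
  apply: family_rev_continuous => s; apply: cvgB; first exact: cvg_cst.
  exact: (clamp_continuous (ltW T0) cq).
pose phi t := `|r' t - r t|.
have cphi : {within `[0, T], continuous phi}.
  by move=> t; apply: cvg_norm; apply: cvgB; [exact: cr'|exact: cr].
have [C C0 phiC] := continuous_bounded (ltW T0) cphi.
suff H t : t \in `[0, T] -> phi t <= 0.
  move=> t /H; rewrite /phi normr_le0 subr_eq0 => /eqP; exact.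
apply: (@halving_le0 _ _ (fun t => t \in `[0, T]) phi (fun t => expR (2 * a * (T - t))) C).
- exact: C0.
- move=> s sI; rewrite (le_trans (phiC s sI))// ler_peMr//.
  rewrite -expR0 ler_expR; apply: mulr_ge0; first by rewrite mulr_ge0.
  by have := rev_itv sI; rewrite in_itv /= => /andP[].
move=> K K0 HK s sI; have := sI; rewrite in_itv /= => /andP[s0 sT].
rewrite /phi r'E// rE// -(bochner_integralB ip); [|exact: bF|exact: bF].
apply: volterra_backward => //; first by apply: bochner_integrableB; exact: bF.
move=> q; rewrite in_itv /= => /andP[sq qT].
have qI : q \in `[0, T] by rewrite in_itv /= (le_trans s0 sq).
rewrite -ES ?subr_ge0// -(linB (E_lin _)) opprD addrACA subrr add0r opprK
  [- P _ _ + _]addrC.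
rewrite -(linB (family_lin (rev_itv qI))).
rewrite (le_trans (EM _ _ _))//; first by rewrite lerBlDr (le_trans qT)// lerDl.
rewrite aE ler_pM2l// (le_trans (PM _ _ (rev_itv qI)))// ler_pM2l//.
by rewrite distrC; exact: HK.
Qed.

Lemma forward_unique (g : R -> V) y0 y y' :
  {within `[0, T], continuous g} ->
  {within `[0, T], continuous y} -> {within `[0, T], continuous y'} ->
  (forall t, t \in `[0, T] -> y t = S t y0 + bochner_integral 0 t
      (fun s => S (t - s) (- P (T - s) (y s) + g s))) ->
  (forall t, t \in `[0, T] -> y' t = S t y0 + bochner_integral 0 t
      (fun s => S (t - s) (- P (T - s) (y' s) + g s))) ->
  forall t, t \in `[0, T] -> y' t = y t.
Proof.
move=> cg cy cy' yE y'E.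
have [ME ME0 EM] := ext_semigroup_bound AS T.
have [M M0 PM] := family_bound.
pose a := ME * M.
have aE X : a * X = ME * (M * X) by rewrite /a mulrA.
have a0 : 0 <= a by rewrite mulr_ge0// ltW.
pose F (q : R -> V) t s := S (t - s) (- P (T - s) (q s) + g s).
have bF q t : {within `[0, T], continuous q} -> t \in `[0, T] ->
    bochner_integrable 0 t (F q t).
  move=> cq; rewrite in_itv /= => /andP[t0 tT].
  pose G s := E (t - s) (- P (clamp T (T - s)) (q (clamp T s)) + g (clamp T s)).
  apply: (@bochner_integrable_eq _ _ _ _ G).
    move=> s; rewrite in_itv /= => /andP[s0 st].
    have sI : s \in `[0, T] by rewrite in_itv /= s0 (le_trans st tT).
    by rewrite /G /F (clamp_id sI) rev_clamp// ES ?subr_ge0.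
  apply: bochner_integrable_continuous; apply: semigroup_comp_rev.
  move=> s; apply: cvgD; last exact: (clamp_continuous (ltW T0) cg).
  apply: cvgN; apply: (family_rev_continuous (u := fun s => q (clamp T s))).
  exact: (clamp_continuous (ltW T0) cq).
pose phi t := `|y' t - y t|.
have cphi : {within `[0, T], continuous phi}.
  by move=> t; apply: cvg_norm; apply: cvgB; [exact: cy'|exact: cy].
have [C C0 phiC] := continuous_bounded (ltW T0) cphi.
suff H t : t \in `[0, T] -> phi t <= 0.
  move=> t /H; rewrite /phi normr_le0 subr_eq0 => /eqP; exact.
apply: (@halving_le0 _ _ (fun t => t \in `[0, T]) phi (fun t => expR (2 * a * t)) C).
- exact: C0.
- move=> s sI; rewrite (le_trans (phiC s sI))// ler_peMr//.
  rewrite -expR0 ler_expR; apply: mulr_ge0; first by rewrite mulr_ge0.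
  by move: sI; rewrite in_itv /= => /andP[].
move=> K K0 HK s sI; have := sI; rewrite in_itv /= => /andP[s0 sT].
rewrite /phi y'E// yE// opprD addrACA subrr add0r.
rewrite -(bochner_integralB ip); [|exact: bF|exact: bF].
apply: volterra_forward => //; first by apply: bochner_integrableB; exact: bF.
move=> q; rewrite in_itv /= => /andP[q0 qs].
have qI : q \in `[0, T] by rewrite in_itv /= q0 (le_trans qs).
rewrite -ES ?subr_ge0// -(linB (E_lin _)) opprD addrACA subrr addr0 opprK
  [- P _ _ + _]addrC.
rewrite -(linB (family_lin (rev_itv qI))).
rewrite (le_trans (EM _ _ _))//; first by rewrite lerBlDr (le_trans sT)// lerDl.
rewrite aE ler_pM2l// (le_trans (PM _ _ (rev_itv qI)))// ler_pM2l//.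
by rewrite distrC; exact: HK.
Qed.

Lemma closed_loop_unique (q : R -> V) f y0 y y' :
  {within `[0, T], continuous q} ->
  {within `[0, T], continuous y} -> {within `[0, T], continuous y'} ->
  (forall t, t \in `[0, T] -> y t = S t y0 + bochner_integral 0 t
      (fun s => S (t - s) (- P (T - s) (y s) - q s + f))) ->
  (forall t, t \in `[0, T] -> y' t = S t y0 + bochner_integral 0 t
      (fun s => S (t - s) (- P (T - s) (y' s) - q s + f))) ->
  forall t, t \in `[0, T] -> y' t = y t.
Proof.
move=> cq cy cy' yE y'E.
have cg : {within `[0, T], continuous (fun s => - q s + f)}.
  by move=> t; apply: cvgD; [apply: cvgN; exact: cq|exact: cvg_cst].
have e (z : R -> V) t :
    (fun s => S (t - s) (- P (T - s) (z s) - q s + f)) =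
    (fun s => S (t - s) (- P (T - s) (z s) + (- q s + f))).
  by apply/funext => s; rewrite addrA.
apply: (forward_unique (y0 := y0) cg cy cy') => t tI.
  by rewrite {1}(yE t tI); congr (_ + bochner_integral _ _ _); exact: e.
by rewrite {1}(y'E t tI); congr (_ + bochner_integral _ _ _); exact: e.
Qed.

End operator_family.

(** With a common bound on the two solutions, the difference of squares
[P P - P' P'] is [P (P - P') + (P - P') P'], so the difference satisfies a
linear Volterra inequality. *)
Lemma riccati_unique (L0 : R -> V -> V) (P P' : R -> V -> V) :
  (forall t, t \in `[0, T] -> bounded_operator (P t)) ->
  (forall x, {within `[0, T], continuous (P ^~ x)}) ->
  (forall t, t \in `[0, T] -> bounded_operator (P' t)) ->
  (forall x, {within `[0, T], continuous (P' ^~ x)}) ->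
  (forall t x, t \in `[0, T] -> P t x = L0 t x - bochner_integral 0 t
      (fun s => S (t - s) (P s (P s (S (t - s) x))))) ->
  (forall t x, t \in `[0, T] -> P' t x = L0 t x - bochner_integral 0 t
      (fun s => S (t - s) (P' s (P' s (S (t - s) x))))) ->
  forall t, t \in `[0, T] -> P' t = P t.
Proof.
move=> oP cP oP' cP' PE P'E.
have [ME ME0 EM] := ext_semigroup_bound AS T.
have [M1 M10 PM1] := family_bound oP cP.
have [M2 M20 PM2] := family_bound oP' cP'.
pose a := ME * ((M1 + M2) * ME).
have aE X : a * X = ME * ((M1 + M2) * (ME * X)) by rewrite /a !mulrA.
have a0 : 0 <= a by rewrite !mulr_ge0// ?addr_ge0// ltW.
pose F (Q : R -> V -> V) t x s := S (t - s) (Q s (Q s (S (t - s) x))).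
have bF Q t x : (forall t, t \in `[0, T] -> bounded_operator (Q t)) ->
    (forall x, {within `[0, T], continuous (Q ^~ x)}) -> t \in `[0, T] ->
    bochner_integrable 0 t (F Q t x).
  move=> oQ cQ; rewrite in_itv /= => /andP[t0 tT].
  pose G s := E (t - s) (Q (clamp T s) (Q (clamp T s) (E (t - s) x))).
  apply: (@bochner_integrable_eq _ _ _ _ G).
    move=> s; rewrite in_itv /= => /andP[s0 st].
    have sI : s \in `[0, T] by rewrite in_itv /= s0 (le_trans st tT).
    by rewrite /G /F (clamp_id sI) ES ?subr_ge0.
  apply: bochner_integrable_continuous; apply: semigroup_comp_rev.
  apply: family_comp_continuous => //; apply: family_comp_continuous => //.
  exact: (continuous_rev (f := E ^~ x) (@E_cont x)).
suff H i : i.1 \in `[0, T] -> `|P' i.1 i.2 - P i.1 i.2| <= 0.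
  move=> t tI; apply/funext => x; have := H (t, x) tI; rewrite /=.
  by rewrite normr_le0 subr_eq0 => /eqP.
apply: (@halving_le0 _ _ (fun i : R * V => i.1 \in `[0, T])
  (fun i => `|P' i.1 i.2 - P i.1 i.2|) (fun i => expR (2 * a * i.1) * `|i.2|) (M1 + M2)).
- by rewrite addr_ge0// ltW.
- move=> [s x] /= sI; rewrite (le_trans (ler_normB _ _))//.
  apply: (@le_trans _ _ ((M1 + M2) * `|x|)).
    by rewrite mulrDl addrC lerD// ?PM1 ?PM2.
  apply: ler_wpM2l; first by rewrite addr_ge0// ltW.
  rewrite ler_peMl//.
  rewrite -expR0 ler_expR; apply: mulr_ge0; first by rewrite mulr_ge0.
  by move: sI; rewrite in_itv /= => /andP[].
move=> K K0 HK [s x] /= sI; have := sI; rewrite in_itv /= => /andP[s0 sT].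
rewrite P'E// PE// opprB addrC addrA subrK distrC.
rewrite -(bochner_integralB ip); [|exact: bF|exact: bF].
rewrite (_ : K / 2 * _ = (K * `|x|) / 2 * expR (2 * a * s)); last by field.
apply: volterra_forward => //; first by rewrite mulr_ge0.
  by apply: bochner_integrableB; exact: bF.
move=> q; rewrite in_itv /= => /andP[q0 qs].
have qI : q \in `[0, T] by rewrite in_itv /= q0 (le_trans qs).
have sqT : s - q <= T by rewrite lerBlDr (le_trans sT)// lerDl.
rewrite /F -ES ?subr_ge0// -(linB (E_lin _)).
rewrite (le_trans (EM _ _ sqT))// aE ler_pM2l//.
set z := E (s - q) x; set w := expR _.
have zM : `|z| <= ME * `|x| by exact: EM.
have KD v : `|P q v - P' q v| <= K * (w * `|v|) by rewrite distrC; exact: (HK (q, v)).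
have Kw : 0 <= K * w by rewrite mulr_ge0// expR_ge0.
rewrite distrC -(subrKA (P q (P' q z))) -(linB (oP _ qI).1) (le_trans (ler_normD _ _))//.
apply: (@le_trans _ _ (M1 * (K * w * `|z|) + K * w * (M2 * `|z|))).
  apply: lerD.
    by rewrite (le_trans (PM1 _ _ qI))// ler_pM2l// -mulrA KD.
  by rewrite (le_trans (KD _))// mulrA ler_wpM2l// PM2.
rewrite (mulrCA (K * w)) -mulrDl; apply: ler_wpM2l; first by rewrite addr_ge0// ltW.
rewrite (_ : ME * (K * `|x| * w) = K * w * (ME * `|x|)); last by ring.
by rewrite ler_wpM2l.
Qed.

End uniqueness.

(** * Optimality and the optimal value *)

Lemma le_1Dsqr {R : realType} (a : R) : a <= 1 + a ^+ 2.
Proof. by have := sqr_ge0 (a - 1); nra. Qed.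

Lemma split_combine {R : realType} (A B C I J K c : R) :
  A = B + C - 2 * c -> I = J + (2 * c + K) -> A + I = B + J + (C + K).
Proof. by move=> -> ->; ring. Qed.

Lemma le_of_split {R : realType} (a b c : R) : b = a + c -> 0 <= c -> a <= b.
Proof. by move=> -> c0; rewrite lerDl. Qed.

Lemma le0_of_split {R : realType} (a b c : R) : b = a + c -> b <= a -> c <= 0.
Proof. by move=> ->; rewrite gerDl. Qed.

Section optimality.
Context {R : realType} {V : completeNormedModType R} (dot : V -> V -> R).
Context (ip : inner_product dot).
Context (S : R -> V -> V) (A : V -> V -> Prop).
Context (AS : generates A S).
Context (symA : forall v w v' w', A v w -> A v' w' -> dot w v' = dot v w').
Context (gamma : R).
Context (gamma0 : 0 < gamma).
Context (h Ah x0 : V) (T : R).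
Context (hA : A h Ah) (T0 : 0 < T).

Local Notation leb := (@lebesgue_measure R).
Local Notation E := (ext_semigroup S).
Local Notation Q := (gramian S).
Local Notation N := (resolvent ip AS symA gamma0).
Local Notation P := (riccati ip AS symA gamma0).
Local Notation p := (final_adjoint ip AS symA gamma0 h x0 T).
Local Notation k := (gap S h).
Local Notation rho := (feedforward ip AS symA gamma0 h).
Local Notation r := (feedforward_rev ip AS symA gamma0 h T).
Let f := - Ah.
Let E_op t : bounded_operator (E t) := ext_semigroup_op AS t.
Let E_lin t : linear (E t) := ext_semigroup_lin AS t.
Let E_cont x : continuous (E ^~ x) := @ext_semigroup_continuous _ _ _ _ AS x.
Let E0 := ext_semigroup0 AS.
Let ED := ext_semigroupD AS.
Let ES := @ext_semigroupE _ _ S.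
Let E_sym := semigroup_sym ip AS symA.
Let T0' : 0 <= T := ltW T0.

Let mI : measurable (`[0, T]%classic : set (measurableTypeR R)).
Proof. exact: measurable_itv. Qed.

Local Notation ctrl u := (strongly_measurable 0 T u /\
  (\int[leb]_(t in `[0%R, T]) (`|u t| ^+ 2)%:E < +oo)%E).
Local Notation final u := (S T x0 + bochner_integral 0 T (fun s => S (T - s) (u s))).
Local Notation objective u := (gamma * `|final u - h| ^+ 2 +
  \int[leb]_(t in `[0, T]) (`|u t| ^+ 2)).

Lemma sqr_normB_le (x y : V) : `|x - y| ^+ 2 <= 2 * `|x| ^+ 2 + 2 * `|y| ^+ 2.
Proof.
by have := sqr_ge0 (`|x + y| : R); rewrite (sqr_normD ip) (sqr_normB ip); lra.
Qed.

Lemma scaled_sqr_norm_split (a b q z : V) : gamma *: (b - z) = - q ->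
  gamma * `|a - z| ^+ 2 =
  gamma * `|b - z| ^+ 2 + gamma * `|a - b| ^+ 2 - 2 * dot (a - b) q.
Proof.
move=> bz; have e : gamma * dot (a - b) (b - z) = - dot (a - b) q.
  by rewrite -(dotZr ip) bz (dotNr ip).
rewrite -(subrKA b a (- z)) (sqr_normD ip) !mulrDr (mulrCA gamma 2) e.
by ring.
Qed.

Lemma control_sqr_integrable (u : R -> V) : ctrl u ->
  leb.-integrable `[0, T] (EFin \o (fun t => `|u t| ^+ 2)).
Proof.
move=> [su iu]; apply/integrableP; split.
  apply/measurable_EFinP; apply: measurable_funX.
  exact: strongly_measurable_norm.
by under eq_integral do rewrite /= ger0_norm ?sqr_ge0//.
Qed.

Lemma control_integrable (u : R -> V) : ctrl u -> bochner_integrable 0 T u.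
Proof.
move=> cu; have iu := control_sqr_integrable cu.
have c1 : leb.-integrable `[0, T] (EFin \o (fun=> 1 : R)).
  by apply: continuous_integrable => t; exact: cvg_cst.
apply: (bochner_integrable_le cu.1 (RintegrableD mI c1 iu)) => t _.
exact: le_1Dsqr.
Qed.

(** On a bounded interval square integrability implies integrability, and the
semigroup is bounded there. *)
Lemma control_image_integrable (u : R -> V) : ctrl u ->
  bochner_integrable 0 T (fun s => S (T - s) (u s)).
Proof.
move=> cu; have bu := control_integrable cu.
have [M M0 EM] := ext_semigroup_bound AS T.
apply: (@bochner_integrable_eq _ _ _ _ (fun s => E (T - s) (u s))).
  by move=> s; rewrite in_itv /= => /andP[_ sT]; rewrite ES// subr_ge0.
apply: (bochner_integrable_le _ (RintegrableZl mI M bu.2)).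
  apply: (strongly_measurable2 (phi := fun (s : R) v => E (T - s) v) _ bu.1).
    exact: strongly_measurable_id.
  move=> t s v; rewrite in_itv /= => /andP[t0 tT] st vt.
  have [M' M'0 EM'] := ext_semigroup_bound AS (T - t + 1).
  apply: (cvg_op (K := fun n => E (T - s n)) (M := M') _ _ vt).
  - by move=> n; exact: E_lin.
  - have := st; move/cvgrPdist_le => /(_ 1 ltr01); apply: filterS => n sn x.
    apply: EM'; have := ler_norm (t - s n); lra.
  - have c : continuous (fun q => E (T - q) (u t)).
      exact: (continuous_rev (f := E ^~ (u t)) (@E_cont _)).
    exact: (cvg_comp s _ st (@c t)).
move=> t; rewrite in_itv /= => /andP[t0 tT]; apply: EM.
by rewrite gerBl.
Qed.

Context (u : R -> V).
Context (uE : forall t, t \in `[0, T] -> u t = E (T - t) p).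

Let us t := E (T - t) p.

Let us_cont : continuous us.
Proof. exact: (continuous_rev (f := E ^~ p) (@E_cont _)). Qed.

Let us_sqr_cont : continuous (fun t => `|us t| ^+ 2).
Proof.
move=> t; have c : (fun t => `|us t|) @ nbhs t --> `|us t|.
  by apply: cvg_norm; exact: us_cont.
exact: (cvgM c c).
Qed.

Lemma optimal_control_admissible : ctrl u.
Proof.
split.
  apply: (@strongly_measurable_eq _ _ _ _ us); first by move=> t /uE ->.
  exact: strongly_measurable_continuous.
have iu : leb.-integrable `[0, T] (EFin \o (fun t => `|u t| ^+ 2)).
  apply: (Rintegrable_eq mI _ (continuous_integrable 0 T us_sqr_cont)).
  by move=> t tI; rewrite uE.
exact: (integrable_lty mI iu).
Qed.

(** The stationarity condition: [x(T) - h = Q(T) p - (h - S(T) x0)], and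
[gamma (h - S(T) x0)] is [p + gamma Q(T) p]. *)
Lemma optimal_final : gamma *: (final u - h) = - p.
Proof.
rewrite (@bochner_FTC _ _ _ ip (fun s => - Q (T - s) p) (fun s => E (2 * (T - s)) p) _ 0 T T0').
- rewrite (subrr T) (gramian0 ip AS) oppr0 add0r opprK subr0 -(ES T0').
  rewrite (_ : E T x0 + _ - h = Q T p - (h - E T x0)); last first.
    by rewrite opprB addrA (addrC (Q T p)).
  by rewrite scalerBr (final_adjointE ip AS symA gamma0) opprD addrCA subrr addr0.
- move=> s; apply: cvgN.
  exact: (continuous_rev (@gramian_continuous _ _ _ ip _ _ AS p)).
- have c : continuous (fun s : R => E (2 * s) p).
    by apply: (semigroup2_comp_continuous AS (u := fun=> p)) => q; exact: cvg_cst.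
  exact: (continuous_rev c).
- move=> s /andP[s0 sT]; rewrite -[E _ p]opprK; apply: has_derivN.
  apply: (has_deriv_rev (F := Q ^~ p)).
  by apply: (has_deriv_gramian ip AS); rewrite subr_gt0.
- move=> s sI; have := sI; rewrite in_itv /= => /andP[s0 sT].
  by rewrite (uE sI) -ES ?subr_ge0// -ED ?subr_ge0// mulr_natl mulr2n.
Qed.

(** Expanding both squares around [u], the cross terms are
[2 gamma <D, x_u(T) - h> = - 2 <D, p>] and [2 int <v - u, u> = 2 <D, p>], where [D] is the
difference of the final states, because [u(t) = S(T - t) p]. *)
Lemma objective_split (v : R -> V) : ctrl v ->
  leb.-integrable `[0, T] (EFin \o (fun t => `|v t - u t| ^+ 2)) /\
  objective v = objective u +
    (gamma * `|final v - final u| ^+ 2 + \int[leb]_(t in `[0, T]) `|v t - u t| ^+ 2).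
Proof.
move=> cv; have cu := optimal_control_admissible.
have iv := control_sqr_integrable cv; have iu := control_sqr_integrable cu.
have iw : leb.-integrable `[0, T] (EFin \o (fun t => `|v t - u t| ^+ 2)).
  apply: (Rintegrable_le mI _ (RintegrableD mI (RintegrableZl mI 2 iv)
      (RintegrableZl mI 2 iu))).
    apply: measurable_funX; apply: strongly_measurable_norm.
    exact: strongly_measurableB cv.1 cu.1.
  by move=> t _; rewrite ger0_norm ?sqr_ge0// sqr_normB_le.
have ic : leb.-integrable `[0, T] (EFin \o (fun t => dot (v t - u t) (us t))).
  apply: (Rintegrable_eq mI (f := fun t => 2^-1 * (`|v t| ^+ 2 - `|u t| ^+ 2 - `|v t - u t| ^+ 2))).
    move=> t tI; rewrite /us -(uE tI) -{1}(subrK (u t) (v t)) (sqr_normD ip).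
    by field.
  by apply: RintegrableZl => //; do 2 apply: RintegrableB => //.
have bv := control_image_integrable cv; have bu := control_image_integrable cu.
pose D := final v - final u.
have DE : dot D p = \int[leb]_(t in `[0, T]) dot (v t - u t) (us t).
  have -> : D = bochner_integral 0 T (fun s => S (T - s) (v s) - S (T - s) (u s)).
    by rewrite (bochner_integralB ip bv bu) /D opprD addrACA subrr add0r.
  rewrite (bochner_dot ip p (bochner_integrableB bv bu)).
  apply: eq_Rintegral => t; rewrite inE /= in_itv /= => /andP[t0 tT].
  by rewrite -ES ?subr_ge0// -(linB (E_lin _)) E_sym.
have energy : \int[leb]_(t in `[0, T]) (`|v t| ^+ 2) =
    \int[leb]_(t in `[0, T]) (`|u t| ^+ 2) +
    (2 * dot D p + \int[leb]_(t in `[0, T]) (`|v t - u t| ^+ 2)).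
  have i2 := RintegrableZl mI 2 ic.
  rewrite DE -RintegralZl// -RintegralD// -RintegralD//; last exact: RintegrableD.
  apply: eq_Rintegral => t; rewrite inE => tI.
  by rewrite -{1}(subrK (u t) (v t)) (sqr_normD ip) /us -(uE tI); ring.
split; first exact: iw.
have target := scaled_sqr_norm_split (final v) optimal_final.
exact: (split_combine target energy).
Qed.

Lemma objective_min (v : R -> V) : ctrl v -> objective u <= objective v.
Proof.
move=> cv; have [_ e] := objective_split cv; apply: (le_of_split e).
apply: addr_ge0; first by rewrite mulr_ge0 ?sqr_ge0// ltW.
by apply: Rintegral_ge0 => t _; rewrite sqr_ge0.
Qed.

Lemma objective_unique (v : R -> V) : ctrl v -> objective v <= objective u ->
  {ae leb, forall t, t \in `[0, T] -> v t = u t}.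
Proof.
move=> cv; have [iw e] := objective_split cv => /(le0_of_split e) le0.
have w0 : \int[leb]_(t in `[0, T]) `|v t - u t| ^+ 2 = 0.
  apply/eqP; rewrite eq_le; apply/andP; split; last first.
    by apply: Rintegral_ge0 => t _; rewrite sqr_ge0.
  by apply: le_trans le0; rewrite lerDr mulr_ge0 ?sqr_ge0// ltW.
have : (\int[leb]_(t in `[0%R, T]) `|(`|v t - u t| ^+ 2)%:E|)%E = 0%E.
  under eq_integral do rewrite gee0_abs ?lee_fin ?sqr_ge0//.
  by rewrite -[LHS]fineK ?(integrable_fin_num mI iw)// -[fine _]/(Rintegral _ _ _) w0.
move/(ae_eq_integral_abs _ mI); move: iw => /integrableP[mw _] /(_ mw).
apply: filterS => t H tI; have [] := H tI => /eqP.
by rewrite sqrf_eq0 normr_eq0 subr_eq0 => /eqP.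
Qed.

(** The integrand is minus the derivative in [t] of
[gamma <N(s) k(s), k(s)>] at [s = T - t]: differentiating [N] gives the term
[- |r| ^ 2], and the two factors [k] together give [2 <r, f>]. *)
Lemma quadratic_gap :
  \int[leb]_(t in `[0, T]) (2 * dot (r t) f - `|r t| ^+ 2) =
  gamma * dot (N T (k T)) (k T).
Proof.
have cr : continuous r by exact: feedforward_rev_continuous.
have cNk : continuous (fun s => N s (k s)).
  by apply: resolvent_comp_continuous; exact: (gap_continuous AS).
pose c s := gamma * dot (N s (k s)) (k s).
have cc : continuous c.
  move=> s; apply: cvgM; first exact: cvg_cst.
  by apply: (cvg_dot ip); [exact: cNk|exact: (gap_continuous AS)].
rewrite (@FTC_real _ (fun t => - c (T - t)) _ 0 T T0').
- rewrite subrr subr0 opprK /c /gap E0 subrr (dot0r ip) mulr0.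
  by rewrite oppr0 add0r.
- by move=> s; apply: cvgN; exact: (continuous_rev cc).
- move=> s; apply: cvgB.
    apply: cvgM; first exact: cvg_cst.
    by apply: (cvg_dot ip); [exact: cr|exact: cvg_cst].
  have n : (fun t => `|r t|) @ nbhs s --> `|r s| by apply: cvg_norm; exact: cr.
  exact: (cvgM n n).
move=> t /andP[t0 tT]; have s0 : 0 < T - t by rewrite subr_gt0.
set s := T - t in s0 *.
have dk := has_deriv_gap AS hA s0.
have dN := @has_deriv_resolvent_comp _ _ _ ip _ _ AS symA _ gamma0 _ _ _ s0 dk.
have := has_deriv_dot ip dN dk.
move/(has_derivZ (c := gamma)) => H.
have {H} := has_derivN (has_deriv_rev (F := c) H).
rewrite opprK (_ : _ *: _ = 2 * dot (r t) f - `|r t| ^+ 2)//.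
rewrite -[LHS]/(gamma * _) -/f /feedforward_rev -/s /feedforward.
have e1 v : dot (N s v) (k s) = dot (N s (k s)) v.
  by rewrite resolvent_sym (dotC ip).
have e2 : dot (E s (N s (k s))) (E s (N s (k s))) =
    dot (N s (k s)) (E (2 * s) (N s (k s))).
  by rewrite E_sym -(ED _ (ltW s0) (ltW s0)) mulr_natl mulr2n.
rewrite -(dot_self ip) (dotDl ip) !(dotZl ip) !(dotZr ip) !e1 e2 E_sym.
by ring.
Qed.

Lemma optimal_energy : \int[leb]_(t in `[0, T]) (`|u t| ^+ 2) = dot (Q T p) p.
Proof.
transitivity (\int[leb]_(t in `[0, T]) dot (E (2 * (T - t)) p) p).
  apply: eq_Rintegral => t; rewrite inE => tI; have := tI; rewrite /= in_itv /= => /andP[t0 tT].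
  have s0 : 0 <= T - t by rewrite subr_ge0.
  by rewrite (uE tI) -(dot_self ip) E_sym -(ED _ s0 s0) (dotC ip) mulr_natl mulr2n.
rewrite (@FTC_real _ (fun t => - dot (Q (T - t) p) p) _ 0 T T0').
- by rewrite (subrr T) (gramian0 ip AS) (dot0l ip) subr0 oppr0 add0r opprK.
- move=> t; apply: cvgN; apply: (cvg_dot ip); last exact: cvg_cst.
  exact: (continuous_rev (@gramian_continuous _ _ _ ip _ _ AS p)).
- move=> t; apply: (cvg_dot ip); last exact: cvg_cst.
  have c : continuous (fun s : R => E (2 * s) p).
    by apply: (semigroup2_comp_continuous AS (u := fun=> p)) => q; exact: cvg_cst.
  exact: (continuous_rev c).
- move=> t /andP[t0 tT]; rewrite -[dot (E _ p) p]opprK; apply: has_derivN.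
  rewrite -(dotNl ip); apply: (has_deriv_dotl ip).
  apply: (has_deriv_rev (F := Q ^~ p)).
  by apply: (has_deriv_gramian ip AS); rewrite subr_gt0.
Qed.

(** The cost is [gamma^-1 |p| ^ 2 + <Q(T) p, p> = <z, p>] with
[z = h - S(T) x0], that is [gamma <N(T) z, z>], and
[z = S(T) y0 + k(T)]. *)
Lemma optimal_value (y0 := h - x0) : objective u =
  dot (P T y0) y0 + 2 * dot (r 0) y0 +
  \int[leb]_(t in `[0, T]) (2 * dot (r t) f - `|r t| ^+ 2).
Proof.
have gN0 : gamma != 0 by rewrite gt_eqF.
rewrite quadratic_gap optimal_energy; set z := h - E T x0.
have zE : z = E T y0 + k T.
  by rewrite /z /y0 /gap (linB (E_lin T)) [RHS]addrC addrA subrK.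
have gz : gamma *: z = p + gamma *: Q T p by exact: final_adjointE.
have -> : gamma * `|final u - h| ^+ 2 = gamma^-1 * dot p p.
  have -> : final u - h = - (gamma^-1 *: p).
    by rewrite -scalerN -optimal_final scalerA mulVf// scale1r.
  by rewrite normrN -(dot_self ip) (dotZl ip) (dotZr ip); field.
have -> : gamma^-1 * dot p p + dot (Q T p) p = dot z p.
  have -> : z = gamma^-1 *: (p + gamma *: Q T p).
    by rewrite -gz scalerA mulVf// scale1r.
  by rewrite (dotZl ip gamma^-1) (dotDl ip) (dotZl ip gamma); field.
have -> : dot (P T y0) y0 = gamma * dot (N T (E T y0)) (E T y0).
  rewrite /riccati (dotZl ip) mulr_natl mulr2n (ED _ T0' T0') E_sym.
  by rewrite (resolventC ip AS symA gamma0).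
have -> : dot (r 0) y0 = gamma * dot (N T (k T)) (E T y0).
  by rewrite /feedforward_rev subr0 /feedforward (dotZl ip) E_sym.
have -> : dot z p = gamma * dot (N T z) z.
  by rewrite /final_adjoint -/z (dotZr ip) (dotC ip).
rewrite zE; move: (E T y0) (k T) => Y K.
rewrite (linD (resolvent_lin ip AS symA gamma0 T)) !(dotDl ip) !(dotDr ip).
rewrite (resolvent_sym ip AS symA gamma0 T Y K) (dotC ip Y (N T K)).
by ring.
Qed.

End optimality.

(** * The Neumann problem *)

(** Green's formula, which is part of the definition of the domain, expresses
both sides through the same products of weak gradients. *)
Lemma neumann_op_sym {R : realType} (Xi : set (R * R)) (oXi : open Xi) (rho : R)
    (v w v' w' : L2dom oXi) :
  neumann_op rho v w -> neumann_op rho v' w' -> L2dot w v' = L2dot v w'.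
Proof.
have ip := L2dot_inner (domain_measure oXi).
move=> [g [Lv [gv _ Lg ->]]] [g' [Lv' [gv' _ Lg' ->]]].
rewrite (dotBl ip) (dotBr ip) (dotZl ip) (dotZr ip) (Lg _ _ gv').
by rewrite (dotC ip v Lv') (Lg' _ _ gv) !(dotC ip g'.1) !(dotC ip g'.2).
Qed.

Theorem proposition12 (R : realType) (T rho : R) (hT : 0 < T) (hrho : 0 < rho)
  (Xi : set (R * R)) (oXi : open Xi) (bXi : bounded_set Xi)
  (rXi : regular_boundary Xi)
  (S : R -> L2dom oXi -> L2dom oXi)
  (hS : generates (@neumann_op R Xi oXi rho) S)
  (gamma : R) (hgamma : 0 < gamma)
  (x0 h Ah : L2dom oXi) (hAh : neumann_op rho h Ah) :
  let f : L2dom oXi := - Ah in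
  let y0 : L2dom oXi := h - x0 in
  exists (P : R -> L2dom oXi -> L2dom oXi)
         (r y : R -> L2dom oXi),
  let u : R -> L2dom oXi := fun t => P (T - t) (y t) + r t in
  [/\ is_unique_on T (riccati_solution S T gamma) P,
      is_unique_on T (backward_solution S T P f) r,
      is_unique_on T (closed_loop_solution S T P r f y0) y,
      optimal_control S T gamma h x0 u /\
      (forall v, optimal_control S T gamma h x0 v ->
         {ae (@lebesgue_measure R), forall t, t \in `[0, T] -> v t = u t}) &
      cost S T gamma h x0 u =
        L2dot (P T y0) y0 + 2 * L2dot (r 0) y0
        + \int[@lebesgue_measure R]_(t in `[0, T])
            (2 * L2dot (r t) f - `|r t| ^+ 2)].
Proof.
move=> f y0.
have ip := L2dot_inner (domain_measure oXi).
have symA := @neumann_op_sym R Xi oXi rho.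
pose P := riccati ip hS symA hgamma.
pose r := feedforward_rev ip hS symA hgamma h T.
pose y := closed_loop ip hS symA hgamma h x0 T.
exists P, r, y => u.
have itvP t : t \in `[0, T] -> 0 <= t /\ t <= T by rewrite in_itv /= => /andP[].
have P_op t : t \in `[0, T] -> bounded_operator (P t) by move=> _; exact: riccati_op.
have P_cont x : {within `[0, T], continuous (P ^~ x)}.
  by apply: continuous_subspaceT; exact: riccati_continuous.
have cr : {within `[0, T], continuous r}.
  by apply: continuous_subspaceT; exact: feedforward_rev_continuous.
have cy : {within `[0, T], continuous y}.
  by apply: continuous_subspaceT; exact: closed_loop_continuous.
have rE t : t \in `[0, T] -> r t = bochner_integral t T
    (fun s => S (s - t) (P (T - s) f - P (T - s) (r s))).
  by move=> /itvP[t0 tT]; exact: feedforward_rev_equation.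
have PE t x : t \in `[0, T] -> P t x = gamma *: S (2 * t) x -
    bochner_integral 0 t (fun s => S (t - s) (P s (P s (S (t - s) x)))).
  by move=> /itvP[t0 tT]; exact: riccati_equation.
have yE t : t \in `[0, T] -> y t = S t y0 + bochner_integral 0 t
    (fun s => S (t - s) (- P (T - s) (y s) - r s + f)).
  by move=> /itvP[t0 tT]; exact: closed_loop_equation.
have uE t : t \in `[0, T] ->
    u t = ext_semigroup S (T - t) (final_adjoint ip hS symA hgamma h x0 T).
  by move=> /itvP[t0 tT]; exact: feedback.
have cu : control T u by exact: optimal_control_admissible uE.
split.
- split; first by split => // t x z _; exact: riccati_sym.
  move=> P' [P'_op P'_cont _ P'E] t tI.
  exact: (riccati_unique ip hS hT P_op P_cont P'_op P'_cont PE P'E).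
- split; first by split.
  move=> r' [cr' r'E] t tI.
  exact: (feedforward_rev_unique ip hS hT P_op P_cont cr cr' rE r'E).
- split; first by split.
  move=> y' [cy' y'E] t tI.
  exact: (closed_loop_unique ip hS hT P_op P_cont cr cy cy' yE y'E).
- split.
    by split=> // v cv; exact: (objective_min hT uE cv).
  move=> v [cv vmin]; exact: (objective_unique hT uE cv (vmin u cu)).
- exact: (optimal_value hAh hT uE).
Qed.
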